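(* Let the Gaussian fully connected network, the inputs $\{x_\alpha\}_{\alpha\in A}$, and all the notation be as in the context, and assume: (i) $\sigma$ is continuous and bounded; (ii) there exist $\widehat{\ell}\in\{1,\ldots,L\}$ and $\gamma_1,\ldots,\gamma_L\in[1,\infty]$ such that $\lim_{n\to\infty} n_\ell(n)/n_{\widehat{\ell}}(n)=\gamma_\ell$ for all $\ell=1,\ldots,L$; set $v_n^*:=n_{\widehat{\ell}}(n)$. Then the sequence of $\mathbb{R}^{|A|\times n_{L+1}}$-valued random variables $\{(Z_h^{(L+1)}(x_\alpha)/\sqrt{v_n^*})_{\alpha\in A,\,h=1,\ldots,n_{L+1}}\}_n$ satisfies the large deviation principle on $\mathbb{R}^{|A|\times n_{L+1}}$ with speed $v_n^*$ and good rate function $$I_{Z^{(L+1)}(\underline{x})}(z):=\inf_{g^{(L)}\in\mathcal{S}_{|A|,C_b},\,r\in\mathbb{R}^{|A|\times n_{L+1}}}\{I_{G^{(L)}(\underline{x})}(g^{(L)})+\|r\|^2/2:\ g^{(L),\#}r=z\},$$ where $\|\cdot\|$ is the Euclidean norm on $\mathbb{R}^{|A|\times n_{L+1}}$, $g^{(L),\#}r$ is the matrix product $(\sum_{\gamma\in A}g^{(L),\#}_{\alpha\gamma}r_{\gamma h})_{\alpha h}$, $$I_{G^{(L)}(\underline{x})}(g^{(L)}):=\inf\Big\{\sum_{\ell=1}^L J(g^{(\ell)}|g^{(\ell-1)}):\ g^{(0)}=g^{(0)}(\underline{x}),\ g^{(1)},\ldots,g^{(L-1)}\in\mathcal{S}_{|A|,C_b}\Big\}\quad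 (g^{(L)}\in\mathcal{S}_{|A|,C_b}),$$ and, for $g^{(\ell-1)},g^{(\ell)}\in\mathcal{S}_{|A|,C_b}$, $$J(g^{(\ell)}|g^{(\ell-1)}):=\begin{cases}\gamma_\ell\,\kappa^*\big(\tfrac{g^{(\ell)}-C_b\mathbf{1}}{C_W};g^{(\ell-1)}\big)&\text{if }\gamma_\ell<\infty,\\ \Delta\big(g^{(\ell)};C_b\mathbf{1}+C_W y(g^{(\ell-1)})\big)&\text{if }\gamma_\ell=\infty.\end{cases}$$
   Context: Fix integers $L\ge1$, $n_0\ge1$, $n_{L+1}\ge1$, constants $C_b\ge0$, $C_W>0$ and a function $\sigma:\mathbb{R}\to\mathbb{R}$. For each $n\ge1$ let $n_1(n),\ldots,n_L(n)$ be positive integers with $n_\ell(n)\to\infty$ as $n\to\infty$ (write $n_\ell=n_\ell(n)$). The network is defined, for $x=(x_1,\ldots,x_{n_0})\in\mathbb{R}^{n_0}$, by $Z_i^{(1)}(x)=b_i^{(1)}+\sum_{r=1}^{n_0}W^{(1)}_{ir}x_r$ ($i=1,\ldots,n_1$) and $Z_i^{(\ell+1)}(x)=b_i^{(\ell+1)}+\sum_{j=1}^{n_\ell}W^{(\ell+1)}_{ij}\sigma(Z_j^{(\ell)}(x))$ ($i=1,\ldots,n_{\ell+1}$, $1\le\ell\le L$), where all biases $b_i^{(\ell)}$ are centered Normal with variance $C_b$ (degenerate at $0$ if $C_b=0$), all weights $W_{ij}^{(\ell+1)}$ ($0\le\ell\le L$) are centered Normal with variance $C_W/n_\ell$, and all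 these random variables are independent. Let $A$ be a finite set and $x_\alpha=(x_{\alpha,1},\ldots,x_{\alpha,n_0})\in\mathbb{R}^{n_0}$, $\alpha\in A$, fixed inputs; $\underline{x}$ denotes $\{x_\alpha\}_{\alpha\in A}$. Notation: for a symmetric positive semidefinite matrix $q=(q_{\alpha\beta})_{\alpha,\beta\in A}$, $q^\#$ is its unique symmetric positive semidefinite square root ($q^\#q^\#=q$). $\mathbf{1}$ is the $A\times A$ matrix with all entries $1$. $\mathcal{S}_{|A|,C_b}$ is the set of symmetric positive semidefinite $A\times A$ matrices $q$ such that $q-C_b\mathbf{1}$ is also positive semidefinite. Let $(N_\gamma)_{\gamma\in A}$ be i.i.d. standard Normal and $\langle q^\#_{\alpha\cdot},N_\cdot\rangle:=\sum_{\gamma\in A}q^\#_{\alpha\gamma}N_\gamma$. For $\eta\in\mathbb{R}^{A\times A}$, $\kappa(\eta;q):=\log\mathbb{E}[\exp(\sum_{\alpha,\beta\in A}\eta_{\alpha\beta}\sigma(\langle q^\#_{\alpha\cdot},N_\cdot\rangle)\sigma(\langle q^\#_{\beta\cdot},N_\cdot\rangle))]$ and $\kappa^*(y;q):=\sup_{\eta\in\mathbb{R}^{A\times A}}\{\langle\eta,y\rangle-\kappa(\eta;q)\}$ with $\langle\eta,y\rangle=\sum_{\alpha,\beta}\eta_{\alpha\beta}y_{\alpha\beta}$. $y(q)$ is the $A\times A$ matrix with entries $y_{\alpha\beta}(q):=\mathbb{E}[\sigma(\langle q^\#_{\alpha\cdot},N_\cdot\rangle)\sigma(\langle q^\#_{\beta\cdot},N_\cdot\rangle)]$.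 $g^{(0)}(\underline{x})$ is the $A\times A$ matrix with entries $C_b+\frac{C_W}{n_0}\sum_{r=1}^{n_0}x_{\alpha,r}x_{\beta,r}$. For $\bar g\in\mathcal{S}_{|A|,C_b}$, $\Delta(g;\bar g):=0$ if $g=\bar g$ and $+\infty$ otherwise. A sequence of random variables satisfies the LDP with speed $v_n\to\infty$ and rate function $I$ (lower semicontinuous, values in $[0,\infty]$) if $\limsup\frac1{v_n}\log P(\cdot\in C)\le-\inf_C I$ for closed $C$ and $\liminf\frac1{v_n}\log P(\cdot\in O)\ge-\inf_O I$ for open $O$; $I$ is good if its sublevel sets are compact. *)

(* Defs.v *)
From HB Require Import structures.
From mathcomp Require Import all_boot all_order all_algebra.
From mathcomp Require Import all_classical all_reals all_analysis.
Set Implicit Arguments. Unset Strict Implicit. Unset Printing Implicit Defensive.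
Import Order.TTheory GRing.Theory Num.Theory.
Import numFieldNormedType.Exports.
Local Open Scope classical_set_scope.
Local Open Scope ring_scope.

Section Defs.
Context {R : realType}.

(* law of a centered Normal with variance v (degenerate at 0 if v = 0);
   normal_prob m s is parameterized by the standard deviation s *)
Definition gauss_law (v : R) : set R -> \bar R :=
  if v == 0 then (\d_(0 : R) : set R -> \bar R) else normal_prob 0 (Num.sqrt v).

Definition centered_gaussian {d} {Omega : measurableType d}
  (P : probability Omega R) (X : Omega -> R) (v : R) : Prop :=
  measurable_fun setT X /\
  forall B : set R, measurable B -> P (X @^-1` B) = gauss_law v B.

Definition mutually_independent {d} {Omega : measurableType d}
  (P : probability Omega R) {I : eqType} (D : set I) (X : I -> Omega -> R) : Prop :=
  (forall i, D i -> measurable_fun setT (X i)) /\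
  forall (s : seq I) (B : I -> set R), uniq s -> (forall i, i \in s -> D i) ->
    (forall i, measurable (B i)) ->
    fine (P (\bigcap_(i in [set j | j \in s]) (X i @^-1` B i)))
      = \prod_(i <- s) fine (P (X i @^-1` B i)).

Definition elog (x : \bar R) : \bar R :=
  match x with
  | r%:E => if (r <= 0)%R then -oo%E else (ln r)%:E
  | +oo%E => +oo%E
  | -oo%E => -oo%E
  end.

Definition rate_function {T : topologicalType} (I : T -> \bar R) : Prop :=
  (forall z, (0 <= I z)%E) /\ lower_semicontinuous I.

Definition good_rate_function {T : topologicalType} (I : T -> \bar R) : Prop :=
  rate_function I /\ forall a : R, compact [set z | (I z <= a%:E)%E].

Definition LDP {d} {Omega : measurableType d} (P : probability Omega R)
  {T : topologicalType} (v : nat -> R) (Y : nat -> Omega -> T) (I : T -> \bar R) : Prop :=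
  rate_function I /\
  (forall C : set T, closed C ->
     (limn_esup (fun n => ((v n)^-1)%:E * elog (P (Y n @^-1` C)))
       <= - ereal_inf (I @` C))%E) /\
  (forall O : set T, open O ->
     (- ereal_inf (I @` O)
       <= limn_einf (fun n => ((v n)^-1)%:E * elog (P (Y n @^-1` O))))%E).

Definition psd {k} (q : 'M[R]_k) : Prop :=
  q^T = q /\ forall v : 'cV[R]_k, 0 <= (v^T *m q *m v) 0 0.

Definition msqrt {k} (q : 'M[R]_k) : 'M[R]_k :=
  xget 0 [set s : 'M[R]_k | psd s /\ s *m s = q].

Definition SCb {k} (Cb : R) (q : 'M[R]_k) : Prop :=
  psd q /\ psd (q - Cb *: const_mx 1).

(* giter m f = E[f(N_0,...,N_{m-1},0,0,...)], N_i i.i.d. standard normal,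
   computed as an iterated integral *)
Fixpoint giter (m : nat) (f : (nat -> R) -> \bar R) : \bar R :=
  match m with
  | 0 => f (fun _ => 0)
  | m'.+1 => (\int[normal_prob 0 1]_t
                giter m' (fun v => f (fun i => if i == m' then t else v i)))%E
  end.

Definition gexp (k : nat) (f : ('I_k -> R) -> \bar R) : \bar R :=
  giter k (fun v => f (fun i : 'I_k => v (nat_of_ord i))).

Definition qN {k} (q : 'M[R]_k) (N : 'I_k -> R) (a : 'I_k) : R :=
  \sum_(c < k) msqrt q a c * N c.

Definition kappa (sigma : R -> R) {k} (eta q : 'M[R]_k) : \bar R :=
  elog (gexp (fun N => (expR (\sum_(a < k) \sum_(b < k)
          eta a b * sigma (qN q N a) * sigma (qN q N b)))%:E)).

Definition kappa_star (sigma : R -> R) {k} (y q : 'M[R]_k) : \bar R :=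
  ereal_sup (range (fun eta : 'M[R]_k =>
     ((\sum_(a < k) \sum_(b < k) eta a b * y a b)%:E - kappa sigma eta q)%E)).

Definition ymat (sigma : R -> R) {k} (q : 'M[R]_k) : 'M[R]_k :=
  \matrix_(a, b) fine (gexp (fun N => (sigma (qN q N a) * sigma (qN q N b))%:E)).

Definition Delta {k} (g gbar : 'M[R]_k) : \bar R := if g == gbar then 0%E else +oo%E.

Definition Jcond (sigma : R -> R) (Cb CW : R) (gam : \bar R) {k} (g' g : 'M[R]_k) : \bar R :=
  match gam with
  | +oo%E => Delta g' (Cb *: const_mx 1 + CW *: ymat sigma g)
  | _ => let y := CW^-1 *: (g' - Cb *: const_mx 1) in
         (gam * kappa_star sigma y g)%E
  end.

Definition g0mat {k n0} (Cb CW : R) (x : 'M[R]_(k, n0)) : 'M[R]_k :=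
  \matrix_(a, b) (Cb + CW / n0%:R * \sum_(r < n0) x a r * x b r).

Definition IG (sigma : R -> R) (Cb CW : R) (L : nat) (gam : nat -> \bar R)
  {k} (g0 gL : 'M[R]_k) : \bar R :=
  ereal_inf [set (\sum_(1 <= l < L.+1) Jcond sigma Cb CW (gam l) (gs l) (gs l.-1))%E
            | gs in [set gs : nat -> 'M[R]_k |
                       gs 0%N = g0 /\ gs L = gL /\
                       forall l, (1 <= l < L)%N -> SCb Cb (gs l)]].

Definition sqnorm {m n} (r : 'M[R]_(m, n)) : R := \sum_(i < m) \sum_(j < n) r i j ^+ 2.

Definition IZ (sigma : R -> R) (Cb CW : R) (L : nat) (gam : nat -> \bar R)
  {k n0 nL1} (x : 'M[R]_(k, n0)) (z : 'M[R]_(k, nL1)) : \bar R :=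
  ereal_inf [set e | exists (g : 'M[R]_k) (r : 'M[R]_(k, nL1)),
     SCb Cb g /\ msqrt g *m r = z /\
     e = (IG sigma Cb CW L gam (g0mat Cb CW x) g + (sqnorm r / 2)%:E)%E].

Definition width (n0 nL1 L : nat) (nn : nat -> nat -> nat) (n l : nat) : nat :=
  if l == 0%N then n0 else if l == L.+1 then nL1 else nn n l.

(* preactivations Z^{(l)}_i(x) for l >= 1, given realized biases b l i
   and weights W l i j; wd l is the width of layer l *)
Fixpoint netZ (sigma : R -> R) (wd : nat -> nat) (b : nat -> nat -> R)
  (W : nat -> nat -> nat -> R) {n0} (x : 'I_n0 -> R) (l : nat) : nat -> R :=
  match l with
  | 0 => fun _ => 0
  | 1 => fun i => b 1%N i + \sum_(r < n0) W 1%N i r * x r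
  | l'.+1 => fun i => b l i + \sum_(j < wd l') W l i j * sigma (netZ sigma wd b W x l' j)
  end.

End Defs.

(* Main.v *)
(* Write G^(l) for the empirical covariance C_b + C_W / n_l * (sum of sigma(Z_j) sigma(Z_j)^T)
   of layer l. Given the earlier layers, the neurons of layer l + 1 are i.i.d. centered
   Gaussian vectors with covariance G^(l), so that on every event defined by G^(l) the
   exponential moment of n_(l+1) <eta, G^(l+1)> is that of n_(l+1) kappa(eta; G^(l)).
   From this identity and the continuity of kappa(eta; .) one gets, for G^(l) close to g, the
   upper bound for G^(l+1) close to g' by Chebyshev's inequality, and the lower bound by
   tilting with an approximate maximiser eta, the tilted law being concentrated near the
   gradient of kappa(.; g) by Chebyshev's inequality again. As G^(l) stays in a compact set,
   these local bounds propagate from layer to layer by a union bound and add up to I_(G^(L)).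
   The output layer is one more step of the same kind, with the Gaussian cumulant function
   1/2 T^T g T, whose Legendre transform is the infimum of |r|^2 / 2 over g^# r = z.
   Local bounds together with exponential tightness give the large deviation principle, and
   also the lower semicontinuity and the compact sublevel sets of the rate function.

   Averaging over the incoming weights of a neuron gives iterated one-dimensional Gaussian
   integrals along a list of vectors a_i; by invariance of the standard Gaussian measure under
   plane rotations these depend only on the matrix sum a_i a_i^T, which is how kappa arises. *)
Require Import Defs.
From HB Require Import structures.
From mathcomp Require Import all_boot all_order all_algebra.
From mathcomp Require Import all_classical all_reals all_analysis.
From mathcomp Require Import measurable_realfun ring lra.
Set Implicit Arguments.
Unset Strict Implicit.
Unset Printing Implicit Defensive.
Import Order.TTheory GRing.Theory Num.Theory.
Import numFieldNormedType.Exports.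
Local Open Scope classical_set_scope.
Local Open Scope ring_scope.

(** * Lebesgue and Gaussian integrals *)

Section LebesgueAffine.
Context {R : realType}.
Notation mu := (@lebesgue_measure R).

Lemma lebesgue_measure_affine (c d : R) (A : set R) : 0 < c -> measurable A ->
  (c%:E * pushforward mu (fun x : R => (c * x + d)%R : measurableTypeR R) A = mu A)%E.
Proof.
move=> c0 mA.
have mh : measurable_fun setT (fun x : R => c * x + d : measurableTypeR R).
  by apply: measurable_funD => //; exact: measurable_funM.
rewrite (@lebesgue_measure_unique R (mscale (NngNum (ltW c0))
  (pushforward mu (fun x : R => c * x + d : measurableTypeR R)))) //= => _ [[a b]] _ <-.
rewrite /mscale /= /pushforward.
have -> : (fun x : R => c * x + d) @^-1` `]a, b]%classic = `](a - d) / c, (b - d) / c]%classic.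
  apply/seteqP; split => x /=; rewrite !in_itv /= => /andP[h1 h2]; apply/andP; split.
  - by rewrite ltr_pdivrMr// ltrBlDr mulrC.
  - by rewrite ler_pdivlMr// lerBrDr mulrC.
  - by move: h1; rewrite ltr_pdivrMr// ltrBlDr mulrC.
  - by move: h2; rewrite ler_pdivlMr// lerBrDr mulrC.
rewrite !lebesgue_measure_itv/= !lte_fin ltr_pM2r ?invr_gt0// ltrD2r.
case: ifP => _; last by rewrite mule0.
rewrite -!EFinB -EFinM; congr (_%:E); field; lra.
Qed.

Lemma ge0_integral_affine_pos (f : R -> \bar R) (c d : R) : 0 < c ->
  measurable_fun setT f -> (forall x, 0 <= f x)%E ->
  (c%:E * \int[mu]_x f (c * x + d)%R = \int[mu]_x f x)%E.
Proof.
move=> c0 mf f0.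
have mh : measurable_fun setT (fun x : R => c * x + d : measurableTypeR R).
  by apply: measurable_funD => //; exact: measurable_funM.
pose h := fun x : R => c * x + d : measurableTypeR R.
transitivity (c%:E * \int[pushforward mu h]_x f x)%E.
  by rewrite ge0_integral_pushforward.
rewrite -(ge0_integral_mscale (pushforward mu h) measurableT (NngNum (ltW c0)))//.
apply: eq_measure_integral => A mA _.
exact: lebesgue_measure_affine.
Qed.

Lemma ge0_integral_opp (f : R -> \bar R) :
  measurable_fun setT f -> (forall x, 0 <= f x)%E ->
  (\int[mu]_x f (- x)%R = \int[mu]_x f x)%E.
Proof.
move=> mf f0.
transitivity (\int[pushforward mu (-%R : R -> measurableTypeR R)]_x f x)%E.
  by rewrite ge0_integral_pushforward.
by apply: eq_measure_integral => A mA _; rewrite /= lebesgue_measureN.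
Qed.

Lemma ge0_integral_affine (f : R -> \bar R) (c d : R) : c != 0 ->
  measurable_fun setT f -> (forall x, 0 <= f x)%E ->
  (`|c|%:E * \int[mu]_x f (c * x + d)%R = \int[mu]_x f x)%E.
Proof.
move=> c0 mf f0; case: (ltrgtP c 0) c0 => // c0 _; last first.
  by rewrite gtr0_norm// ge0_integral_affine_pos.
rewrite ltr0_norm// -(@ge0_integral_affine_pos f (- c) d) ?oppr_gt0//; congr *%E.
rewrite -[LHS]ge0_integral_opp//; last first.
  apply: (measurableT_comp mf); apply: measurable_funD => //; exact: measurable_funM.
by apply: eq_integral => x _; congr f; ring.
Qed.

End LebesgueAffine.

Section LebesgueIntegral.
Context {R : realType}.
Notation pR := (R * R)%type.

(* Sealing the integral behind a constant keeps the two convertible measurable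
   structures on [R] ([R] itself and [measurableTypeR R]) out of unification. *)
Definition leb (f : R -> \bar R) : \bar R := (\int[@lebesgue_measure R]_x f x)%E.

Lemma leb_affine (f : R -> \bar R) (c d : R) : c != 0 ->
  measurable_fun setT f -> (forall x, 0 <= f x)%E ->
  (`|c|%:E * leb (fun x => f (c * x + d)%R) = leb f)%E.
Proof. exact: ge0_integral_affine. Qed.

Lemma leb_swap (h : R -> R -> \bar R) :
  measurable_fun setT (fun p : pR => h p.1 p.2) -> (forall x y, 0 <= h x y)%E ->
  leb (fun x => leb (h x)) = leb (fun y => leb (h ^~ y)).
Proof.
by move=> mh h0; exact: (@fubini_tonelli _ _ _ _ _ lebesgue_measure lebesgue_measure
  (fun p : pR => h p.1 p.2)).
Qed.

Lemma measurable_leb (h : R -> R -> \bar R) :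
  measurable_fun setT (fun p : pR => h p.1 p.2) -> (forall x y, 0 <= h x y)%E ->
  measurable_fun setT (fun x => leb (h x)).
Proof.
by move=> mh h0; exact: (@measurable_fun_fubini_tonelli_F _ _ _ _ _ lebesgue_measure
  (fun p : pR => h p.1 p.2)).
Qed.

Lemma leb_ge0 (f : R -> \bar R) : (forall x, 0 <= f x)%E -> (0 <= leb f)%E.
Proof. by move=> f0; apply: integral_ge0. Qed.

Lemma lebZl (k : \bar R) (f : R -> \bar R) : (0 <= k)%E ->
  measurable_fun setT f -> (forall x, 0 <= f x)%E ->
  leb (fun x => k * f x)%E = (k * leb f)%E.
Proof. by move=> k0 mf f0; exact: ge0_integralZl. Qed.

Lemma eq_leb (f g : R -> \bar R) : f =1 g -> leb f = leb g.
Proof. by move=> fg; apply: eq_integral => x _; rewrite fg. Qed.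

Lemma measurable_fun_uncurry d (T : measurableType d) (h : R -> R -> \bar R) (f1 f2 : T -> R) :
  measurable_fun setT (fun p : pR => h p.1 p.2) ->
  measurable_fun setT f1 -> measurable_fun setT f2 ->
  measurable_fun setT (fun t => h (f1 t) (f2 t)).
Proof.
move=> mh m1 m2; apply: (measurableT_comp (f := fun p : pR => h p.1 p.2)
    (g := fun t => (f1 t, f2 t)) mh); exact: measurable_fun_pair.
Qed.

Lemma leb_rot (h : R -> R -> \bar R) (c s : R) :
  measurable_fun setT (fun p : pR => h p.1 p.2) -> (forall x y, 0 <= h x y)%E ->
  c ^+ 2 + s ^+ 2 = 1 ->
  leb (fun x => leb (fun y => h (c * x + s * y) (- s * x + c * y))) =
  leb (fun x => leb (h x)).
Proof.
move=> mh h0 cs.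
have mF1 a b : measurable_fun setT (fun p : pR => a * p.1 + b * p.2).
  by apply: measurable_funD; apply: measurable_funM.
have [c0|c0] := eqVneq c 0.
  have s0 : s != 0.
    by apply: contra_eq_neq cs => ->; rewrite c0 expr0n/= addr0 eq_sym oner_eq0.
  have s1 : `|s| = 1.
    apply/eqP; rewrite -(@eqrXn2 _ 2)// expr1n.
    by rewrite real_normK ?num_real// -cs c0 expr0n/= add0r.
  transitivity (leb (fun x => leb (fun y => h y (- s * x)))).
    apply: eq_leb => x.
    rewrite -[RHS](@leb_affine (h ^~ (- s * x)) s 0).
    - by rewrite s1 mul1e; apply: eq_leb => y; rewrite c0 mul0r add0r addr0 mul0r addr0.
    - exact: s0.
    - by apply: (measurable_fun_uncurry mh).
    - by move=> y; exact: h0.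
  rewrite (leb_swap (h := fun x y => h y (- s * x))); first last.
  - by move=> x y; exact: h0.
  - apply: (measurable_fun_uncurry mh) => //; exact: measurable_funM.
  apply: eq_leb => x; rewrite -[RHS](@leb_affine _ (- s) 0).
  - by rewrite normrN s1 mul1e; apply: eq_leb => y; rewrite addr0.
  - by rewrite oppr_eq0.
  - by apply: (measurable_fun_uncurry mh).
  - by move=> y; exact: h0.
rewrite (leb_swap (h := fun x y => h (c * x + s * y) (- s * x + c * y))); first last.
- by move=> x y; exact: h0.
- by apply: (measurable_fun_uncurry mh); exact: mF1.
pose k (y u : R) := h u (y / c - s / c * u).
have k0 y u : (0 <= k y u)%E by exact: h0.
have mk d (T : measurableType d) (f1 f2 : T -> R) :
    measurable_fun setT f1 -> measurable_fun setT f2 ->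
    measurable_fun setT (fun t => k (f1 t) (f2 t)).
  move=> m1 m2; apply: (measurable_fun_uncurry mh) => //.
  by apply: measurable_funB; exact: measurable_funM.
have c'0 : (0 <= (`|c|^-1)%:E)%E by rewrite lee_fin invr_ge0.
transitivity (leb (fun y => `|c|^-1%:E * leb (k y)))%E.
  apply: eq_leb => y.
  rewrite -(@leb_affine (k y) c (s * y)) //; last exact: mk.
  rewrite muleA -EFinM mulVf ?normr_eq0// mul1e; apply: eq_leb => x.
  rewrite /k; congr h.
  transitivity (- s * x + (1 - s ^+ 2) / c * y); last by field.
  by rewrite -cs addrK expr2 mulfK.
rewrite lebZl //; last 2 first.
- by apply: measurable_leb => //; exact: mk.
- by move=> y; exact: leb_ge0.
rewrite (leb_swap (h := k)) //; last exact: mk.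
rewrite -lebZl //; last 2 first.
- apply: (measurable_leb (h := fun x y => k y x)) => //; exact: mk.
- by move=> y; exact: leb_ge0.
apply: eq_leb => u.
rewrite -(@leb_affine (h u) c^-1 (- (s / c * u))).
- by rewrite normrV ?unitfE//; congr *%E; apply: eq_leb => y; rewrite /k mulrC.
- by rewrite invr_eq0.
- by apply: (measurable_fun_uncurry mh).
- by move=> y; exact: h0.
Qed.

End LebesgueIntegral.

Section StandardNormal.
Context {R : realType}.
Notation phi := (normal_pdf (0 : R) 1).
Notation pR := (R * R)%type.

Definition gint (f : R -> \bar R) : \bar R := (\int[normal_prob 0 1]_x f x)%E.

Lemma measurable_phi : measurable_fun setT (fun x => (phi x)%:E).
Proof. by apply/measurable_EFinP; exact: measurable_normal_pdf. Qed.

Lemma gintE (f : R -> \bar R) :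
  measurable_fun setT f -> (forall x, 0 <= f x)%E ->
  gint f = leb (fun x => f x * (phi x)%:E)%E.
Proof.
move=> mf f0; have dom := normal_prob_dominates (0 : R) 1.
have mphi := measurable_phi.
rewrite /gint /leb -(Radon_Nikodym_SigmaFinite.change_of_variables dom)//.
set g := Radon_Nikodym_SigmaFinite.f _ _.
have mg : measurable_fun setT g.
  exact: measurable_int (Radon_Nikodym_SigmaFinite.f_integrable dom).
have g0 x : (0 <= g x)%E by exact: Radon_Nikodym_SigmaFinite.f_ge0.
apply: ge0_ae_eq_integral => //.
- exact: emeasurable_funM.
- exact: emeasurable_funM.
- by move=> x _; exact: mule_ge0.
- by move=> x _; rewrite mule_ge0// lee_fin normal_pdf_ge0.
apply: ae_eqe_mul2l; apply: integral_ae_eq => //.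
- exact: Radon_Nikodym_SigmaFinite.f_integrable.
- by move=> A _ mA; rewrite -Radon_Nikodym_SigmaFinite.f_integral.
Qed.

Lemma gint_ge0 (f : R -> \bar R) : (forall x, 0 <= f x)%E -> (0 <= gint f)%E.
Proof. by move=> f0; apply: integral_ge0. Qed.

Lemma eq_gint (f g : R -> \bar R) : f =1 g -> gint f = gint g.
Proof. by move=> fg; apply: eq_integral => x _; rewrite fg. Qed.

Lemma gintZl (k : \bar R) (f : R -> \bar R) : (0 <= k)%E ->
  measurable_fun setT f -> (forall x, 0 <= f x)%E ->
  gint (fun x => k * f x)%E = (k * gint f)%E.
Proof. by move=> k0 mf f0; exact: ge0_integralZl. Qed.

Lemma measurable_gint d (T : measurableType d) (h : T -> R -> \bar R) :
  measurable_fun setT (fun p : T * R => h p.1 p.2) -> (forall x y, 0 <= h x y)%E ->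
  measurable_fun setT (fun x => gint (h x)).
Proof.
by move=> mh h0; exact: (@measurable_fun_fubini_tonelli_F _ _ _ _ _ (normal_prob 0 1)
  (fun p : T * R => h p.1 p.2)).
Qed.

Lemma normal01_pdfE (x : R) : phi x = phi 0 * expR (- (x ^+ 2) / 2).
Proof.
rewrite normal_pdfE ?oner_eq0// /normal_fun !subr0 expr0n/= oppr0 mul0r expR0 mulr1.
by rewrite expr1n.
Qed.

Lemma normal01_pdf_rot (c s x y : R) : c ^+ 2 + s ^+ 2 = 1 ->
  phi (c * x + s * y) * phi (- s * x + c * y) = phi x * phi y.
Proof.
move=> cs; rewrite (normal01_pdfE (_ + _)) (normal01_pdfE (- s * _ + _)).
rewrite (normal01_pdfE x) (normal01_pdfE y) (mulrACA (phi 0)) [in RHS](mulrACA (phi 0)) -!expRD.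
congr (_ * expR _).
transitivity (- (c ^+ 2 + s ^+ 2) * (x ^+ 2 + y ^+ 2) / 2); first by field.
by rewrite cs; field.
Qed.

Lemma gint_rot (h : R -> R -> \bar R) (c s : R) :
  measurable_fun setT (fun p : pR => h p.1 p.2) -> (forall x y, 0 <= h x y)%E ->
  c ^+ 2 + s ^+ 2 = 1 ->
  gint (fun x => gint (fun y => h (c * x + s * y) (- s * x + c * y))) =
  gint (fun x => gint (h x)).
Proof.
move=> mh h0 cs.
have mF1 a b : measurable_fun setT (fun p : pR => a * p.1 + b * p.2).
  by apply: measurable_funD; apply: measurable_funM.
have key (g : R -> R -> \bar R) : measurable_fun setT (fun p : pR => g p.1 p.2) ->
    (forall x y, 0 <= g x y)%E ->
    gint (fun x => gint (g x)) = leb (fun x => leb (fun y => g x y * (phi x * phi y)%R%:E)%E).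
  move=> mg g0; rewrite gintE; last 2 first.
  - exact: measurable_gint.
  - by move=> x; exact: gint_ge0.
  apply: eq_leb => x; rewrite gintE; last 2 first.
  - exact: (measurable_fun_uncurry mg).
  - by move=> y; exact: g0.
  rewrite muleC -lebZl.
  - by apply: eq_leb => y; rewrite EFinM muleCA.
  - by rewrite lee_fin normal_pdf_ge0.
  - apply: emeasurable_funM; last exact: measurable_phi.
    exact: (measurable_fun_uncurry mg).
  - by move=> y; rewrite mule_ge0// lee_fin normal_pdf_ge0.
rewrite (key (fun x y => h (c * x + s * y) (- s * x + c * y))); last 2 first.
- by apply: (measurable_fun_uncurry mh); exact: mF1.
- by move=> x y; exact: h0.
rewrite [RHS](key _ mh h0) -[RHS](leb_rot (c := c) (s := s)
  (h := fun x y => h x y * (phi x * phi y)%R%:E)%E); last 3 first.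
- apply: emeasurable_funM; first exact: mh.
  apply/measurable_EFinP; apply: measurable_funM; apply: measurableT_comp => //; exact: measurable_normal_pdf.
- by move=> x y; rewrite mule_ge0// lee_fin mulr_ge0// normal_pdf_ge0.
- exact: cs.
apply: eq_leb => x; apply: eq_leb => y; by rewrite normal01_pdf_rot.
Qed.

Lemma gint_cst (k : \bar R) : (0 <= k)%E -> gint (cst k) = k.
Proof.
move=> k0; rewrite /gint integral_cst//= -[normal_prob _ _ _]/(normal_prob (0 : R) 1 setT).
by rewrite probability_setT mule1.
Qed.

Lemma normal01_mgf (c : R) : gint (fun x => (expR (c * x))%:E) = (expR (c ^+ 2 / 2))%:E.
Proof.
have mphi := measurable_phi.
rewrite gintE; last 2 first.
- by apply/measurable_EFinP; apply: measurableT_comp => //; exact: measurable_funM.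
- by move=> x; rewrite lee_fin expR_ge0.
transitivity (leb (fun x => (expR (c ^+ 2 / 2))%:E * (phi (1 * x + - c))%:E)%E).
  apply: eq_leb => x; rewrite -!EFinM; congr (_%:E).
  rewrite (normal01_pdfE (1 * x - c)) (normal01_pdfE x) mulrCA [in RHS]mulrCA -!expRD.
  by congr (_ * expR _); field.
rewrite lebZl; last 3 first.
- by rewrite lee_fin expR_ge0.
- apply: (measurableT_comp (f := fun x => (phi x)%:E)) => //.
  by apply: measurable_funD => //; exact: measurable_funM.
- by move=> x; rewrite lee_fin normal_pdf_ge0.
have := leb_affine (f := fun x => (phi x)%:E) (- c) (oner_neq0 R).
rewrite normr1 mul1e => -> //; first by rewrite /leb integral_normal_pdf mule1.
by move=> x; rewrite lee_fin normal_pdf_ge0.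
Qed.

End StandardNormal.

Section GaussianVectors.
Context {R : realType} {k : nat}.
Implicit Types (l : seq 'cV[R]_k) (psi : 'cV[R]_k -> \bar R) (x a : 'cV[R]_k).

(* Measurability on ['cV_k], phrased without choosing a sigma-algebra there. *)
Definition vmeas psi : Prop :=
  forall d (T : measurableType d) (x : T -> 'cV[R]_k),
    (forall i, measurable_fun setT (fun t => x t i 0)) ->
    measurable_fun setT (fun t => psi (x t)).

(* Expectation of [psi (x + \sum_(a <- l) N_a *: a)], the [N_a] being independent
   standard Normal variables. *)
Fixpoint Eg l psi x : \bar R :=
  if l is a :: l' then gint (fun t => Eg l' psi (x + t *: a)) else psi x.

Definition cov l : 'M[R]_k := \sum_(a <- l) a *m a^T.

Lemma Eg_ge0 l psi x : (forall y, 0 <= psi y)%E -> (0 <= Eg l psi x)%E.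
Proof.
by move=> p0; elim: l x => [|a l IH] x //=; apply: gint_ge0.
Qed.

Lemma measurable_Eg psi d (T : measurableType d) (I : Type) (l : seq I)
    (a : I -> T -> 'cV[R]_k) (x : T -> 'cV[R]_k) :
  vmeas psi -> (forall y, 0 <= psi y)%E ->
  (forall i j, measurable_fun setT (fun t => a i t j 0)) ->
  (forall i, measurable_fun setT (fun t => x t i 0)) ->
  measurable_fun setT (fun t => Eg [seq a i t | i <- l] psi (x t)).
Proof.
move=> mpsi p0; elim: l d T a x => [|i l IH] d T a x ma mx /=; first exact: mpsi.
apply: (measurable_gint (h := fun t u => Eg [seq a i t | i <- l] psi (x t + u *: a i t))).
  apply: (IH _ (T * R)%type (fun i p => a i p.1) (fun p => x p.1 + p.2 *: a i p.1)).
    by move=> i' j; apply: (measurableT_comp (ma i' j)).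
  move=> j; under eq_fun do rewrite !mxE.
  apply: measurable_funD; first by apply: (measurableT_comp (mx j)).
  by apply: measurable_funM => //; apply: (measurableT_comp (ma i j)).
by move=> *; exact: Eg_ge0.
Qed.

Lemma Eg_rot psi a b l x (c s : R) : vmeas psi -> (forall y, 0 <= psi y)%E ->
  c ^+ 2 + s ^+ 2 = 1 ->
  Eg (a :: b :: l) psi x = Eg (c *: a + s *: b :: - s *: a + c *: b :: l) psi x.
Proof.
move=> mpsi p0 cs /=.
have cs' : c ^+ 2 + (- s) ^+ 2 = 1 by rewrite sqrrN.
pose h t u := Eg l psi (x + t *: a + u *: b).
have h0 t u : (0 <= h t u)%E by exact: Eg_ge0.
have mh : measurable_fun setT (fun p : R * R => h p.1 p.2).
  rewrite /h -(map_id l).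
  apply: (measurable_Eg l (a := fun b (_ : R * R) => b)
    (x := fun p : R * R => x + p.1 *: a + p.2 *: b) mpsi p0) => [i j|j] //.
  under eq_fun do rewrite !mxE.
  by apply: measurable_funD; [apply: measurable_funD|]; rewrite //; exact: measurable_funM.
rewrite -[LHS]/(gint (fun t => gint (h t))) -(gint_rot mh h0 cs').
apply: eq_gint => t; apply: eq_gint => u; congr Eg.
rewrite -!addrA; congr (_ + _).
by apply/colP => j; rewrite !mxE; ring.
Qed.

Lemma cov_cons a l : cov (a :: l) = a *m a^T + cov l.
Proof. by rewrite /cov big_cons. Qed.

Lemma cov_rot a b l (c s : R) : c ^+ 2 + s ^+ 2 = 1 ->
  cov (a :: b :: l) = cov (c *: a + s *: b :: - s *: a + c *: b :: l).
Proof.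
move=> cs; rewrite !cov_cons !addrA; congr (_ + _).
apply/matrixP => i j; rewrite !mxE !big_ord1 !mxE.
transitivity ((c ^+ 2 + s ^+ 2) * (a i 0 * a j 0 + b i 0 * b j 0)); last by ring.
by rewrite cs mul1r.
Qed.

Lemma Eg_head0 psi x l : (forall y, 0 <= psi y)%E -> Eg (0 :: l) psi x = Eg l psi x.
Proof.
move=> p0 /=; rewrite -[RHS](@gint_cst R); last exact: Eg_ge0.
by apply: eq_gint => t; rewrite scaler0 addr0.
Qed.

Lemma Eg_eliminate (p : 'I_k) (Z : pred 'I_k) l :
  (forall a, a \in l -> forall q, Z q -> a q 0 = 0) ->
  exists (c : 'cV[R]_k) (l' : seq 'cV[R]_k), [/\ 0 <= c p 0, forall a, a \in l' -> a p 0 = 0,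
    forall a, a \in c :: l' -> forall q, Z q -> a q 0 = 0,
    cov l = cov (c :: l') &
    forall psi x, vmeas psi -> (forall y, 0 <= psi y)%E ->
      Eg l psi x = Eg (c :: l') psi x].
Proof.
elim: l => [|b l IH] Zl.
  exists 0, [::]; split => //.
  - by rewrite mxE.
  - by move=> a; rewrite inE => /eqP -> q _; rewrite mxE.
  - by rewrite cov_cons mul0mx add0r.
  - by move=> psi x mpsi p0; rewrite Eg_head0.
have [|c [l' [c0 l'0 Zc cl Ecl]]] := IH.
  by move=> a al; apply: Zl; rewrite inE al orbT.
pose r := Num.sqrt (b p 0 ^+ 2 + c p 0 ^+ 2).
have [u [v [uv e0 e1]]] : exists u v, [/\ u ^+ 2 + v ^+ 2 = 1 :> R,
    0 <= u * b p 0 + v * c p 0 & - v * b p 0 + u * c p 0 = 0].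
  have [r0|r0] := eqVneq r 0.
    have /eqP : b p 0 ^+ 2 + c p 0 ^+ 2 = 0.
      by apply/eqP; rewrite eq_le addr_ge0 ?sqr_ge0// -sqrtr_eq0 -/r r0 eqxx.
    rewrite paddr_eq0 ?sqr_ge0// !sqrf_eq0 => /andP[/eqP b0 /eqP c0'].
    by exists 0, 1; rewrite b0 c0' !mulr0 addr0 expr0n expr1n add0r.
  have r2 : r ^+ 2 = b p 0 ^+ 2 + c p 0 ^+ 2 by rewrite sqr_sqrtr// addr_ge0 ?sqr_ge0.
  have rp : 0 <= r by exact: sqrtr_ge0.
  exists (b p 0 / r), (c p 0 / r); split.
  - by rewrite !expr_div_n -mulrDl -r2 divff// sqrf_eq0.
  - by rewrite mulrAC [X in _ + X]mulrAC -mulrDl divr_ge0// -!expr2 addr_ge0// sqr_ge0.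
  - by field.
exists (u *: b + v *: c), (- v *: b + u *: c :: l'); split.
- by rewrite !mxE.
- by move=> a; rewrite inE => /orP[/eqP ->|/l'0//]; rewrite !mxE.
- have Zb q : Z q -> b q 0 = 0 by apply: Zl; rewrite mem_head.
  have Zc' q : Z q -> c q 0 = 0 by apply: Zc; rewrite mem_head.
  move=> a; rewrite !inE => /or3P[/eqP ->|/eqP ->|al] q Zq.
  + by rewrite !mxE Zb// Zc'// !mulr0 addr0.
  + by rewrite !mxE Zb// Zc'// !mulr0 addr0.
  + by apply: Zc; rewrite // inE al orbT.
- by rewrite -cov_rot// cov_cons cl -!cov_cons.
- move=> psi x mpsi p0; rewrite -Eg_rot//=.
  by apply: eq_gint => t; rewrite Ecl.
Qed.

Lemma cov_coord (p : 'I_k) c l : (forall a, a \in l -> a p 0 = 0) ->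
  forall q, cov (c :: l) q p = c q 0 * c p 0.
Proof.
move=> l0 q; rewrite /cov big_cons mxE mxE big_ord1 !mxE summxE big1_seq ?addr0// => a /andP[_ al].
by rewrite mxE big_ord1 !mxE (l0 _ al) mulr0.
Qed.

(* Cholesky elimination, one coordinate at a time; the pivot is extracted only when
   it is nonzero, which keeps the reduced form unique for degenerate covariances. *)
Lemma Eg_cov psi l1 l2 x : vmeas psi -> (forall y, 0 <= psi y)%E ->
  cov l1 = cov l2 -> Eg l1 psi x = Eg l2 psi x.
Proof.
move=> mpsi p0.
suff H m : forall l1 l2 x,
    (forall a, a \in l1 -> forall q : 'I_k, (q < k - m)%N -> a q 0 = 0) ->
    (forall a, a \in l2 -> forall q : 'I_k, (q < k - m)%N -> a q 0 = 0) ->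
    cov l1 = cov l2 -> Eg l1 psi x = Eg l2 psi x.
  by move=> c12; apply: (H k) => // a _ q; rewrite subnn.
elim: m => [|m IH] {}l1 {}l2 {}x.
  have zero l y : (forall a, a \in l -> forall q : 'I_k, (q < k - 0)%N -> a q 0 = 0) ->
      Eg l psi y = psi y.
    elim: l y => [//|a l IH] y h.
    have -> : a = 0.
      by apply/colP => q; rewrite mxE; apply: h; rewrite ?mem_head// subn0.
    by rewrite Eg_head0// IH// => b bl; apply: h; rewrite inE bl orbT.
  by move=> h1 h2 _; rewrite !zero.
have [km|mk] := leqP k m.
  have e : (k - m.+1 = k - m)%N.
    by rewrite (eqP (_ : k - m == 0)%N) ?subn_eq0// (eqP (_ : k - m.+1 == 0)%N)// subn_eq0 leqW.
  by rewrite e; exact: IH.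
have pk : (k - m.+1 < k)%N by rewrite ltn_subrL/= (leq_ltn_trans _ mk).
have kmS : (k - m = (k - m.+1).+1)%N by rewrite subnSK.
pose p := Ordinal pk.
move=> h1 h2 c12.
have [c1 [l1' [c1p z1 Z1 cov1 E1]]] := @Eg_eliminate p (fun q => (q < k - m.+1)%N) _ h1.
have [c2 [l2' [c2p z2 Z2 cov2 E2]]] := @Eg_eliminate p (fun q => (q < k - m.+1)%N) _ h2.
rewrite E1// E2//.
have hz (c : 'cV[R]_k) (l : seq 'cV[R]_k) : c p 0 = 0 -> (forall a, a \in l -> a p 0 = 0) ->
    (forall a, a \in c :: l -> forall q : 'I_k, (q < k - m.+1)%N -> a q 0 = 0) ->
    (forall a, a \in c :: l -> forall q : 'I_k, (q < k - m)%N -> a q 0 = 0).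
  move=> cz lz Zl a al q; rewrite kmS ltnS leq_eqVlt => /orP[/eqP qp|]; last exact: Zl.
  have -> : q = p by exact: val_inj.
  by move: al; rewrite inE => /orP[/eqP ->|/lz].
have e12 : c1 p 0 = c2 p 0.
  apply/eqP; rewrite -(@eqrXn2 _ 2)// !expr2 -(cov_coord c1 z1) -(cov_coord c2 z2).
  by rewrite -cov1 -cov2 c12.
have [c10|c10] := eqVneq (c1 p 0) 0.
  apply: IH; [exact: hz|apply: hz => //; by rewrite -e12|by rewrite -cov1 -cov2].
have c1c2 : c1 = c2.
  apply/colP => q; apply: (mulIf c10).
  by rewrite -(cov_coord c1 z1) -cov1 c12 cov2 (cov_coord c2 z2) e12.
rewrite -c1c2 /=; apply: eq_gint => t; apply: IH.
- move=> a al q; rewrite kmS ltnS leq_eqVlt => /orP[/eqP qp|]; last first.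
    by apply: Z1; rewrite inE al orbT.
  have -> : q = p by exact: val_inj.
  exact: z1.
- move=> a al q; rewrite kmS ltnS leq_eqVlt => /orP[/eqP qp|]; last first.
    by apply: Z2; rewrite inE al orbT.
  have -> : q = p by exact: val_inj.
  exact: z2.
- by apply: (addrI (c1 *m c1^T)); rewrite -cov_cons -cov1 c12 cov2 cov_cons c1c2.
Qed.

Lemma Eg_exp (t : 'cV[R]_k) l x :
  Eg l (fun z => (expR ((t^T *m z) 0 0))%:E) x =
  (expR ((t^T *m x) 0 0 + (t^T *m cov l *m t) 0 0 / 2))%:E.
Proof.
elim: l x => [|a l IH] x /=.
  have -> : (t^T *m cov [::] *m t) 0 0 = 0 by rewrite /cov big_nil mulmx0 mul0mx mxE.
  by rewrite mul0r addr0.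
transitivity (gint (fun u => (expR ((t^T *m x) 0 0 + (t^T *m cov l *m t) 0 0 / 2))%:E *
    (expR ((t^T *m a) 0 0 * u))%:E)%E).
  apply: eq_gint => u; rewrite IH -EFinM -expRD mulmxDr -scalemxAr; congr ((expR _)%:E).
  by rewrite !mxE; ring.
rewrite gintZl; last 3 first.
- by rewrite lee_fin expR_ge0.
- by apply/measurable_EFinP; apply: measurableT_comp => //; exact: measurable_funM.
- by move=> u; rewrite lee_fin expR_ge0.
rewrite normal01_mgf -EFinM -expRD; congr ((expR _)%:E).
have mxD (A B : 'M[R]_1) : (A + B) 0 0 = A 0 0 + B 0 0 by rewrite mxE.
rewrite cov_cons mulmxDr mulmxDl mxD -addrA; congr (_ + _).
have -> : (t^T *m (a *m a^T) *m t) 0 0 = (t^T *m a) 0 0 ^+ 2.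
  rewrite mulmxA -(mulmxA (t^T *m a)) mxE big_ord1 expr2; congr (_ * _).
  by rewrite -(trmxK (a^T *m t)) trmx_mul trmxK mxE.
by rewrite addrC mulrDl.
Qed.

Lemma giter_Eg psi (a : nat -> 'cV[R]_k) m x :
  giter m (fun v => psi (x + \sum_(i < m) v i *: a i)) =
  Eg [seq a i | i <- rev (iota 0 m)] psi x.
Proof.
elim: m x => [|m IH] x.
  by rewrite /= big_ord0 addr0.
rewrite -addn1 iotaD rev_cat map_cat addn1 /= add0n.
apply: eq_gint => t; rewrite -IH; congr giter; apply/funext => v; congr psi.
rewrite big_ord_recr/= eqxx addrA addrAC; congr (_ + _ + _).
by apply: eq_bigr => i _; rewrite ltn_eqF.
Qed.

Lemma gexp_Eg psi (s : 'M[R]_k) l : vmeas psi -> (forall y, 0 <= psi y)%E ->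
  cov l = s *m s^T ->
  gexp (fun N : 'I_k -> R => psi (\col_a \sum_(c < k) s a c * N c)) = Eg l psi 0.
Proof.
move=> mpsi p0 cl.
pose a i : 'cV[R]_k := if insub i is Some j then col j s else 0.
rewrite (@Eg_cov _ l [seq a i | i <- rev (iota 0 k)])//; last first.
  rewrite cl /cov big_map (perm_big (iota 0 k)) /= ?perm_rev//.
  have -> : iota 0 k = index_iota 0 k by rewrite /index_iota subn0.
  rewrite big_mkord.
  apply/matrixP => i j; rewrite mxE summxE; apply: eq_bigr => c _.
  by rewrite [RHS]mxE big_ord1 /a valK !mxE.
rewrite -giter_Eg; congr giter; apply/funext => v; congr psi.
rewrite add0r; apply/colP => i; rewrite mxE summxE; apply: eq_bigr => c _.
by rewrite /a valK !mxE mulrC.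
Qed.

End GaussianVectors.

(** * Positive semidefinite matrices *)

Section MatrixTopology.
Context {R : realType}.

Lemma continuous_sumr (T : topologicalType) (I : Type) (r : seq I) (f : I -> T -> R) :
  (forall i, continuous (f i)) -> continuous (fun x => \sum_(i <- r) f i x).
Proof.
move=> cf; elim: r => [|i r IH].
  under eq_fun do rewrite big_nil; exact: cst_continuous.
under eq_fun do rewrite big_cons.
by move=> x; apply: (@continuousD _ R^o); [exact: cf|exact: IH].
Qed.

Lemma cvg_mx (T : Type) (F : set_system T) {FF : Filter F} m n (f : T -> 'M[R]_(m, n))
    (l : 'M[R]_(m, n)) :
  (forall i j, f x i j @[x --> F] --> l i j) -> f @ F --> l.
Proof.
move=> h A [P lP PA].
have : F (fun x => forall ij : 'I_m * 'I_n, P ij.1 ij.2 (f x ij.1 ij.2)).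
  by apply: filter_forall => -[i j]; exact: h.
move=> H; apply: (@filterS _ F FF _ _ _ H) => x Px; apply: PA => i j; exact: (Px (i, j)).
Qed.

Lemma continuous_mulr (T : topologicalType) (f g : T -> R) :
  continuous f -> continuous g -> continuous (fun x => f x * g x).
Proof. by move=> cf cg x; exact: (cvgM (cf x) (cg x)). Qed.

Lemma continuous_dist (T : topologicalType) (f : T -> R) (c : R) :
  continuous f -> continuous (fun x => `|f x - c|).
Proof.
move=> cf x; apply: cvg_norm.
by apply: (@cvgB _ R^o); [exact: cf|exact: cvg_cst].
Qed.

Definition mx_box m n (B : R) : set 'M[R]_(m, n) := [set g | forall i j, `|g i j| <= B].

Lemma compact_mx_box m n (B : R) : compact (@mx_box m n B).
Proof.
have -> : @mx_box m n B = (@vec_mx R m n) @`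
    [set v : 'rV_(m * n) | forall i, `[(- B), B]%classic (v ord0 i)].
  apply/seteqP; split => [g gB|_ [v vB <-] i j].
    exists (mxvec g); last by rewrite mxvecK.
    move=> i /=; rewrite in_itv /= -ler_norml.
    by case/mxvec_indexP: i => i j; rewrite mxvecE; exact: gB.
  by rewrite mxE ler_norml; have := vB (mxvec_index i j); rewrite /= in_itv.
apply: continuous_compact.
  apply: continuous_subspaceT => v; apply: (cvg_mx (F := nbhs v)) => i j.
  under eq_fun do rewrite mxE.
  by rewrite mxE; exact: coord_continuous.
by apply: (@rV_compact _ _ (fun=> `[(- B), B]%classic)) => _; exact: segment_compact.
Qed.

Lemma closed_le_continuous (T : topologicalType) (f : T -> R) (c : R) :
  continuous f -> closed [set x | c <= f x].
Proof.
by move=> cf; apply: (preimage_closed _ (@closed_ge _ c)) => x _; exact: cf.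
Qed.

Lemma closed_eq_continuous (T : topologicalType) (f g : T -> R) :
  continuous f -> continuous g -> closed [set x | f x = g x].
Proof.
move=> cf cg.
have -> : [set x | f x = g x] = [set x | 0 <= f x - g x] `&` [set x | 0 <= g x - f x].
  apply/seteqP; split => x /=; first by move=> ->; rewrite subrr.
  by rewrite !subr_ge0 => -[h1 h2]; apply/eqP; rewrite eq_le h1 h2.
by apply: closedI; apply: closed_le_continuous => x;
  apply: (@continuousB _ R^o); [exact: cf|exact: cg|exact: cg|exact: cf].
Qed.

Lemma continuous_seq m n (f : 'M[R]_(m, n) -> R) :
  (forall (s : 'M[R]_(m, n)) (u : nat -> 'M[R]_(m, n)), u i @[i --> \oo] --> s -> f (u i) @[i --> \oo] --> f s) ->
  continuous f.
Proof.
move=> H s; have FF := nbhs_filter s; apply/cvgrPdist_lt => e e0; apply: contrapT => nh.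
have h i : exists t, ball s i.+1%:R^-1 t /\ ~ (`|f s - f t| < e).
  have i0 : (0 : R) < i.+1%:R^-1 by rewrite invr_gt0.
  apply: contrapT => nex; apply: nh; apply: (@filterS _ _ FF _ _ _ (nbhsx_ballx s _ i0)).
  by move=> t st; apply: contrapT => nt; apply: nex; exists t.
have [u hu] := choice h.
have us : u i @[i --> \oo] --> s.
  apply/cvg_ballP => r r0.
  have [K _ HK] := near_infty_natSinv_lt (PosNum r0).
  exists K => // i /= Ki; apply: le_ball (hu i).1; exact: ltW (HK _ Ki).
have /cvgrPdist_lt/(_ _ e0)[K _ HK] := H _ _ us.
by have [_] := hu K; apply; apply: HK => /=.
Qed.

End MatrixTopology.

Section PositiveSemidefinite.
Context {R : realType} {k : nat}.
Implicit Types (q s : 'M[R]_k) (v w : 'cV[R]_k).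

Definition qform q v : R := (v^T *m q *m v) 0 0.

Lemma mx11D (A B : 'M[R]_1) : (A + B) 0 0 = A 0 0 + B 0 0. Proof. by rewrite mxE. Qed.
Lemma mx11Z (c : R) (A : 'M[R]_1) : (c *: A) 0 0 = c * A 0 0. Proof. by rewrite mxE. Qed.
Lemma mx11M (A B : 'M[R]_1) : (A *m B) 0 0 = A 0 0 * B 0 0.
Proof. by rewrite mxE big_ord1. Qed.

Lemma mx11T (A : 'M[R]_1) : A^T 0 0 = A 0 0. Proof. by rewrite mxE. Qed.
Lemma trmxZ m n (c : R) (A : 'M[R]_(m, n)) : (c *: A)^T = c *: A^T.
Proof. exact: linearZ. Qed.
Lemma trmxD m n (A B : 'M[R]_(m, n)) : (A + B)^T = A^T + B^T.
Proof. exact: linearD. Qed.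

Lemma qformE q v : qform q v = \sum_i \sum_j v j 0 * q j i * v i 0.
Proof.
rewrite /qform mxE; apply: eq_bigr => i _; rewrite mxE mulr_suml.
by apply: eq_bigr => j _; rewrite mxE.
Qed.

Lemma qformDl q p v : qform (q + p) v = qform q v + qform p v.
Proof. by rewrite /qform mulmxDr mulmxDl mx11D. Qed.

Lemma qformZl (c : R) q v : qform (c *: q) v = c * qform q v.
Proof. by rewrite /qform -scalemxAr -scalemxAl mx11Z. Qed.

Lemma qformZ q (c : R) v : qform q (c *: v) = c ^+ 2 * qform q v.
Proof.
by rewrite /qform trmxZ -!scalemxAl -!scalemxAr !mx11Z mulrA expr2.
Qed.

Lemma dot_sum v : (v^T *m v) 0 0 = \sum_i v i 0 ^+ 2.
Proof. by rewrite mxE; apply: eq_bigr => i _; rewrite mxE expr2. Qed.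

Lemma dot_ge0 v : 0 <= (v^T *m v) 0 0.
Proof. by rewrite dot_sum sumr_ge0// => i _; exact: sqr_ge0. Qed.

Lemma dot_eq0 v : (v^T *m v) 0 0 = 0 -> v = 0.
Proof.
rewrite dot_sum => /eqP; rewrite psumr_eq0 => [/allP h|i _]; last exact: sqr_ge0.
apply/colP => i; rewrite mxE; apply/eqP; rewrite -sqrf_eq0.
by apply: h; rewrite mem_index_enum.
Qed.

Lemma qform1 v : qform 1%:M v = (v^T *m v) 0 0.
Proof. by rewrite /qform mulmx1. Qed.

Lemma qform_outer (u v : 'cV[R]_k) : qform (u *m u^T) v = (u^T *m v) 0 0 ^+ 2.
Proof.
rewrite /qform mulmxA -mulmxA mx11M expr2; congr (_ * _).
by rewrite -mx11T trmx_mul trmxK.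
Qed.

Lemma psd_sum (I : Type) (r : seq I) (f : I -> 'M[R]_k) :
  (forall i, psd (f i)) -> psd (\sum_(i <- r) f i).
Proof.
move=> pf; elim/big_rec: _ => [|i x _ [xs xp]].
  by split => [|v]; rewrite ?trmx0// mulmx0 mul0mx mxE.
have [fs fp] := pf i; split; first by rewrite linearD/= xs fs.
by move=> v; rewrite -/(qform _ _) qformDl addr_ge0//; [exact: fp|exact: xp].
Qed.

Lemma psd_outer (u : 'cV[R]_k) : psd (u *m u^T).
Proof.
split; first by rewrite trmx_mul trmxK.
by move=> v; rewrite -/(qform _ _) qform_outer sqr_ge0.
Qed.

Lemma psdZ (c : R) q : 0 <= c -> psd q -> psd (c *: q).
Proof.
move=> c0 [qs qp]; split; first by rewrite linearZ/= qs.
by move=> v; rewrite -/(qform _ _) qformZl mulr_ge0//; exact: qp.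
Qed.

Lemma psdD q p : psd q -> psd p -> psd (q + p).
Proof.
move=> [qs qp] [ps pp]; split; first by rewrite linearD/= qs ps.
by move=> v; rewrite -/(qform _ _) qformDl addr_ge0//; [exact: qp|exact: pp].
Qed.

Lemma psd_kernel q v : psd q -> qform q v = 0 -> q *m v = 0.
Proof.
move=> [qs qp] qv0; pose w := q *m v.
have E (t : R) : qform q (v + t *: w) = 2 * t * (w^T *m w) 0 0 + t ^+ 2 * qform q w.
  rewrite /qform trmxD trmxZ !mulmxDl !mulmxDr !mx11D.
  rewrite -!scalemxAl -!scalemxAr !mx11Z.
  have -> : (v^T *m q *m v) 0 0 = 0 by [].
  have -> : v^T *m q *m w = w^T *m w by rewrite /w trmx_mul qs.
  have -> : w^T *m q *m v = w^T *m w by rewrite /w -[in LHS]mulmxA.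
  by rewrite /qform; ring.
apply: dot_eq0; rewrite -/w; set n := (w^T *m w) 0 0 in E *.
have n0 : 0 <= n by exact: dot_ge0.
have c0 : 0 <= qform q w by exact: qp.
set c := qform q w in E c0.
have c1 : 0 < c + 1 by rewrite ltr_pwDr.
have := qp (v + (- n / (c + 1)) *: w); rewrite -/(qform _ _) E.
have -> : 2 * (- n / (c + 1)) * n + (- n / (c + 1)) ^+ 2 * c =
   - (n ^+ 2 * (c + 2) / (c + 1) ^+ 2) by field; rewrite gt_eqF.
rewrite oppr_ge0 => h; apply/eqP; rewrite -sqrf_eq0; apply/eqP.
have h2 : n ^+ 2 * ((c + 2) / (c + 1) ^+ 2) <= 0 by rewrite mulrA.
have h3 : 0 < (c + 2) / (c + 1) ^+ 2 by rewrite divr_gt0 ?exprn_gt0// ltr_pwDr.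
by apply/eqP; rewrite eq_le sqr_ge0 andbT -(pmulr_lle0 _ h3).
Qed.

Lemma continuous_qform q : continuous (qform q).
Proof.
rewrite (_ : qform q = fun v => \sum_i \sum_j v j 0 * q j i * v i 0); last first.
  by apply/funext => v; rewrite qformE.
apply: continuous_sumr => i; apply: continuous_sumr => j.
by do !apply: continuous_mulr; [exact: coord_continuous|exact: cst_continuous|exact: coord_continuous].
Qed.

Lemma psd_eigenvector q : psd q -> q != 0 ->
  exists v (lam : R), [/\ 0 < lam, v^T *m v = 1%:M & q *m v = lam *: v].
Proof.
move=> pq q0; have [qs qp] := pq.
pose S : set 'cV[R]_k := [set v | qform 1%:M v = 1].
have S0 : S !=set0.
  have [i _] : exists i : 'I_k, true.
    case: k q q0 {pq qs qp S} => [q q0|n q _]; last by exists ord0.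
    by case/eqP: q0; apply/matrixP => -[].
  exists (delta_mx i 0); rewrite /S /= qform1 dot_sum (bigD1 i)//= big1 ?addr0.
    by rewrite mxE !eqxx expr1n.
  by move=> j ji; rewrite mxE (negbTE ji) expr0n.
have cS : compact S.
  apply: (subclosed_compact _ (@compact_mx_box R k 1 1)).
    apply: closed_eq_continuous; [exact: continuous_qform|exact: cst_continuous].
  move=> v; rewrite /S /= qform1 dot_sum => v1 i j; rewrite ord1.
  rewrite -(@ler_pXn2r _ 2) ?nnegrE// expr1n -v1.
  by rewrite (bigD1 i)//= real_normK ?num_real// lerDl sumr_ge0// => ? _; exact: sqr_ge0.
have [|c + cmax] := compact_EVT_max S0 cS (f := qform q).
  by apply: continuous_subspaceT; exact: continuous_qform.
rewrite inE => Sc; pose lam := qform q c.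
have c1 : (c^T *m c) 0 0 = 1 by rewrite -qform1.
have pp : psd (lam%:M - q).
  split; first by rewrite linearB/= tr_scalar_mx qs.
  move=> w; rewrite -/(qform _ _) -scalemx1 -scaleN1r qformDl !qformZl mulN1r subr_ge0.
  have [->|w0] := eqVneq w 0.
    by rewrite /qform !mulmx0 !mxE mulr0.
  set n := qform 1%:M w.
  have n0 : 0 < n.
    rewrite lt0r /n qform1 dot_ge0 andbT; apply: contra w0 => /eqP w0; exact/eqP/dot_eq0.
  pose r := (Num.sqrt n)^-1.
  have r2 : r ^+ 2 = n^-1 by rewrite exprVn sqr_sqrtr// ltW.
  have := cmax (r *: w); rewrite inE /S /= !qformZ r2 mulVf ?gt_eqF// => /(_ erefl).
  by rewrite ler_pdivrMl// mulrC.
have pc : (lam%:M - q) *m c = 0.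
  apply: psd_kernel => //.
  rewrite -scalemx1 -scaleN1r qformDl !qformZl mulN1r qform1 c1 mulr1.
  by rewrite subrr.
exists c, lam; split.
- rewrite lt0r (qp c) andbT; apply: contra q0 => /eqP l0; apply/eqP.
  rewrite -[q]mulmx1; apply/matrixP => i j.
  have h w : q *m w = 0.
    apply: psd_kernel => //; apply/eqP; rewrite eq_le (qp w) andbT.
    have := pp.2 w; rewrite -/(qform _ _) -scalemx1 -scaleN1r qformDl !qformZl l0 mul0r add0r mulN1r.
    by rewrite oppr_ge0.
  have /colP/(_ i) := h (col j 1%:M); rewrite [RHS]mxE => e; rewrite [RHS]mxE -e.
  by rewrite mxE [RHS]mxE; apply: eq_bigr => l _; rewrite !mxE.
- by apply/matrixP => i j; rewrite !ord1 c1 mxE.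
- by move: pc; rewrite mulmxBl mul_scalar_mx => /eqP; rewrite subr_eq0 => /eqP.
Qed.

(* Deflation: subtracting [lam v v^T] for a unit eigenvector [v] lowers the rank. *)
Lemma psd_sqrt_exists q : psd q -> exists s, psd s /\ s *m s = q.
Proof.
move: {2}(\rank q).+1 (ltnSn (\rank q)) => n.
elim: n q => [//|n IH] q rq pq.
have [->|q0] := eqVneq q 0.
  exists 0; split; last by rewrite mul0mx.
  by split => [|v]; rewrite ?trmx0// mulmx0 mul0mx mxE.
have [v [lam [lam0 v1 qv]]] := psd_eigenvector pq q0.
have [qs qp] := pq.
have vq : v^T *m q = lam *: v^T by rewrite -{1}qs -trmx_mul qv linearZ.
pose E := 1%:M - v *m v^T.
have Es : E^T = E by rewrite linearB/= trmx1 trmx_mul trmxK.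
pose q' := q - lam *: (v *m v^T).
have q'E : q' = E *m q.
  by rewrite mulmxBl mul1mx -mulmxA vq -scalemxAr.
have q'E2 : q' = E *m q *m E.
  rewrite -q'E mulmxBr mulmx1 mulmxBl -scalemxAl -!mulmxA (mulmxA v^T) v1 mul1mx.
  by rewrite (mulmxA q) qv -scalemxAl subrr subr0.
have q'v : q' *m v = 0.
  by rewrite mulmxBl qv -scalemxAl -mulmxA v1 mulmx1 subrr.
have pq' : psd q'.
  split; first by rewrite q'E2 !trmx_mul Es qs mulmxA.
  move=> w; rewrite q'E2.
  by have := qp (E *m w); rewrite trmx_mul Es !mulmxA.
have rq' : (\rank q' < n)%N.
  rewrite -ltnS (leq_trans _ rq)// ltnS; apply: rank_ltmx; rewrite ltmxE.
  rewrite q'E submxMl /= -q'E; apply/negP => /submxP[D qD].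
  have : q *m v = 0 by rewrite qD -mulmxA q'v mulmx0.
  rewrite qv => /eqP; rewrite scaler_eq0 gt_eqF//= => /eqP v0.
  by move: v1; rewrite v0 mulmx0 => /matrixP/(_ 0 0)/eqP; rewrite !mxE/= eq_sym oner_eq0.
have [s' [[s's s'p] s'q]] := IH _ rq' pq'.
have s'v : s' *m v = 0.
  by apply: dot_eq0; rewrite trmx_mul s's mulmxA -(mulmxA v^T) s'q -mulmxA q'v mulmx0 mxE.
have vs' : v^T *m s' = 0 by rewrite -s's -trmx_mul s'v trmx0.
exists (Num.sqrt lam *: (v *m v^T) + s'); split.
  by apply: psdD => //; apply: psdZ; [exact: sqrtr_ge0|exact: psd_outer].
rewrite mulmxDl !mulmxDr s'q -!scalemxAl -!scalemxAr scalerA -expr2 sqr_sqrtr ?ltW//.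
rewrite -!mulmxA vs' mulmx0 scaler0 addr0 (mulmxA s') s'v mul0mx scaler0 add0r.
by rewrite (mulmxA v^T) v1 mul1mx addrC subrK.
Qed.

Lemma msqrtP q : psd q -> psd (msqrt q) /\ msqrt q *m msqrt q = q.
Proof. by move=> /psd_sqrt_exists; exact: xgetPex. Qed.

Lemma msqrtM q : psd q -> msqrt q *m (msqrt q)^T = q.
Proof. by move=> /msqrtP[[-> _] ->]. Qed.

Lemma msqrt_bound q (B : R) : psd q -> (forall i, q i i <= B) ->
  forall i j, msqrt q i j ^+ 2 <= B.
Proof.
move=> pq qB i j; apply: le_trans (qB i).
rewrite -[in leRHS](msqrtM pq) mxE (bigD1 j)//= !mxE -expr2 lerDl sumr_ge0// => l _.
by rewrite !mxE -expr2 sqr_ge0.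
Qed.

Lemma closed_psd : closed [set q : 'M[R]_k | psd q].
Proof.
have -> : [set q : 'M[R]_k | psd q] = (\bigcap_(p in [set: 'I_k * 'I_k]) [set q : 'M[R]_k | q p.2 p.1 = q p.1 p.2])
    `&` (\bigcap_(v in [set: 'cV[R]_k]) [set q : 'M[R]_k | 0 <= qform q v]).
  apply/seteqP; split => [q [qs qp]|q [qs qp]].
    by split => [[i j] _|v _]; [rewrite /= -{1}qs mxE|exact: qp].
  split; last by move=> v; exact: (qp v).
  by apply/matrixP => i j; rewrite mxE; exact: (qs (i, j)).
apply: closedI.
  apply: closed_bigI => -[i j] _.
  by apply: closed_eq_continuous; exact: coord_continuous.
apply: closed_bigI => v _; apply: closed_le_continuous.
rewrite (_ : qform ^~ v = fun q => \sum_i \sum_j v j 0 * q j i * v i 0); last first.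
  by apply/funext => q; rewrite qformE.
apply: continuous_sumr => i; apply: continuous_sumr => j.
by do !apply: continuous_mulr; [exact: cst_continuous|exact: coord_continuous|exact: cst_continuous].
Qed.

Lemma closed_SCb (Cb : R) : closed [set q : 'M[R]_k | SCb Cb q].
Proof.
have -> : [set q : 'M[R]_k | SCb Cb q] = [set q : 'M[R]_k | psd q] `&`
   ((fun q => q - Cb *: const_mx 1) @^-1` [set q : 'M[R]_k | psd q]) by [].
apply: closedI; first exact: closed_psd.
apply: preimage_closed closed_psd => q _.
apply: (cvg_mx (F := nbhs q)) => i j; under eq_fun do rewrite !mxE.
rewrite !mxE; apply: (@cvgB _ R^o); first exact: coord_continuous.
exact: cvg_cst.
Qed.

Lemma compact_SCb_box (Cb B : R) : compact ([set q : 'M[R]_k | SCb Cb q] `&` @mx_box R k k B).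
Proof.
by apply: (subclosed_compact _ (@compact_mx_box R k k B)); [
  apply: closedI; [exact: closed_SCb|apply: compact_closed; [exact: norm_hausdorff|exact: compact_mx_box]]
  |move=> q []].
Qed.

End PositiveSemidefinite.

(** * The function kappa *)

Section GaussianSpace.
Context {R : realType}.

Definition gmeas (f : (nat -> R) -> R) : Prop :=
  forall d (T : measurableType d) (v : nat -> T -> R),
    (forall i, measurable_fun setT (v i)) ->
    measurable_fun setT (fun t => f (fun i => v i t)).

Lemma integrable_bounded_fun d (T : measurableType d) (P : probability T R) (f : T -> R) (M : R) :
  measurable_fun setT f -> (forall t, `|f t| <= M) -> P.-integrable setT (EFin \o f).
Proof.
move=> mf fM; apply: measurable_bounded_integrable => //.
  by rewrite [X in (X < _)%E](_ : _ = 1%E) ?ltry//; exact: probability_setT.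
by exists M; split; [exact: num_real|move=> x Mx t _; exact: le_trans (fM t) (ltW Mx)].
Qed.

Lemma gauss_space m : exists d (T : measurableType d) (P : probability T R) (N : nat -> T -> R),
  (forall i, measurable_fun setT (N i)) /\
  forall (f : (nat -> R) -> R) (M : R), gmeas f -> (forall v, `|f v| <= M) ->
    giter m (fun v => (f v)%:E) = (\int[P]_t (f (fun i => N i t))%:E)%E.
Proof.
elim: m => [|m [d [T [P [N [mN HN]]]]]].
  exists _, (measurableTypeR R), (normal_prob (0 : R) 1), (fun _ _ => 0); split => // f M mf fM /=.
  by rewrite integral_cst// [X in (_ * X)%E](_ : _ = 1%E) ?mule1//; exact: probability_setT.
pose N' i (p : measurableTypeR R * T) : R := if i == m then p.1 else N i p.2.
have mN' i : measurable_fun setT (N' i).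
  rewrite /N'; case: (i == m).
    exact: (@measurable_fst _ _ (measurableTypeR R) T).
  exact: (measurableT_comp (mN i) (@measurable_snd _ _ (measurableTypeR R) T)).
exists _, (measurableTypeR R * T)%type, (normal_prob (0 : R) 1 \x P)%E, N'; split => // f M mf fM.
pose h (p : measurableTypeR R * T) : \bar R := (f (fun i => N' i p))%:E.
have ih : (normal_prob (0 : R) 1 \x P)%E.-integrable setT h.
  exact: (@integrable_bounded_fun _ _ (normal_prob (0 : R) 1 \x P)%E _ M (mf _ _ N' mN')).
rewrite -[RHS](integral12_prod_meas1 ih) /=; apply: eq_integral => t _.
rewrite (HN (fun v => f (fun i => if i == m then t else v i)) M)//.
move=> d' T' v mv; apply: (mf _ _ (fun i s => if i == m then t else v i s)) => i.
by case: eqP.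
Qed.

End GaussianSpace.

Section LogMoment.
Context {R : realType} d (T : measurableType d) (P : probability T R).
Implicit Types (X F : T -> R).

Lemma integrable_funD X F : P.-integrable setT (EFin \o X) -> P.-integrable setT (EFin \o F) ->
  P.-integrable setT (EFin \o (fun t => X t + F t)).
Proof. by move=> iX iF; exact: (integrableD measurableT iX iF). Qed.

Lemma integrable_funZl (c : R) X : P.-integrable setT (EFin \o X) ->
  P.-integrable setT (EFin \o (fun t => c * X t)).
Proof. by move=> iX; exact: (integrableZl measurableT c iX). Qed.

Lemma expR_le_quad (u : R) : u <= 1 / 2 -> expR u <= 1 + u + 2 * u ^+ 2.
Proof.
move=> u2; have u1 : 0 < 1 - u by lra.
have h : 1 - u <= expR (- u) by have := expR_ge1Dx (- u); rewrite addrC addrC.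
have : expR u <= (1 - u)^-1.
  by rewrite -[expR u]invrK -expRN lef_pV2 ?posrE ?expR_gt0.
move/le_trans; apply; rewrite -div1r ler_pdivrMr//.
have : 0 <= u ^+ 2 * (1 - 2 * u) by rewrite mulr_ge0 ?sqr_ge0//; lra.
nra.
Qed.

Lemma measurable_expR_comp X : measurable_fun setT X -> measurable_fun setT (fun t => expR (X t)).
Proof. by move=> mX; exact: measurableT_comp. Qed.

Lemma expR_norm_le (x B : R) : `|x| <= B -> `|expR x| <= expR B.
Proof.
by move=> xB; rewrite ger0_norm ?expR_ge0// ler_expR (le_trans _ xB)// ler_norm.
Qed.

Lemma expR_integrable X (B : R) : measurable_fun setT X -> (forall t, `|X t| <= B) ->
  P.-integrable setT (EFin \o (fun t => expR (X t))).
Proof.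
move=> mX XB; apply: (@integrable_bounded_fun _ _ _ P _ (expR B)); first exact: measurable_expR_comp.
by move=> t; exact: expR_norm_le.
Qed.

Lemma Rintegral_cst1 (c : R) : \int[P]_t c = c.
Proof. by rewrite Rintegral_cst// [X in fine X](_ : _ = 1%E) ?mulr1//; exact: probability_setT. Qed.

Lemma expR_Rint_bounds X (B : R) : measurable_fun setT X -> (forall t, `|X t| <= B) ->
  expR (- B) <= \int[P]_t expR (X t) <= expR B.
Proof.
move=> mX XB; have iX := expR_integrable mX XB.
have icst c : P.-integrable setT (EFin \o (fun _ : T => c : R)).
  by apply: (@integrable_bounded_fun _ _ _ P _ (`|c|)).
apply/andP; split.
  rewrite -[leLHS](Rintegral_cst1 (expR (- B))); apply: le_Rintegral => // t _.
  by rewrite ler_expR lerNl (le_trans _ (XB t))// -normrN ler_norm.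
rewrite -[leRHS](Rintegral_cst1 (expR B)); apply: le_Rintegral => // t _.
by rewrite ler_expR (le_trans _ (XB t))// ler_norm.
Qed.

Lemma expR_Rint_gt0 X (B : R) : measurable_fun setT X -> (forall t, `|X t| <= B) ->
  0 < \int[P]_t expR (X t).
Proof.
by move=> mX XB; have /andP[+ _] := expR_Rint_bounds mX XB; apply: lt_le_trans; exact: expR_gt0.
Qed.

Lemma jensen_expR X (B : R) : measurable_fun setT X -> (forall t, `|X t| <= B) ->
  \int[P]_t X t <= ln (\int[P]_t expR (X t)).
Proof.
move=> mX XB; have A0 := expR_Rint_gt0 mX XB.
have iX := integrable_bounded_fun P mX XB; have ieX := expR_integrable mX XB.
set e := \int[P]_t X t.
rewrite -ler_expR lnK ?posrE//.
have icst c : P.-integrable setT (EFin \o (fun _ : T => c : R)).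
  by apply: (@integrable_bounded_fun _ _ _ P _ (`|c|)).
have i1 : P.-integrable setT (EFin \o (fun t => X t + (1 - e))).
  exact: integrable_funD.
have : \int[P]_t (expR e * (X t + (1 - e))) <= \int[P]_t expR (X t).
  apply: le_Rintegral => //.
    exact: integrable_funZl.
  move=> t _; have := expR_ge1Dx (X t - e).
  rewrite expRB ler_pdivlMr ?expR_gt0// => h; apply: le_trans h.
  by rewrite mulrC; apply: ler_wpM2r; [exact: expR_ge0|lra].
rewrite RintegralZl//.
rewrite (RintegralD (f1 := X) (f2 := fun _ : T => 1 - e))// Rintegral_cst1 -/e.
by rewrite addrC subrK mulr1.
Qed.

Lemma ln_mgf_le X F (B b t : R) :
  measurable_fun setT X -> (forall s, `|X s| <= B) ->
  measurable_fun setT F -> (forall s, `|F s| <= b) -> `|t| * b <= 1 / 2 ->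
  ln (\int[P]_s expR (X s + t * F s)) <=
  ln (\int[P]_s expR (X s)) + t * ((\int[P]_s (expR (X s) * F s)) / \int[P]_s expR (X s))
  + 2 * b ^+ 2 * t ^+ 2.
Proof.
move=> mX XB mF Fb tb; have A0 := expR_Rint_gt0 mX XB.
set A := \int[P]_s expR (X s) in A0 *; set D := \int[P]_s (expR (X s) * F s).
have ieX := expR_integrable mX XB.
have iD : P.-integrable setT (EFin \o (fun s => expR (X s) * F s)).
  apply: (@integrable_bounded_fun _ _ _ P _ (expR B * b)).
    by apply: measurable_funM => //; exact: measurable_expR_comp.
  by move=> s; rewrite normrM ler_pM//; exact: expR_norm_le.
have mXF : measurable_fun setT (fun s => X s + t * F s).
  by apply: measurable_funD => //; exact: measurable_funM.
have XFB s : `|X s + t * F s| <= B + `|t| * b.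
  by rewrite (le_trans (ler_normD _ _))// lerD// normrM ler_wpM2l.
have E0 := expR_Rint_gt0 mXF XFB.
have le1 : \int[P]_s expR (X s + t * F s) <= A * (1 + 2 * b ^+ 2 * t ^+ 2) + t * D.
  rewrite /A /D -(RintegralZl _ measurableT iD) -(RintegralZr _ measurableT ieX).
  have i1 : P.-integrable setT (EFin \o (fun s => expR (X s) * (1 + 2 * b ^+ 2 * t ^+ 2))).
    exact: (integrableZr measurableT _ ieX).
  have i2 : P.-integrable setT (EFin \o (fun s => t * (expR (X s) * F s))).
    exact: integrable_funZl.
  rewrite -RintegralD//; apply: le_Rintegral => //.
    by apply: (expR_integrable mXF XFB).
    exact: integrable_funD.
  move=> s _; rewrite expRD.
  have -> : expR (X s) * (1 + 2 * b ^+ 2 * t ^+ 2) + t * (expR (X s) * F s) =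
     expR (X s) * (1 + t * F s + 2 * (b ^+ 2 * t ^+ 2)) by ring.
  rewrite ler_wpM2l ?expR_ge0//.
  have tF : `|t * F s| <= `|t| * b by rewrite normrM ler_wpM2l.
  have h : t * F s <= 1 / 2 by rewrite (le_trans (ler_norm _))// (le_trans tF).
  apply: le_trans (expR_le_quad h) _; rewrite lerD2l ler_wpM2l//.
  rewrite -exprMn -(real_normK (num_real (t * F s))) -(real_normK (num_real (b * t))).
  rewrite ler_pXn2r ?nnegrE// (le_trans tF)// normrM mulrC ler_wpM2r// ler_norm//.
have c0 : 0 < 1 + (t * (D / A) + 2 * b ^+ 2 * t ^+ 2).
  rewrite -(pmulr_lgt0 _ A0) (lt_le_trans E0)// (le_trans le1)// le_eqVlt; apply/orP; left.
  by apply/eqP; field; rewrite gt_eqF.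
rewrite -addrA; apply: (@le_trans _ _ (ln (A * (1 + (t * (D / A) + 2 * b ^+ 2 * t ^+ 2))))).
  rewrite ler_ln ?posrE// ?mulr_gt0//; apply: (le_trans le1).
  by rewrite le_eqVlt; apply/orP; left; apply/eqP; field; rewrite gt_eqF.
rewrite lnM ?posrE// lerD2l le_ln1Dx//.
by rewrite -ltrBlDl in c0; rewrite (le_lt_trans _ c0)// sub0r.
Qed.

End LogMoment.

Section CumulantFunction.
Context {R : realType} {k : nat}.
Variable sigma : R -> R.
Hypothesis csigma : continuous sigma.
Variable M : R.
Hypothesis sigmaM : forall t, `|sigma t| <= M.
Implicit Types (eta q s y : 'M[R]_k) (N : 'I_k -> R).

Definition mxdot m n (eta y : 'M[R]_(m, n)) : R := \sum_a \sum_b eta a b * y a b.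

Definition feat s N a : R := sigma (\sum_(c < k) s a c * N c).

Definition energy eta s N : R := \sum_a \sum_b eta a b * feat s N a * feat s N b.

Definition esize eta : R := \sum_a \sum_b `|eta a b| * M ^+ 2.

Definition kap eta q : R := fine (kappa sigma eta q).

Lemma feat2_le s N a b : `|feat s N a * feat s N b| <= M ^+ 2.
Proof. by rewrite normrM expr2 ler_pM//; exact: sigmaM. Qed.

Lemma energy_le eta s N : `|energy eta s N| <= esize eta.
Proof.
apply: le_trans (ler_norm_sum _ _ _) _; apply: ler_sum => a _.
apply: le_trans (ler_norm_sum _ _ _) _; apply: ler_sum => b _.
by rewrite -mulrA normrM ler_wpM2l// feat2_le.
Qed.

Lemma measurable_feat d (T : measurableType d) s (N : 'I_k -> T -> R) a :
  (forall i, measurable_fun setT (N i)) -> measurable_fun setT (fun t => feat s (N^~ t) a).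
Proof.
move=> mN; apply: (measurableT_comp (continuous_measurable_fun csigma)).
by apply: measurable_sum => c; exact: measurable_funM.
Qed.

Lemma measurable_energy d (T : measurableType d) eta s (N : 'I_k -> T -> R) :
  (forall i, measurable_fun setT (N i)) -> measurable_fun setT (fun t => energy eta s (N^~ t)).
Proof.
move=> mN; apply: measurable_sum => a; apply: measurable_sum => b.
by do 2?apply: measurable_funM => //; exact: measurable_feat.
Qed.

Lemma kappa_space : exists d (T : measurableType d) (P : probability T R) (N : 'I_k -> T -> R),
  [/\ forall i, measurable_fun setT (N i),
    forall eta s, gexp (fun N => (expR (energy eta s N))%:E) =
      (\int[P]_t expR (energy eta s (N^~ t)))%:E,
    forall eta q, kap eta q = ln (\int[P]_t expR (energy eta (msqrt q) (N^~ t))),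
    forall eta q, kappa sigma eta q = (kap eta q)%:E &
    forall q a b, ymat sigma q a b =
      \int[P]_t (feat (msqrt q) (N^~ t) a * feat (msqrt q) (N^~ t) b)].
Proof.
have [d [T [P [N [mN HN]]]]] := gauss_space (R := R) k.
exists d, T, P, (fun i : 'I_k => N i).
have mN' (i : 'I_k) : measurable_fun setT (N i) by exact: mN.
have h1 eta s : gexp (fun N => (expR (energy eta s N))%:E) =
    (\int[P]_t expR (energy eta s (fun i : 'I_k => N i t)))%:E.
  rewrite /gexp (HN (fun v => expR (energy eta s (fun i : 'I_k => v i))) (expR (esize eta))).
  - rewrite /Rintegral fineK//; apply: integrable_fin_num => //.
    apply: (expR_integrable P (measurable_energy _ _ mN') (B := esize eta)) => t.
    exact: energy_le.
  - move=> d' T' v mv; apply: measurable_expR_comp.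
    exact: (measurable_energy eta s (N := fun i : 'I_k => v i)).
  - by move=> v; apply: expR_norm_le; exact: energy_le.
have h0 eta s : 0 < \int[P]_t expR (energy eta s (fun i : 'I_k => N i t)).
  apply: (@expR_Rint_gt0 _ _ _ P _ (esize eta)); first exact: measurable_energy.
  by move=> t; exact: energy_le.
have h2 eta q : kappa sigma eta q =
    (ln (\int[P]_t expR (energy eta (msqrt q) (fun i : 'I_k => N i t))))%:E.
  by rewrite /kappa -[X in elog X]/(gexp (fun N => (expR (energy eta (msqrt q) N))%:E)) h1/= leNgt h0.
have h3 eta q : kap eta q = ln (\int[P]_t expR (energy eta (msqrt q) (fun i : 'I_k => N i t))).
  by rewrite /kap h2.
split => //; first by move=> eta q; rewrite h3 h2.
move=> q a b; rewrite mxE /gexp.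
rewrite (HN (fun v => feat (msqrt q) (fun i : 'I_k => v i) a * feat (msqrt q) (fun i : 'I_k => v i) b)
  (M ^+ 2)) //.
- move=> d' T' v mv; apply: measurable_funM;
  exact: (measurable_feat (msqrt q) _ (N := fun i : 'I_k => v i)).
- by move=> v; exact: feat2_le.
Qed.

Lemma kappaE eta q : kappa sigma eta q = (kap eta q)%:E.
Proof. by have [d [T [P [N [_ _ _ h _]]]]] := kappa_space. Qed.

Lemma gexp_kap eta q :
  gexp (fun N => (expR (energy eta (msqrt q) N))%:E) = (expR (kap eta q))%:E.
Proof.
have [d [T [P [N [mN h1 h2 _ _]]]]] := kappa_space.
rewrite h1 h2 lnK// posrE; apply: (@expR_Rint_gt0 _ _ _ P _ (esize eta)).
  exact: measurable_energy.
by move=> t; exact: energy_le.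
Qed.

Lemma energy0 s N : energy 0 s N = 0.
Proof. by rewrite /energy big1// => a _; rewrite big1// => b _; rewrite mxE !mul0r. Qed.

Lemma kap0 q : kap 0 q = 0.
Proof.
have [d [T [P [N [mN h1 h2 _ _]]]]] := kappa_space.
rewrite h2; under eq_Rintegral do rewrite energy0 expR0.
by rewrite Rintegral_cst1 ln1.
Qed.

Lemma energy_delta eta s N (t : R) a b :
  energy (eta + t *: delta_mx a b) s N = energy eta s N + t * (feat s N a * feat s N b).
Proof.
rewrite /energy.
transitivity (\sum_i \sum_j (eta i j * feat s N i * feat s N j +
   t * ((delta_mx a b : 'M[R]_k) i j * (feat s N i * feat s N j)))).
  by apply: eq_bigr => i _; apply: eq_bigr => j _; rewrite !mxE; ring.
under eq_bigr do rewrite big_split/=.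
rewrite big_split/=; congr (_ + _).
rewrite (bigD1 a)//= [X in _ + X]big1 ?addr0 => [|i ia]; last first.
  by rewrite big1// => j _; rewrite mxE (negbTE ia)/= mul0r mulr0.
rewrite (bigD1 b)//= [X in _ + X]big1 ?addr0 => [|j jb]; last first.
  by rewrite mxE (negbTE jb) andbF mul0r mulr0.
by rewrite mxE !eqxx mul1r.
Qed.

(* [m] is the mean of the exponentially tilted law: the gradient of [kap _ q] at [eta]. *)
Lemma kap_quad eta q : exists m : 'M[R]_k, (eta = 0 -> m = ymat sigma q) /\
  forall a b t, `|t| * M ^+ 2 <= 1 / 2 ->
    kap (eta + t *: delta_mx a b) q <= kap eta q + t * m a b + 2 * (M ^+ 2) ^+ 2 * t ^+ 2.
Proof.
have [d [T [P [N [mN h1 h2 _ h5]]]]] := kappa_space.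
set X := fun t => energy eta (msqrt q) (N^~ t).
set F := fun a b t => feat (msqrt q) (N^~ t) a * feat (msqrt q) (N^~ t) b.
exists (\matrix_(a, b) ((\int[P]_t (expR (X t) * F a b t)) / \int[P]_t expR (X t))).
split.
  move=> e0; apply/matrixP => a b; rewrite mxE h5.
  have X0 t : X t = 0 by rewrite /X e0 energy0.
  under eq_Rintegral do rewrite X0 expR0 mul1r.
  under [X in _ / X]eq_Rintegral do rewrite X0 expR0.
  by rewrite Rintegral_cst1 divr1.
move=> a b t tM; rewrite mxE !h2.
under eq_Rintegral do rewrite energy_delta.
apply: (@ln_mgf_le _ _ _ P X (F a b) (esize eta)) => //.
- exact: measurable_energy.
- by move=> s; exact: energy_le.
- by apply: measurable_funM; exact: measurable_feat.
- by move=> s; exact: feat2_le.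
Qed.

Lemma kap_jensen eta q : mxdot eta (ymat sigma q) <= kap eta q.
Proof.
have [d [T [P [N [mN h1 h2 _ h5]]]]] := kappa_space.
rewrite h2; apply: le_trans (@jensen_expR _ _ _ P _ (esize eta) _ _); last 2 first.
- exact: measurable_energy.
- by move=> s; exact: energy_le.
rewrite le_eqVlt; apply/orP; left; apply/eqP.
have isum (I : Type) (r : seq I) (f : I -> T -> R) :
    (forall i, P.-integrable setT (EFin \o f i)) ->
    P.-integrable setT (EFin \o (fun t => \sum_(i <- r) f i t)) /\
    \int[P]_t (\sum_(i <- r) f i t) = \sum_(i <- r) \int[P]_t f i t.
  move=> fi; elim: r => [|i r [IH1 IH2]].
    split.
      under eq_fun do rewrite big_nil.
      exact: (@integrable_bounded_fun _ _ _ P (fun=> 0) `|0| (measurable_cst _) (fun=> lexx _)).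
    by under eq_Rintegral do rewrite big_nil; rewrite big_nil Rintegral_cst1.
  split.
    under eq_fun do rewrite big_cons.
    exact: integrable_funD.
  under eq_Rintegral do rewrite big_cons.
  by rewrite big_cons RintegralD// IH2.
have if2 a b : P.-integrable setT (EFin \o (fun t => feat (msqrt q) (N^~ t) a * feat (msqrt q) (N^~ t) b)).
  apply: (@integrable_bounded_fun _ _ _ P _ (M ^+ 2)); last by move=> t; exact: feat2_le.
  by apply: measurable_funM; exact: measurable_feat.
have if3 a b : P.-integrable setT (EFin \o (fun t => eta a b * feat (msqrt q) (N^~ t) a * feat (msqrt q) (N^~ t) b)).
  have := integrable_funZl (eta a b) (if2 a b).
  by under [X in _ -> _.-integrable _ (_ \o X)]eq_fun do rewrite -mulrA.
have isum1 I r f fi := (@isum I r f fi).1; have isum2 I r f fi := (@isum I r f fi).2.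
rewrite /energy isum2; last by move=> a; exact: isum1.
apply: eq_bigr => a _; rewrite isum2//.
apply: eq_bigr => b _; rewrite h5 -RintegralZl//.
by apply: eq_Rintegral => t _; rewrite mulrA.
Qed.

Lemma kap_Eg eta q (l : seq 'cV[R]_k) : psd q -> cov l = q ->
  Eg l (fun z => (expR (\sum_a \sum_b eta a b * sigma (z a 0) * sigma (z b 0)))%:E) 0 =
  (expR (kap eta q))%:E.
Proof.
move=> pq cl; rewrite -gexp_kap -(@gexp_Eg _ _ _ (msqrt q)).
- congr gexp; apply/funext => N; congr ((expR _)%:E).
  by apply: eq_bigr => a _; apply: eq_bigr => b _; rewrite !mxE.
- move=> d T x mx; apply/measurable_EFinP; apply: measurable_expR_comp.
  apply: measurable_sum => a; apply: measurable_sum => b.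
  do 2?apply: measurable_funM => //;
  by apply: (measurableT_comp (continuous_measurable_fun csigma)).
- by move=> z; rewrite lee_fin expR_ge0.
- by rewrite msqrtM.
Qed.

Definition kapS eta s : R := ln (fine (gexp (fun N => (expR (energy eta s N))%:E))).

Lemma kapSE eta q : kapS eta (msqrt q) = kap eta q.
Proof. by rewrite /kapS gexp_kap/= expRK. Qed.

Lemma kapS_law eta s q : psd q -> s *m s^T = q -> kapS eta s = kap eta q.
Proof.
move=> pq sq; pose l := [seq col i (msqrt q) | i <- enum 'I_k].
have cl : cov l = q.
  rewrite /cov big_map -[RHS](msqrtM pq) big_enum/=; apply/matrixP => i j.
  by rewrite summxE mxE; apply: eq_bigr => c _; rewrite mxE big_ord1 !mxE.
have := kap_Eg eta pq cl; rewrite -(@gexp_Eg _ _ _ s) => [h|d T x mx|z|].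
- rewrite /kapS; suff -> : gexp (fun N => (expR (energy eta s N))%:E) = (expR (kap eta q))%:E.
    by rewrite /= expRK.
  rewrite -h; congr gexp; apply/funext => N; congr ((expR _)%:E).
  by apply: eq_bigr => a _; apply: eq_bigr => b _; rewrite !mxE.
- apply/measurable_EFinP; apply: measurable_expR_comp.
  apply: measurable_sum => a; apply: measurable_sum => b.
  do 2?apply: measurable_funM => //;
  by apply: (measurableT_comp (continuous_measurable_fun csigma)).
- by rewrite lee_fin expR_ge0.
- by rewrite cl sq.
Qed.

Lemma continuous_kapS eta : continuous (kapS eta).
Proof.
have [d [T [P [N [mN h1 h2 _ h5]]]]] := kappa_space.
have h0 s : 0 < \int[P]_t expR (energy eta s (N^~ t)).
  apply: (@expR_Rint_gt0 _ _ _ P _ (esize eta)); first exact: measurable_energy.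
  by move=> t; exact: energy_le.
apply: continuous_seq => s u us.
rewrite /kapS; under eq_fun do rewrite h1 /=; rewrite h1 /=.
apply: continuous_cvg; first exact: continuous_ln.
have cE t : continuous (fun s => expR (energy eta s (N^~ t))).
  move=> r; apply: continuous_comp; last exact: continuous_expR.
  apply: (continuous_sumr (T := 'M[R]_k)) => a; apply: continuous_sumr => b.
  have cf c : continuous (fun r : 'M[R]_k => feat r (N^~ t) c).
    move=> r'; apply: continuous_comp; last exact: csigma.
    apply: (continuous_sumr (T := 'M[R]_k)) => c'; apply: continuous_mulr.
      exact: coord_continuous.
    exact: cst_continuous.
  by do !apply: continuous_mulr => //; exact: cst_continuous.
have [] := @dominated_convergence _ _ _ P setT measurableT
  (fun i t => (expR (energy eta (u i) (N^~ t)))%:E) (fun t => (expR (energy eta s (N^~ t)))%:E)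
  (fun _ => (expR (esize eta))%:E).
- by move=> i; apply/measurable_EFinP/measurable_expR_comp; exact: measurable_energy.
- by apply/measurable_EFinP/measurable_expR_comp; exact: measurable_energy.
- apply: aeW => t _; apply: cvg_EFin; first by near=> i.
  exact: (cvg_comp _ _ us (cE t s)).
- exact: (@integrable_bounded_fun _ _ _ P (fun=> _) `|expR (esize eta)| (measurable_cst _) (fun=> lexx _)).
- apply: aeW => t i _; rewrite /= lee_fin; apply: expR_norm_le; exact: energy_le.
move=> _ _ h; apply: fine_cvg; move: h; congr (_ @ _ --> _).
rewrite /Rintegral fineK//; apply: integrable_fin_num => //.
apply: (expR_integrable P (measurable_energy eta s mN) (B := esize eta)) => t.
exact: energy_le.
Unshelve. all: by end_near. Qed.

(* Continuity of [msqrt] itself is not needed: square roots of matrices near [g] range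
   in a compact set, and [kapS eta] only depends on the square of its argument. *)
Lemma kap_continuous eta g (e : R) : psd g -> 0 < e ->
  exists2 de, 0 < de & forall q, psd q -> ball g de q -> `|kap eta q - kap eta g| < e.
Proof.
move=> pg e0; pose B : R := \sum_i `|g i i| + 1.
have B0 : 0 <= B by rewrite addr_ge0// sumr_ge0.
pose K : set 'M[R]_k := @mx_box R k k (B + 1) `&` [set s | e <= `|kapS eta s - kap eta g| ].
have cK : compact K.
  apply: (subclosed_compact _ (@compact_mx_box R k k (B + 1))); last by move=> s [].
  apply: closedI; first by apply: compact_closed; [exact: norm_hausdorff|exact: compact_mx_box].
  apply: closed_le_continuous; apply: (continuous_dist (T := 'M[R]_k)).
  exact: continuous_kapS.
pose sq (s : 'M[R]_k) : 'M[R]_k := s *m s^T.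
have csq : continuous sq.
  move=> s; apply: (cvg_mx (F := nbhs s)) => i j.
  rewrite /sq mxE; under eq_fun do rewrite mxE.
  apply: (continuous_sumr (T := 'M[R]_k)) => c; apply: continuous_mulr; first exact: coord_continuous.
  by under eq_fun do rewrite mxE; exact: coord_continuous.
have cT : closed (sq @` K).
  apply: compact_closed; first exact: norm_hausdorff.
  by apply: continuous_compact => //; exact: continuous_subspaceT.
have gT : ~ (sq @` K) g.
  by move=> [s [_ /= h] sg]; move: h; rewrite (kapS_law eta pg sg) subrr normr0 leNgt e0.
have /open_nbhs_nbhs : open_nbhs g (~` (sq @` K)) by split => //; exact: closed_openC.
move=> /nbhs_ballP[de /= de0 gde].
exists (Num.min de 1); first by rewrite lt_min de0 ltr01.
move=> q pq gq; rewrite ltNge; apply/negP => eq.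
have /gde : ball g de q by apply: le_ball gq; rewrite ge_min lexx.
apply; exists (msqrt q); last exact: msqrtM.
split; last by rewrite /= kapSE.
have qB i : q i i <= B.
  have : ball g 1 q by apply: le_ball gq; rewrite ge_min lexx orbT.
  move=> [_ /(_ i i)]; rewrite /ball/= distrC => /ltr_distlDr/ltW h.
  apply: le_trans (h) _; rewrite lerD2r (bigD1 i)//= (le_trans (ler_norm _))// lerDl sumr_ge0//.
move=> i j; have := msqrt_bound pq qB i j => h.
have B1 : 0 <= B + 1 by rewrite addr_ge0.
suff : `|msqrt q i j| ^+ 2 <= (B + 1) ^+ 2 by rewrite ler_pXn2r ?nnegrE.
rewrite real_normK ?num_real// (le_trans h)// sqrrD1 mulr2n.
by rewrite -addrA -[leLHS]add0r lerD ?sqr_ge0// -addrA lerDl addr_ge0.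
Qed.

End CumulantFunction.

(** * Upper and lower bounds by exponential tilting *)

Section Mxdot.
Context {R : realType} {p r : nat}.
Implicit Types eta y : 'M[R]_(p, r).

Definition asum eta : R := \sum_a \sum_b `|eta a b|.

Lemma asum_ge0 eta : 0 <= asum eta.
Proof. by apply: sumr_ge0 => a _; apply: sumr_ge0. Qed.

Lemma mxdot0l y : mxdot 0 y = 0.
Proof. by rewrite /mxdot big1// => a _; rewrite big1// => b _; rewrite mxE mul0r. Qed.

Lemma mxdot_lip eta y y' (e : R) : (forall a b, `|y a b - y' a b| <= e) ->
  `|mxdot eta y - mxdot eta y'| <= asum eta * e.
Proof.
move=> h; rewrite /mxdot -sumrB mulr_suml.
apply: le_trans (ler_norm_sum _ _ _) _; apply: ler_sum => a _.
rewrite -sumrB mulr_suml.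
apply: le_trans (ler_norm_sum _ _ _) _; apply: ler_sum => b _.
by rewrite -mulrBr normrM ler_wpM2l.
Qed.

Lemma mxdot_deltal eta y (t : R) a b :
  mxdot (eta + t *: delta_mx a b) y = mxdot eta y + t * y a b.
Proof.
rewrite /mxdot.
transitivity (\sum_i \sum_j (eta i j * y i j + t * ((delta_mx a b : 'M[R]_(p, r)) i j * y i j))).
  by apply: eq_bigr => i _; apply: eq_bigr => j _; rewrite !mxE; ring.
under eq_bigr do rewrite big_split/=.
rewrite big_split/=; congr (_ + _).
rewrite (bigD1 a)//= [X in _ + X]big1 ?addr0 => [|i ia]; last first.
  by rewrite big1// => j _; rewrite mxE (negbTE ia)/= mul0r mulr0.
rewrite (bigD1 b)//= [X in _ + X]big1 ?addr0 => [|j jb]; last first.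
  by rewrite mxE (negbTE jb) andbF mul0r mulr0.
by rewrite mxE !eqxx mul1r.
Qed.

Lemma mxdotC eta y : mxdot eta y = mxdot y eta.
Proof. by apply: eq_bigr => a _; apply: eq_bigr => b _; rewrite mulrC. Qed.

Lemma mxdot_deltar eta y (t : R) a b :
  mxdot eta (y + t *: delta_mx a b) = mxdot eta y + t * eta a b.
Proof. by rewrite mxdotC mxdot_deltal mxdotC. Qed.

Lemma mxdot_ge_sqr eta a b : eta a b ^+ 2 <= mxdot eta eta.
Proof.
rewrite /mxdot (bigD1 a)//= (bigD1 b)//= -expr2 -addrA lerDl addr_ge0//.
  by apply: sumr_ge0 => j _; rewrite -expr2 sqr_ge0.
by apply: sumr_ge0 => i _; apply: sumr_ge0 => j _; rewrite -expr2 sqr_ge0.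
Qed.

Lemma mxdotBr eta y y' : mxdot eta (y - y') = mxdot eta y - mxdot eta y'.
Proof.
rewrite /mxdot -sumrB; apply: eq_bigr => a _; rewrite -sumrB; apply: eq_bigr => b _.
by rewrite !mxE mulrBr.
Qed.

Lemma mxdotZr (c : R) eta y : mxdot eta (c *: y) = c * mxdot eta y.
Proof.
rewrite /mxdot mulr_sumr; apply: eq_bigr => a _; rewrite mulr_sumr; apply: eq_bigr => b _.
by rewrite !mxE mulrCA.
Qed.

End Mxdot.

Section OneStep.
Context {R : realType} d (Omega : measurableType d) (P : probability Omega R).
Context {k p r : nat}.
Variable S : set 'M[R]_k.
Variable kp : 'M[R]_(p, r) -> 'M[R]_k -> R.
Implicit Types (X : Omega -> 'M[R]_k) (Y : Omega -> 'M[R]_(p, r)).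

Definition mx_measurable m n (X : Omega -> 'M[R]_(m, n)) : Prop :=
  forall i j, measurable_fun setT (fun w => X w i j).

Definition inball m n (X : Omega -> 'M[R]_(m, n)) (g : 'M[R]_(m, n)) (rho : R) : set Omega :=
  [set w | ball g rho (X w)].

(* [Y] has, conditionally on [X], the logarithmic moment generating function
   [N * kp eta X] at [N * eta]. *)
Definition mgf_model (N : R) X Y : Prop :=
  [/\ 0 <= N, mx_measurable X /\ mx_measurable Y,
   forall eta, measurable_fun setT (fun w => kp eta (X w)), forall w, S (X w) &
   forall eta g rho,
     (\int[P]_(w in inball X g rho) (expR (N * mxdot eta (Y w)))%:E =
      \int[P]_(w in inball X g rho) (expR (N * kp eta (X w)))%:E)%E].

Variable g : 'M[R]_k.
Hypothesis kp_continuous : forall eta (e : R), 0 < e ->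
  nbhs g (fun q => S q -> `|kp eta q - kp eta g| < e).
Hypothesis kp0 : forall q, kp 0 q = 0.
Variables C t0 : R.
Hypothesis C0 : 0 <= C.
Hypothesis t00 : 0 < t0.

Lemma measurable_inball m n (X : Omega -> 'M[R]_(m, n)) h rho :
  mx_measurable X -> measurable (inball X h rho).
Proof.
move=> mX; have [rho0|rho0] := ltP 0 rho; last first.
  rewrite (_ : inball X h rho = set0)//.
  by apply/seteqP; split => // w [+ _]; rewrite ltNge rho0.
have -> : inball X h rho = \bigcap_(ij in [set: 'I_m * 'I_n])
    (fun w => X w ij.1 ij.2) @^-1` ball (h ij.1 ij.2) rho.
  apply/seteqP; split => w /= H; first by move=> ij _; exact: H.2.
  by split => // i j; exact: (H (i, j)).
apply: fin_bigcap_measurable => [|ij _]; first exact: finite_finset.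
by rewrite -[X in measurable X]setTI; apply: mX => //; exact: measurable_ball.
Qed.

Lemma measurable_mxdot eta Y : mx_measurable Y -> measurable_fun setT (fun w => mxdot eta (Y w)).
Proof.
move=> mY; apply: measurable_sum => a; apply: measurable_sum => b.
by apply: measurable_funM => //; exact: mY.
Qed.

Lemma int_le (A : set Omega) (f h : Omega -> R) : measurable A ->
  measurable_fun setT f -> measurable_fun setT h ->
  (forall w, 0 <= f w) -> (forall w, A w -> f w <= h w) ->
  (\int[P]_(w in A) (f w)%:E <= \int[P]_(w in A) (h w)%:E)%E.
Proof.
move=> mA mf mh f0 fh; apply: ge0_le_integral => //.
- by move=> w _; rewrite lee_fin.
- exact/measurable_funTS/measurable_EFinP.
- exact/measurable_funTS/measurable_EFinP.
Qed.

Lemma int_subset (A B : set Omega) (f : Omega -> R) : measurable A -> measurable B ->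
  measurable_fun setT f -> (forall w, 0 <= f w) -> A `<=` B ->
  (\int[P]_(w in A) (f w)%:E <= \int[P]_(w in B) (f w)%:E)%E.
Proof.
move=> mA mB mf f0 AB; apply: ge0_subset_integral => //.
- exact/measurable_funTS/measurable_EFinP.
- by move=> w _; rewrite lee_fin.
Qed.

Lemma int_Zl (A : set Omega) (c : R) (f : Omega -> R) : measurable A -> 0 <= c ->
  measurable_fun setT f -> (forall w, 0 <= f w) ->
  (\int[P]_(w in A) (c * f w)%:E = c%:E * \int[P]_(w in A) (f w)%:E)%E.
Proof.
move=> mA c0 mf f0; under eq_integral do rewrite EFinM.
apply: ge0_integralZl_EFin => //.
- by move=> w _; rewrite lee_fin.
- exact/measurable_funTS/measurable_EFinP.
Qed.

Lemma int_cst (A : set Omega) (c : R) : measurable A ->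
  (\int[P]_(w in A) c%:E = c%:E * P A)%E.
Proof. by move=> mA; rewrite integral_cst. Qed.

Lemma int_sum (A : set Omega) (I : Type) (s : seq I) (f : I -> Omega -> R) : measurable A ->
  (forall i, measurable_fun setT (f i)) -> (forall i w, 0 <= f i w) ->
  (\int[P]_(w in A) (\sum_(i <- s) f i w)%:E = \sum_(i <- s) \int[P]_(w in A) (f i w)%:E)%E.
Proof.
move=> mA mf f0; under eq_integral do rewrite -sumEFin.
rewrite ge0_integral_sum// => [i|i w _]; last by rewrite lee_fin.
exact/measurable_funTS/measurable_EFinP.
Qed.

Lemma upper_step eta y (a : R) : a < mxdot eta y - kp eta g ->
  exists2 de, 0 < de & forall rho N X Y, rho <= de -> mgf_model N X Y ->
    (P (inball X g rho `&` inball Y y de) <= (expR (- (N * a)))%:E * P (inball X g rho))%E.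
Proof.
move=> lta; pose e := (mxdot eta y - kp eta g - a) / 2.
have e0 : 0 < e by rewrite divr_gt0// subr_gt0.
have /nbhs_ballP[d1 /= d10 Hd1] := kp_continuous eta e0.
have as1 : 0 < asum eta + 1 by rewrite ltr_wpDl// asum_ge0.
exists (Num.min d1 (e / (asum eta + 1))).
  by rewrite lt_min d10 divr_gt0.
set de := Num.min _ _ => rho N X Y rhode [N0 [mX mY] mk XS mgf].
have mA : measurable (inball X g rho) by exact: measurable_inball.
have mB : measurable (inball Y y de) by exact: measurable_inball.
have mAB := measurableI _ _ mA mB.
set A := inball X g rho in mA mAB *; set B := inball Y y de in mB mAB *.
pose c := expR (- (N * (mxdot eta y - e))).
pose f w := expR (N * mxdot eta (Y w)).
have mf : measurable_fun setT f.
  by apply: measurable_expR_comp; apply: measurable_funM => //; exact: measurable_mxdot.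
have f0 w : 0 <= f w by exact: expR_ge0.
have c0 : 0 <= c by exact: expR_ge0.
have i1 : (P (A `&` B) <= \int[P]_(w in A `&` B) (c * f w)%:E)%E.
  rewrite -[X in (X <= _)%E]mul1e -int_cst//; apply: int_le => //.
    exact: measurable_funM.
  move=> w [_ [_ /= Bw]]; rewrite /c /f -expRD -[X in X <= _]expR0 ler_expR.
  rewrite addrC -mulrBr mulr_ge0//.
  have /ler_normlP[+ _] : `|mxdot eta (Y w) - mxdot eta y| <= asum eta * de.
    by apply: mxdot_lip => a' b'; rewrite distrC ltW//; exact: Bw.
  rewrite opprB => h.
  have : asum eta * de <= e.
    rewrite (@le_trans _ _ (asum eta * (e / (asum eta + 1))))//.
      by rewrite ler_wpM2l ?asum_ge0// ge_min lexx orbT.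
    by rewrite mulrCA ger_pMr// ler_pdivrMr// mul1r lerDl.
  move: h; lra.
apply: (le_trans i1); apply: (le_trans (y := (\int[P]_(w in A) (c * f w)%:E)%E)).
  apply: int_subset => //; [exact: measurable_funM|by move=> w; exact: mulr_ge0].
rewrite int_Zl// [X in (_ * X)%E]mgf -/A.
have -> : expR (- (N * a)) = c * expR (N * (kp eta g + e)).
  by rewrite /c -expRD; congr expR; rewrite /e; field.
rewrite EFinM -muleA lee_pmul2l ?lte_fin ?expR_gt0// -int_cst//.
apply: int_le => //.
  by apply: measurable_expR_comp; exact: measurable_funM.
move=> w Aw; rewrite ler_expR ler_wpM2l//.
have : ball g d1 (X w) by apply: le_ball Aw; rewrite (le_trans rhode)// ge_min lexx.
by move=> /Hd1/(_ (XS w))/ltr_distlDr/ltW.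
Qed.

Definition quad_bound eta (m : 'M[R]_(p, r)) : Prop := forall a b t, `|t| <= t0 ->
  kp (eta + t *: delta_mx a b) g <= kp eta g + t * m a b + C * t ^+ 2.

(* Exponential Chebyshev inequality for the law tilted by [eta], whose mean is [m]. *)
Lemma tilt_escape eta m de : quad_bound eta m -> 0 < de ->
  exists rho0 c : R, [/\ 0 < rho0, 0 < c & forall rho, 0 < rho -> rho <= rho0 ->
   forall N X Y, mgf_model N X Y ->
    (\int[P]_(w in inball X g rho `\` inball Y m de) (expR (N * mxdot eta (Y w)))%:E <=
     ((p * r * 2)%:R * expR (- (N * c)))%:E *
     \int[P]_(w in inball X g rho) (expR (N * mxdot eta (Y w)))%:E)%E].
Proof.
move=> qm de0.
pose I := ('I_p * 'I_r * bool)%type.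
pose t := Num.min t0 (de / (2 * (C + 1))).
have C1 : 0 < C + 1 by rewrite ltr_wpDl.
have tp : 0 < t by rewrite lt_min t00 divr_gt0// mulr_gt0.
have tt0 : t <= t0 by rewrite ge_min lexx.
have Ct : C * t ^+ 2 <= t * de / 2.
  have h : t * (2 * (C + 1)) <= de.
    by rewrite -ler_pdivlMr ?mulr_gt0// ge_min lexx orbT.
  have : t * (t * (2 * (C + 1))) <= t * de by rewrite ler_pM2l.
  have : 0 <= t ^+ 2 by exact: sqr_ge0.
  rewrite expr2; nra.
pose sg (i : I) : R := (-1) ^+ i.2.
have sg2 i : `|sg i * t| <= t0 by rewrite normrM normrX normrN1 expr1n mul1r gtr0_norm.
have sgt i : (sg i * t) ^+ 2 = t ^+ 2 by rewrite exprMn sqrr_sign mul1r.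
pose et (i : I) := eta + (sg i * t) *: delta_mx i.1.1 i.1.2.
pose e := t * de / 8.
have e0 : 0 < e by rewrite divr_gt0// mulr_gt0.
have H : nbhs g (fun q => forall o : option I, S q ->
    `|kp (if o is Some i then et i else eta) q - kp (if o is Some i then et i else eta) g| < e).
  by apply: (@filter_forall _ _ _ (nbhs g) (nbhs_filter g)) => o; exact: kp_continuous.
move: H => /nbhs_ballP[rho0 /= rho00 Hrho].
pose c := t * de / 4.
exists rho0, c; split => //; first by rewrite divr_gt0// mulr_gt0.
move=> rho rhop rle N X Y [N0 [mX mY] mk XS mgf].
have mA : measurable (inball X g rho) by exact: measurable_inball.
have mB : measurable (inball Y m de) by exact: measurable_inball.
set A := inball X g rho in mA *; set B := inball Y m de in mB *.
have mD : measurable (A `\` B) by exact: measurableD.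
pose f z w := expR (N * mxdot z (Y w)).
have mf z : measurable_fun setT (f z).
  by apply: measurable_expR_comp; apply: measurable_funM => //; exact: measurable_mxdot.
have f0 z w : 0 <= f z w by exact: expR_ge0.
pose cc (i : I) := expR (- (N * (t * (sg i * m i.1.1 i.1.2 + de)))).
have cc0 i : 0 <= cc i by exact: expR_ge0.
have mh i : measurable_fun setT (fun w => cc i * f (et i) w) by exact: measurable_funM.
have h0 i w : 0 <= cc i * f (et i) w by exact: mulr_ge0.
have step1 : (\int[P]_(w in A `\` B) (f eta w)%:E <=
    \int[P]_(w in A `\` B) (\sum_(i : I) cc i * f (et i) w)%:E)%E.
  apply: int_le => //; first exact: measurable_sum.
  move=> w [_ nB].
  have [a [b hab]] : exists a b, de <= `|m a b - Y w a b|.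
    apply: contrapT => nex; apply: nB; split => // a b; rewrite /ball/= ltNge.
    by apply/negP => hab; apply: nex; exists a, b.
  pose i : I := (a, b, (Y w a b < m a b)).
  apply: (@le_trans _ _ (cc i * f (et i) w)); last first.
    by rewrite (bigD1 i)//= lerDl sumr_ge0.
  rewrite /cc /f -expRD ler_expR mxdot_deltal /= -mulrN -mulrDr ler_wpM2l//.
  rewrite addrC -addrA lerDl -mulrN -/(sg i).
  have : de <= sg i * (Y w a b - m a b).
    rewrite /sg /=; case: ltP hab => h; rewrite ?expr1 ?expr0 ?mul1r ?mulN1r.
      by rewrite opprB gtr0_norm ?subr_gt0.
    by rewrite distrC ger0_norm ?subr_ge0.
  move=> h; have -> : sg i * t * Y w a b + t * - (sg i * m a b + de) =
    t * (sg i * (Y w a b - m a b) - de) by ring.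
  by rewrite mulr_ge0 ?subr_ge0// ltW.
apply: (le_trans step1).
have step2 : (\int[P]_(w in A `\` B) (\sum_(i : I) cc i * f (et i) w)%:E <=
    \int[P]_(w in A) (\sum_(i : I) cc i * f (et i) w)%:E)%E.
  apply: int_subset => //; first exact: measurable_sum.
  by move=> w; apply: sumr_ge0.
apply: (le_trans step2); rewrite int_sum//.
have step3 i : (\int[P]_(w in A) (cc i * f (et i) w)%:E <=
    (expR (- (N * c)))%:E * \int[P]_(w in A) (f eta w)%:E)%E.
  rewrite int_Zl// [X in (_ * X <= _)%E]mgf [X in (_ <= _ * X)%E]mgf -/A.
  have mke z : measurable_fun setT (fun w => expR (N * kp z (X w))).
    by apply: measurable_expR_comp; exact: measurable_funM.
  rewrite -!int_Zl ?expR_ge0//.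
  apply: int_le; [exact: mA|exact: measurable_funM|exact: measurable_funM| |].
    by move=> w; rewrite mulr_ge0// expR_ge0.
  move=> w Aw; rewrite /cc -!expRD ler_expR -!mulrN -!mulrDr ler_wpM2l//.
  have gX : ball g rho0 (X w) by apply: le_ball Aw.
  have := Hrho _ gX (Some i) (XS w); have := Hrho _ gX None (XS w).
  have := qm i.1.1 i.1.2 (sg i * t) (sg2 i); rewrite sgt -/(et i).
  move=> h1 /ltr_distlCBl/ltW h2 /ltr_distlDr/ltW h3.
  move: h1 h2 h3; rewrite /c /e; move: Ct.
  have -> : t * - (sg i * m i.1.1 i.1.2 + de) = - (sg i * t * m i.1.1 i.1.2) - t * de by ring.
  lra.
apply: (@le_trans _ _ (\sum_(i : I) ((expR (- (N * c)))%:E * \int[P]_(w in A) (f eta w)%:E))%E).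
  by apply: lee_sum => i _; exact: step3.
rewrite le_eqVlt; apply/orP; left; apply/eqP.
rewrite -ge0_sume_distrl => [|i _]; last by rewrite lee_fin expR_ge0.
by rewrite sumEFin sumr_const !card_prod !card_ord card_bool mulr_natl.
Qed.

Lemma tilt_lower eta m de : quad_bound eta m -> 0 < de ->
  exists rho0 N0 : R, 0 < rho0 /\ forall rho, 0 < rho -> rho <= rho0 ->
   forall N X Y, N0 <= N -> mgf_model N X Y ->
    ((1 / 2)%:E * \int[P]_(w in inball X g rho) (expR (N * mxdot eta (Y w)))%:E <=
     \int[P]_(w in inball X g rho `&` inball Y m de) (expR (N * mxdot eta (Y w)))%:E)%E.
Proof.
move=> qm de0; have [r1 [c [r10 c0 H]]] := tilt_escape qm de0.
have /nbhs_ballP[r2 /= r20 Hr2] := kp_continuous eta (ltr01 : (0 : R) < 1).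
pose n : R := (p * r * 2)%:R.
exists (Num.min r1 r2), (2 * n / c); split; first by rewrite lt_min r10.
move=> rho rhop; rewrite le_min => /andP[rr1 rr2] N X Y NN mod.
have [N0 [mX mY] mk XS mgf] := mod.
have mA : measurable (inball X g rho) by exact: measurable_inball.
have mB : measurable (inball Y m de) by exact: measurable_inball.
have := H rho rhop rr1 _ _ _ mod.
set A := inball X g rho in mA *; set B := inball Y m de in mB *.
have mD : measurable (A `\` B) by exact: measurableD.
have mAB : measurable (A `&` B) by exact: measurableI.
pose f w := expR (N * mxdot eta (Y w)).
have mf : measurable_fun setT f.
  by apply: measurable_expR_comp; apply: measurable_funM => //; exact: measurable_mxdot.
have f0 w : 0 <= f w by exact: expR_ge0.
rewrite -/f => h.
have split_int : (\int[P]_(w in A) (f w)%:E =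
    \int[P]_(w in A `&` B) (f w)%:E + \int[P]_(w in A `\` B) (f w)%:E)%E.
  have {1}-> : A = (A `&` B) `|` (A `\` B).
    apply/seteqP; split => [w Aw|w [[]|[]]//].
    by case: (pselect (B w)) => Bw; [left|right].
  rewrite ge0_integral_setU//.
  - exact/measurable_funTS/measurable_EFinP.
  - by move=> w _; rewrite lee_fin.
  - by apply/disj_setPS => w [[_ ?] [_]].
have fin : (\int[P]_(w in A) (f w)%:E)%E \is a fin_num.
  rewrite ge0_fin_numE; last by apply: integral_ge0 => w _; rewrite lee_fin.
  rewrite [X in (X < _)%E]mgf -/A.
  apply: (@le_lt_trans _ _ ((expR (N * (kp eta g + 1)))%:E * P A)%E).
    rewrite -int_cst//; apply: int_le => //.
      by apply: measurable_expR_comp; exact: measurable_funM.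
    move=> w Aw; rewrite ler_expR ler_wpM2l//.
    have : ball g r2 (X w) by apply: le_ball Aw.
    by move=> /Hr2/(_ (XS w))/ltr_distlDr/ltW.
  by rewrite lte_mul_pinfty// ?lee_fin ?expR_ge0// (le_lt_trans (probability_le1 P mA))// ltry.
have half : (\int[P]_(w in A `\` B) (f w)%:E <= (1 / 2)%:E * \int[P]_(w in A) (f w)%:E)%E.
  apply: (le_trans h); rewrite lee_wpmul2r//; first by apply: integral_ge0 => w _; rewrite lee_fin.
  rewrite lee_fin expRN ler_pdivrMr ?expR_gt0// -/n.
  have h1 : 1 + N * c <= expR (N * c) by exact: expR_ge1Dx.
  have h2 : 2 * n <= N * c by rewrite -ler_pdivrMr.
  lra.
move: fin split_int half; set u := (\int[P]_(w in A) _)%E; set v := (\int[P]_(w in A `&` B) _)%E.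
set z := (\int[P]_(w in A `\` B) _)%E => fu uvz zu.
have v0 : (0 <= v)%E by apply: integral_ge0 => w _; rewrite lee_fin.
have z0 : (0 <= z)%E by apply: integral_ge0 => w _; rewrite lee_fin.
move: fu zu v0 z0; rewrite uvz.
case: v {uvz} => [v||]; case: z => [z||] //=; rewrite -?EFinD -?EFinM ?lee_fin => _; lra.
Qed.

Lemma lower_step_tilt eta m de (a : R) : quad_bound eta m -> 0 < de ->
  mxdot eta m - kp eta g < a ->
  exists2 rho0 : R, 0 < rho0 & forall rho, 0 < rho -> rho <= rho0 ->
   exists N0 : R, forall N X Y, N0 <= N -> mgf_model N X Y ->
    ((expR (- (N * a)))%:E * P (inball X g rho) <=
      P (inball X g rho `&` inball Y m de))%E.
Proof.
move=> qm de0 ha; pose e := (a - (mxdot eta m - kp eta g)) / 4.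
have e0 : 0 < e by rewrite divr_gt0// subr_gt0.
have as1 : 0 < asum eta + 1 by rewrite ltr_wpDl// asum_ge0.
pose de' := Num.min de (e / (asum eta + 1)).
have de'0 : 0 < de' by rewrite lt_min de0 divr_gt0.
have [r1 [N1 [r10 H]]] := tilt_lower qm de'0.
have /nbhs_ballP[r2 /= r20 Hr2] := kp_continuous eta e0.
exists (Num.min r1 r2); first by rewrite lt_min r10.
move=> rho rhop; rewrite le_min => /andP[rr1 rr2].
exists (Num.max N1 (1 / e)) => N X Y; rewrite ge_max => /andP[NN1 NN2] mod.
have [N0 [mX mY] mk XS mgf] := mod.
have := H rho rhop rr1 _ _ _ NN1 mod.
have mA : measurable (inball X g rho) by exact: measurable_inball.
have mB : measurable (inball Y m de') by exact: measurable_inball.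
have mB' : measurable (inball Y m de) by exact: measurable_inball.
have mAB := measurableI _ _ mA mB.
set A := inball X g rho in mA mAB *; set B := inball Y m de' in mB mAB *.
pose f w := expR (N * mxdot eta (Y w)).
have mf : measurable_fun setT f.
  by apply: measurable_expR_comp; apply: measurable_funM => //; exact: measurable_mxdot.
rewrite -/f => h.
have up : (\int[P]_(w in A `&` B) (f w)%:E <= (expR (N * (mxdot eta m + e)))%:E * P (A `&` B))%E.
  rewrite -int_cst//; apply: int_le => //; first by move=> w; exact: expR_ge0.
  move=> w [_ [_ Bw]]; rewrite ler_expR ler_wpM2l//.
  have /ler_normlP[_] : `|mxdot eta (Y w) - mxdot eta m| <= asum eta * de'.
    by apply: mxdot_lip => a' b'; rewrite distrC ltW//; exact: Bw.
  have : asum eta * de' <= e.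
    rewrite (@le_trans _ _ (asum eta * (e / (asum eta + 1))))//.
      by rewrite ler_wpM2l ?asum_ge0// ge_min lexx orbT.
    by rewrite mulrCA ger_pMr// ler_pdivrMr// mul1r lerDl.
  lra.
have lo : ((expR (N * (kp eta g - e)))%:E * P A <= \int[P]_(w in A) (f w)%:E)%E.
  rewrite [X in (_ <= X)%E]mgf -/A -int_cst//; apply: int_le => //.
  - by apply: measurable_expR_comp; exact: measurable_funM.
  move=> w Aw; rewrite ler_expR ler_wpM2l//.
  have : ball g r2 (X w) by apply: le_ball Aw.
  by move=> /Hr2/(_ (XS w))/ltr_distlCBl/ltW.
have bal : (P (A `&` B) <= P (A `&` inball Y m de))%E.
  apply: le_measure; rewrite ?inE//; first exact: measurableI.
  by apply: setIS => w /= Bw; apply: le_ball Bw; rewrite ge_min lexx.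
apply: le_trans bal.
rewrite -(@lee_pmul2l _ (expR (N * (mxdot eta m + e)))%:E) ?lte_fin ?expR_gt0//.
apply: le_trans up; apply: le_trans h.
apply: (le_trans (y := ((1 / 2)%:E * ((expR (N * (kp eta g - e)))%:E * P A))%E)); last first.
  by rewrite lee_pmul2l.
rewrite !muleA lee_wpmul2r// -!EFinM lee_fin -expRD.
have -> : N * (kp eta g - e) = N * (mxdot eta m + e) + - (N * a) + 2 * (N * e).
  by rewrite /e; field.
rewrite [X in _ <= _ * X]expRD mulrCA ler_peMr ?expR_ge0//.
have : 1 <= N * e by rewrite -ler_pdivrMr.
have := expR_ge1Dx (2 * (N * e)); lra.
Qed.

Lemma lower_step_mean m de : quad_bound 0 m -> 0 < de ->
  exists2 rho0 : R, 0 < rho0 & forall rho, 0 < rho -> rho <= rho0 ->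
   exists N0 : R, forall N X Y, N0 <= N -> mgf_model N X Y ->
    ((1 / 2)%:E * P (inball X g rho) <= P (inball X g rho `&` inball Y m de))%E.
Proof.
move=> qm de0; have [r1 [N1 [r10 H]]] := tilt_lower qm de0.
exists r1 => // rho rhop rr1; exists N1 => N X Y NN1 mod.
have [N0 [mX mY] mk XS mgf] := mod.
have := H rho rhop rr1 _ _ _ NN1 mod.
have mA : measurable (inball X g rho) by exact: measurable_inball.
have mB : measurable (inball Y m de) by exact: measurable_inball.
have mAB := measurableI _ _ mA mB.
have E D : measurable D -> (\int[P]_(w in D) (expR (N * mxdot 0 (Y w)))%:E = P D)%E.
  move=> mD; under eq_integral do rewrite mxdot0l mulr0 expR0.
  by rewrite int_cst// mul1e.
by rewrite !E.
Qed.

(* Adding [- e |eta|^2 / 2] makes the maximisation of [<eta, y> - kp eta g] coercive,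
   so an approximate maximiser [eta] has a tilted mean [m] close to [y]. *)
Lemma approx_tilt y (c0 a de : R) : 0 < de -> c0 < a ->
  (forall eta, mxdot eta y - kp eta g <= c0) ->
  (forall eta, exists m, quad_bound eta m) ->
  exists eta m, [/\ quad_bound eta m, forall i j, `|y i j - m i j| <= de &
    mxdot eta m - kp eta g < a].
Proof.
move=> de0 ca yc qb.
have c00 : 0 <= c0 by apply: le_trans (yc 0); rewrite mxdot0l kp0 subrr.
pose u := 2 * (c0 + 1).
have u0 : 0 < u by rewrite mulr_gt0// ltr_wpDl.
pose e := de ^+ 2 / (4 * u).
have e0 : 0 < e by rewrite divr_gt0 ?exprn_gt0// mulr_gt0.
pose H := u / e + 1.
have H0 : 0 < H by rewrite ltr_wpDl// divr_ge0// ltW.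
pose D := Num.min (de / 2) ((a - c0) / (2 * ((p * r)%:R * H + 1))).
have prH : 0 < (p * r)%:R * H + 1 by rewrite ltr_wpDl// mulr_ge0// ltW.
have D0 : 0 < D by rewrite lt_min divr_gt0//= divr_gt0 ?subr_gt0// mulr_gt0.
have Ce : 0 < C + e by rewrite ltr_wpDl.
pose t := Num.min t0 (D / (2 * (C + e))).
have tp : 0 < t by rewrite lt_min t00 divr_gt0// mulr_gt0.
have tt0 : t <= t0 by rewrite ge_min lexx.
have tD : (C + e) * t <= D / 2.
  have : t <= D / (2 * (C + e)) by rewrite ge_min lexx orbT.
  by rewrite invfM mulrA ler_pdivlMr// mulrC.
pose tau := Num.min 1 (t * D / 2).
have tau0 : 0 < tau by rewrite lt_min ltr01 divr_gt0// mulr_gt0.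
pose phi eta := mxdot eta y - kp eta g - e / 2 * mxdot eta eta.
have sq0 (eta : 'M[R]_(p, r)) : 0 <= mxdot eta eta.
  by apply: sumr_ge0 => i _; apply: sumr_ge0 => j _; rewrite -expr2 sqr_ge0.
have hs : has_sup (range phi).
  split; first by exists (phi 0), 0.
  exists c0 => _ [eta _ <-]; rewrite /phi; have := yc eta.
  have : 0 <= e / 2 * mxdot eta eta by rewrite mulr_ge0// ltW// divr_gt0.
  lra.
have [_ [eta _ <-] Heta] := sup_adherent tau0 hs.
have Hmax z : phi z <= phi eta + tau.
  have : phi z <= sup (range phi) by apply: sup_upper_bound => //; exists z.
  by move: Heta; lra.
have [m qm] := qb eta.
have sqH : e * mxdot eta eta <= u.
  have := Hmax 0; rewrite /phi mxdot0l kp0 mxdot0l mulr0 !subr0.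
  have := yc eta; have : tau <= 1 by rewrite ge_min lexx.
  rewrite /u; lra.
have etaH i j : `|eta i j| <= H.
  have h : `|eta i j| ^+ 2 <= u / e.
    rewrite real_normK ?num_real// ler_pdivlMr// mulrC (le_trans _ sqH)// ler_pM2l//.
    exact: mxdot_ge_sqr.
  have : 0 <= `|eta i j| by []. 
  by move: h; rewrite /H expr2; nra.
have dab i j : `|y i j - m i j - e * eta i j| <= D.
  have key s : `|s| = t -> s * (y i j - m i j - e * eta i j) <= t * D.
    move=> st; have s2 : s ^+ 2 = t ^+ 2 by rewrite -st real_normK ?num_real.
    have := Hmax (eta + s *: delta_mx i j).
    have := qm i j s; rewrite st s2 => /(_ tt0).
    rewrite /phi mxdot_deltal mxdot_deltal mxdot_deltar.
    have -> : (eta + s *: delta_mx i j) i j = eta i j + s by rewrite !mxE !eqxx mulr1.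
    have : tau <= t * D / 2 by rewrite ge_min lexx orbT.
    have : t * ((C + e) * t) <= t * (D / 2) by rewrite ler_pM2l.
    have : 0 <= e * t ^+ 2 by rewrite mulr_ge0 ?sqr_ge0// ltW.
    rewrite (mulrDr s (eta i j)) -[s * s]expr2 s2 expr2; nra.
  apply/ler_normlP; split; rewrite -(@ler_pM2l _ t)//.
    have := key (- t); rewrite normrN gtr0_norm// => /(_ erefl).
    by rewrite mulNr mulrN.
  by have := key t; rewrite gtr0_norm// => /(_ erefl).
have eeta i j : e * `|eta i j| <= de / 2.
  have h1 : 0 <= de / 2 by rewrite ltW// divr_gt0.
  have h2 : 0 <= e * `|eta i j| by rewrite mulr_ge0// ltW.
  rewrite -(@ler_pXn2r _ 2) ?nnegrE//.
  rewrite exprMn real_normK ?num_real//.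
  apply: (@le_trans _ _ (e * u)).
    rewrite expr2 -mulrA ler_pM2l// (le_trans _ sqH)// ler_pM2l//.
    exact: mxdot_ge_sqr.
  rewrite /e exprMn exprVn le_eqVlt; apply/orP; left; apply/eqP.
  by field; rewrite gt_eqF.
exists eta, m; split => //.
- move=> i j.
  have -> : y i j - m i j = (y i j - m i j - e * eta i j) + e * eta i j by rewrite subrK.
  apply: le_trans (ler_normD _ _) _; rewrite normrM (gtr0_norm e0).
  have := dab i j; have := eeta i j.
  have : D <= de / 2 by rewrite ge_min lexx.
  lra.
have asH : asum eta <= (p * r)%:R * H.
  rewrite natrM -mulrA /asum.
  apply: (@le_trans _ _ (\sum_(i < p) \sum_(j < r) H)).
    by apply: ler_sum => i _; apply: ler_sum.
  by rewrite !sumr_const !card_ord mulr_natl mulr_natl.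
have : `|mxdot eta (y - e *: eta) - mxdot eta m| <= asum eta * D.
  by apply: mxdot_lip => i j; rewrite !mxE addrAC.
rewrite mxdotBr mxdotZr => /ler_normlP[+ _].
have : asum eta * D <= (a - c0) / 2.
  apply: (@le_trans _ _ ((p * r)%:R * H * D)); first by rewrite ler_pM2r.
  apply: (@le_trans _ _ (((p * r)%:R * H + 1) * D)); first by rewrite ler_pM2r// lerDl.
  have : D <= (a - c0) / (2 * ((p * r)%:R * H + 1)) by rewrite ge_min lexx orbT.
  rewrite invfM mulrA ler_pdivlMr// mulrC; lra.
have := yc eta; have : 0 <= e * mxdot eta eta by rewrite mulr_ge0// ltW.
by move: ca; lra.
Qed.

Lemma lower_step y (c0 a de : R) : 0 < de -> c0 < a ->
  (forall eta, mxdot eta y - kp eta g <= c0) ->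
  (forall eta, exists m, quad_bound eta m) ->
  exists2 rho0 : R, 0 < rho0 & forall rho, 0 < rho -> rho <= rho0 ->
   exists N0 : R, forall N X Y, N0 <= N -> mgf_model N X Y ->
    ((expR (- (N * a)))%:E * P (inball X g rho) <=
      P (inball X g rho `&` inball Y y de))%E.
Proof.
move=> de0 ca yc qb.
have de2 : 0 < de / 2 by rewrite divr_gt0.
have [eta [m [qm ym etaa]]] := approx_tilt de2 ca yc qb.
have [rho0 rho00 H] := lower_step_tilt qm de2 etaa.
exists rho0 => // rho rhop rle; have [N0 HN] := H rho rhop rle.
exists N0 => N X Y NN mod; apply: (le_trans (HN N X Y NN mod)).
have [_ [mX mY] _ _ _] := mod.
have mA : measurable (inball X g rho) by exact: measurable_inball.
have mB : measurable (inball Y y de) by exact: measurable_inball.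
have mB' : measurable (inball Y m (de / 2)) by exact: measurable_inball.
apply: le_measure; rewrite ?inE; [exact: measurableI|exact: measurableI|].
apply: setIS => w [_ Bw]; split => // i j.
rewrite /ball/= (le_lt_trans (ler_distD (m i j) _ _))//.
rewrite [ltRHS]splitr ler_ltD//; exact: Bw.
Qed.

End OneStep.

(** * Integrating out one independent Gaussian variable *)

Section Laws.
Context {R : realType} {I : choiceType}.

(* Measurability on [I -> R], phrased as in [vmeas]. *)
Definition fmeas (H : (I -> R) -> \bar R) : Prop :=
  forall d (T : measurableType d) (v : I -> T -> R),
    (forall i, measurable_fun setT (v i)) ->
    measurable_fun setT (fun t => H (fun i => v i t)).

Definition cylinders : set (set (I -> R)) :=
  [set A | exists (s : seq I) (B : I -> set R), [/\ forall i, measurable (B i),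
     forall i, i \notin s -> B i = setT & A = [set v | forall i, B i (v i)]]].

Lemma setI_closed_cylinders : setI_closed cylinders.
Proof.
move=> _ _ [s [B [mB sB ->]]] [t [C [mC tC ->]]].
exists (s ++ t), (fun i => B i `&` C i); split.
- by move=> i; exact: measurableI.
- by move=> i; rewrite mem_cat negb_or => /andP[/sB -> /tC ->]; rewrite setIT.
- by apply/seteqP; split => v /=; [move=> [Bv Cv] i; split|move=> BC; split => i; case: (BC i)].
Qed.

Let TI : measurableType _ := g_sigma_algebraType cylinders.

Lemma measurable_to_cylinders d (T : measurableType d) (X : I -> T -> R) :
  (forall i, measurable_fun setT (X i)) -> measurable_fun setT (fun t => (fun i => X i t) : TI).
Proof.
move=> mX; apply: (@measurability _ _ T TI setT _ cylinders erefl) => _ [_ [s [B [mB sB ->]]] <-].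
rewrite setTI; have -> : (fun t i => X i t) @^-1` [set v | forall i, B i (v i)] =
    \bigcap_(i in [set` s]) (X i @^-1` B i).
  apply/seteqP; split => t /= h i; first by move=> _; exact: h.
  by case: (boolP (i \in s)) => [/h//|/sB ->].
rewrite bigcap_seq; apply: bigsetI_measurable => i _.
by rewrite -[X in measurable X]setTI; exact: mX.
Qed.

Lemma measurable_eval i : measurable_fun setT (fun v : TI => v i).
Proof.
move=> _ B mB; rewrite setTI; apply: sub_sigma_algebra.
exists [:: i], (fun j => if j == i then B else setT); split.
- by move=> j; case: ifP.
- by move=> j; rewrite inE => /negbTE ->.
- apply/seteqP; split => v /=; last by move=> /(_ i); rewrite eqxx.
  by move=> Bv j; case: eqP => // ->.
Qed.

(* Requiring [i0] to occur in every cylinder loses nothing, and lets [gauss_elim] single out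
   one coordinate. *)
Lemma law_eq (i0 : I) d1 (T1 : measurableType d1) (P1 : probability T1 R) (X1 : I -> T1 -> R)
    d2 (T2 : measurableType d2) (P2 : probability T2 R) (X2 : I -> T2 -> R) H :
  (forall i, measurable_fun setT (X1 i)) -> (forall i, measurable_fun setT (X2 i)) ->
  (forall s (B : I -> set R), uniq (i0 :: s) -> (forall i, measurable (B i)) ->
     P1 (\bigcap_(i in [set` i0 :: s]) (X1 i @^-1` B i)) =
     P2 (\bigcap_(i in [set` i0 :: s]) (X2 i @^-1` B i))) ->
  fmeas H -> (forall v, 0 <= H v)%E ->
  (\int[P1]_w H (fun i => X1 i w) = \int[P2]_w H (fun i => X2 i w))%E.
Proof.
move=> mX1 mX2 XX mH H0.
have m1 := measurable_to_cylinders mX1; have m2 := measurable_to_cylinders mX2.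
have mHT : measurable_fun setT (H : TI -> \bar R).
  by apply: (mH _ TI (fun i v => v i)) => i; exact: measurable_eval.
have E A : measurable A -> pushforward P1 (fun t => (fun i => X1 i t) : TI) A =
    pushforward P2 (fun t => (fun i => X2 i t) : TI) A.
  apply: (@measure_unique _ R TI cylinders (fun=> setT) erefl setI_closed_cylinders _ _
    (pushforward P1 (fun t => (fun i => X1 i t) : TI))
    (pushforward P2 (fun t => (fun i => X2 i t) : TI))).
  - by move=> _; exists [::], (fun=> setT); split => //; apply/seteqP; split.
  - by rewrite bigcup_const//; exists 0%N.
  - move=> _ [s [B [mB sB ->]]]; rewrite /pushforward.
    pose s' := rem i0 (undup s).
    have us : uniq (i0 :: s') by rewrite /= mem_rem_uniq ?undup_uniq// !inE eqxx/= rem_uniq ?undup_uniq.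
    have G d (T : measurableType d) (X : I -> T -> R) :
        (fun t i => X i t) @^-1` [set v | forall i, B i (v i)] =
        \bigcap_(i in [set` i0 :: s']) (X i @^-1` B i).
      apply/seteqP; split => t /= h i; first by move=> _; exact: h.
      have [is'|/sB ->//] := boolP (i \in s); apply: (h i).
      rewrite /= inE; have [//|ii0] := eqVneq i i0.
      by rewrite mem_rem_uniq ?undup_uniq// !inE ii0 mem_undup.
    by have := XX s' B us mB; rewrite -(G _ _ X1) -(G _ _ X2); exact.
  - move=> _; rewrite /= /pushforward [X in (X < _)%E](_ : _ = 1%E) ?ltry//.
    by rewrite preimage_setT probability_setT.
transitivity (\int[pushforward P1 (fun t => (fun i => X1 i t) : TI)]_v H v)%E.
  by rewrite ge0_integral_pushforward//.
transitivity (\int[pushforward P2 (fun t => (fun i => X2 i t) : TI)]_v H v)%E.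
  by apply: eq_measure_integral => A mA _; exact: E.
by rewrite ge0_integral_pushforward//.
Qed.

End Laws.

Section Gauss.
Context {R : realType}.
Implicit Types (v s : R) (B : set R).

Lemma normal_pdf_scale s (x : R) : 0 < s ->
  s * normal_pdf 0 s (s * x) = normal_pdf 0 1 x.
Proof.
move=> s0; rewrite !normal_pdfE ?oner_eq0 ?gt_eqF// /normal_fun /normal_peak !subr0.
rewrite expr1n mul1r -mulrnAr (sqrtrM _ (sqr_ge0 s)) sqrtr_sqr gtr0_norm// invfM.
rewrite mulrA mulrA mulfV ?gt_eqF// mul1r; congr (_ * expR _).
by rewrite exprMn; field; exact: lt0r_neq0.
Qed.

Lemma gauss_lawE v B : 0 <= v -> measurable B ->
  gauss_law v B = gint (fun t => (\1_B (Num.sqrt v * t))%:E).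
Proof.
move=> v0 mB; rewrite /gauss_law; case: eqP => [->|/eqP v1].
  rewrite sqrtr0; under eq_gint do rewrite mul0r.
  by rewrite gint_cst ?lee_fin.
have s0 : 0 < Num.sqrt v by rewrite sqrtr_gt0 lt_neqAle eq_sym v1.
have mi : measurable_fun setT (\1_B : R -> R) by exact: measurable_indic.
have m1 : measurable_fun setT (fun x => (\1_B (Num.sqrt v * x))%:E : \bar R).
  by apply/measurable_EFinP; apply: (measurableT_comp mi); exact: measurable_funM.
have m2 : measurable_fun setT (fun x => (\1_B x * normal_pdf 0 (Num.sqrt v) x)%:E : \bar R).
  apply/measurable_EFinP; apply: measurable_funM => //; exact: measurable_normal_pdf.
have p0 x : (0 <= (\1_B x * normal_pdf 0 (Num.sqrt v) x)%:E :> \bar R)%E.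
  by rewrite lee_fin mulr_ge0// normal_pdf_ge0.
rewrite gintE//.
transitivity (leb (fun x => (\1_B x * normal_pdf 0 (Num.sqrt v) x)%:E)).
  rewrite /normal_prob integral_mkcond; apply: eq_integral => x _.
  by rewrite patchE indicE; case: ifPn; rewrite ?mul1r ?mul0r.
rewrite -(@leb_affine _ _ (Num.sqrt v) 0)//; last by rewrite gt_eqF.
rewrite -lebZl//.
- apply: eq_leb => x; rewrite addr0 gtr0_norm//.
  by rewrite -!EFinM mulrCA normal_pdf_scale.
- apply: (measurableT_comp m2); apply: measurable_funD => //; exact: measurable_funM.
Qed.

End Gauss.

Section Independence.
Context {R : realType} {I : choiceType} d (Omega : measurableType d) (P : probability Omega R).
Variables (D : set I) (X : I -> Omega -> R) (var : I -> R).
Hypothesis indX : mutually_independent P D X.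
Hypothesis gaussX : forall i, D i -> 0 <= var i /\ centered_gaussian P (X i) (var i).

(* Unlike [X], this family is independent over the whole of [I]. *)
Definition cutoff (i : I) (w : Omega) : R := if `[< D i >] then X i w else 0.
Notation X' := cutoff.

Lemma cutoffE i : D i -> X' i = X i.
Proof. by move=> Di; apply/funext => w; rewrite /X' asboolT. Qed.

Lemma measurable_cutoff i : measurable_fun setT (X' i).
Proof.
have [Di|nDi] := pselect (D i); first by rewrite cutoffE//; exact: indX.1.
by rewrite (_ : X' i = cst 0)//; apply/funext => w; rewrite /X' asboolF.
Qed.

Lemma measurable_cutoff_preimage i B : measurable B -> measurable (X' i @^-1` B).
Proof. by move=> mB; rewrite -[X in measurable X]setTI; exact: measurable_cutoff. Qed.

Lemma cutoff_independent (s : seq I) (B : I -> set R) : uniq s -> (forall i, measurable (B i)) ->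
  fine (P (\bigcap_(i in [set` s]) (X' i @^-1` B i))) = \prod_(i <- s) fine (P (X' i @^-1` B i)).
Proof.
move=> us mB.
have X'0 j : ~ D j -> X' j = cst 0 by move=> nD; apply/funext => w; rewrite /X' asboolF.
have [[j [js nDj nB]]|nex] := pselect (exists j, [/\ j \in s, ~ D j & ~ B j 0]).
  have e0 : X' j @^-1` B j = set0 by rewrite X'0//; apply/seteqP; split.
  rewrite (_ : \bigcap_(i in _) _ = set0) ?measure0/=; last first.
    by apply/seteqP; split => // w /= /(_ j js); rewrite -/((X' j @^-1` B j) w) e0.
  by apply/esym/eqP; rewrite prodf_seq_eq0; apply/hasP; exists j => //=; rewrite e0 measure0.
have B0 j : j \in s -> ~ D j -> B j 0 by move=> js nD; apply: contrapT => nB; apply: nex; exists j.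
pose s' := [seq i <- s | `[< D i >]].
have -> : \bigcap_(i in [set` s]) (X' i @^-1` B i) = \bigcap_(i in [set` s']) (X i @^-1` B i).
  apply/seteqP; split => w /= h i.
    by rewrite /= mem_filter => /andP[/asboolP Di /h]; rewrite cutoffE.
  move=> /= is'; have [Di|nDi] := pselect (D i); last by rewrite X'0//; exact: B0.
  by rewrite cutoffE//; apply: h; rewrite /= mem_filter is' andbT; exact/asboolP.
rewrite indX.2//; last 2 first.
- exact: filter_uniq.
- by move=> i; rewrite mem_filter => /andP[/asboolP].
rewrite big_filter [RHS](bigID (fun i => `[< D i >]))/= [X in _ * X]big1_seq ?mulr1.
  by apply: eq_bigr => i /asboolP Di; rewrite cutoffE.
move=> i /andP[/asboolP nDi is']; rewrite X'0// (_ : _ @^-1` _ = setT) ?probability_setT//.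
by apply/seteqP; split => // w _; exact: B0.
Qed.

Lemma gauss_elim (i : I) H : D i -> fmeas H -> (forall v, 0 <= H v)%E ->
  (\int[P]_w H (fun j => X' j w) =
   \int[P]_w gint (fun t => H (fun j => if j == i then (Num.sqrt (var i) * t)%R else X' j w)))%E.
Proof.
move=> Di mH H0; have [v0 [mXi lawX]] := gaussX Di.
pose X2 j (p : Omega * measurableTypeR R) : R :=
  if j == i then Num.sqrt (var i) * p.2 else X' j p.1.
have mX2 j : measurable_fun setT (X2 j).
  rewrite /X2; case: (j == i).
    apply: measurable_funM => //; exact: (@measurable_snd _ _ Omega (measurableTypeR R)).
  exact: (measurableT_comp (measurable_cutoff j) (@measurable_fst _ _ Omega (measurableTypeR R))).
have mH2 := mH _ _ X2 mX2.
transitivity (\int[P \x normal_prob (0 : R) 1]_p H (fun j => X2 j p))%E; last first.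
  by rewrite fubini_tonelli1.
apply: (@law_eq R I i _ _ _ X' _ _ (P \x normal_prob (0 : R) 1)%E X2) => //.
  exact: measurable_cutoff.
move=> s B /= /andP[nis us] mB.
pose A : set (measurableTypeR R) := [set t | B i (Num.sqrt (var i) * t)].
have mA : measurable A.
  have mf : measurable_fun setT (fun t : measurableTypeR R => Num.sqrt (var i) * t).
    exact: measurable_funM.
  by rewrite -[X in measurable X]setTI; exact: mf.
pose C := \bigcap_(j in [set` s]) (X' j @^-1` B j).
have mC : measurable C.
  by rewrite /C bigcap_seq; apply: bigsetI_measurable => j _; exact: measurable_cutoff_preimage.
have -> : \bigcap_(j in [set` i :: s]) (X2 j @^-1` B j) = C `*` A.
  apply/seteqP; split => -[w t] /=.
    move=> h; split => /=.
      move=> j js; have := h j; rewrite /= inE js orbT /X2/= => /(_ isT).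
      by case: eqP => // ji; rewrite -ji js in nis.
    by have := h i; rewrite /= mem_head /X2 eqxx; apply.
  move=> [Cw At] j /=; rewrite inE /X2/=; case: eqP => [->//|_ /= js]; exact: Cw.
rewrite product_measure1E//.
have EA : normal_prob (0 : R) 1 A = P (X' i @^-1` B i).
  rewrite cutoffE// lawX// gauss_lawE// /gint.
  by have := @integral_indic _ _ _ (normal_prob (0 : R) 1) setT measurableT A mA; rewrite setIT => <-.
transitivity (P C * P (X' i @^-1` B i))%E; last by congr *%E; exact/esym/EA.
rewrite -(fineK (fin_num_measure P _ mC)).
rewrite -(fineK (fin_num_measure P _ (measurable_cutoff_preimage i (mB i)))) -EFinM.
rewrite -[LHS]fineK; last first.
  apply: fin_num_measure; rewrite bigcap_seq; apply: bigsetI_measurable => j _.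
  exact: measurable_cutoff_preimage.
congr EFin; rewrite cutoff_independent/= ?nis// /C cutoff_independent// big_cons.
by rewrite mulrC.
Qed.

End Independence.

Section LinearElimination.
Context {R : realType} {I : choiceType} d (Omega : measurableType d) (P : probability Omega R).
Variables (D : set I) (X : I -> Omega -> R) (var : I -> R).
Hypothesis indX : mutually_independent P D X.
Hypothesis gaussX : forall i, D i -> 0 <= var i /\ centered_gaussian P (X i) (var i).
Notation X' := (cutoff D X).

Definition off_support {T} (s : seq I) (F : (I -> R) -> T) : Prop :=
  forall v v', (forall i, i \notin s -> v i = v' i) -> F v = F v'.

Definition cmeas k (u : (I -> R) -> 'cV[R]_k) : Prop :=
  forall d (T : measurableType d) (v : I -> T -> R),
    (forall i, measurable_fun setT (v i)) ->
    forall a, measurable_fun setT (fun t => u (fun i => v i t) a 0).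

Lemma lin_elim k (s : seq I) (F : (I -> R) -> \bar R) (c : (I -> R) -> 'cV[R]_k)
    (u : I -> (I -> R) -> 'cV[R]_k) (psi : 'cV[R]_k -> \bar R) :
  uniq s -> (forall i, i \in s -> D i) ->
  fmeas F -> (forall v, 0 <= F v)%E -> off_support s F ->
  cmeas c -> off_support s c ->
  (forall i, cmeas (u i)) -> (forall i, i \in s -> off_support s (u i)) ->
  vmeas psi -> (forall y, 0 <= psi y)%E ->
  let V w := fun i => X' i w in
  (\int[P]_w (F (V w) * psi (c (V w) + (\sum_(i <- s) V w i *: u i (V w)))%R) =
   \int[P]_w (F (V w) * Eg [seq Num.sqrt (var i) *: u i (V w) | i <- s] psi (c (V w))))%E.
Proof.
move=> us sD mF F0 oF mc oc mu ou mpsi p0.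
elim: s c us sD oF mc oc ou => [|i s IH] c us sD oF mc oc ou V.
  by apply: eq_integral => w _; rewrite big_nil addr0.
have sub T (f : (I -> R) -> T) : off_support (i :: s) f -> off_support s f.
  by move=> of' v v' h; apply: of' => j; rewrite inE negb_or => /andP[_]; exact: h.
have is_ : i \notin s by case/andP: us.
pose c' v := c v + v i *: u i v.
have mc' : cmeas c'.
  move=> d' T v mv a; under eq_fun do rewrite !mxE.
  apply: measurable_funD; first exact: mc.
  by apply: measurable_funM => //; exact: mu.
transitivity (\int[P]_w (F (V w) * psi (c' (V w) + (\sum_(j <- s) V w j *: u j (V w)))%R))%E.
  by apply: eq_integral => w _; rewrite big_cons addrA.
rewrite IH//; first last.
- by move=> j js; apply: sub; apply: ou; rewrite inE js orbT.
- move=> v v' h; rewrite /c' (sub _ _ oc v v')// h// (sub _ _ (ou i _) v v')//.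
  by rewrite mem_head.
- exact: sub.
- by move=> j js; apply: sD; rewrite inE js orbT.
- by case/andP: us.
pose H v := (F v * Eg [seq Num.sqrt (var j) *: u j v | j <- s] psi (c' v))%E.
have mEg d' (T : measurableType d') (v : I -> T -> R) (e : T -> 'cV[R]_k) :
    (forall i, measurable_fun setT (v i)) -> (forall a, measurable_fun setT (fun t => e t a 0)) ->
    measurable_fun setT (fun t =>
      Eg [seq Num.sqrt (var j) *: u j (fun i => v i t) | j <- s] psi (e t)).
  move=> mv me.
  apply: (measurable_Eg s (a := fun j t => Num.sqrt (var j) *: u j (fun i => v i t)) mpsi p0) => //.
  move=> j a; under eq_fun do rewrite !mxE.
  by apply: measurable_funM => //; exact: mu.
have mH : fmeas H.
  move=> d' T v mv; apply: emeasurable_funM; first exact: mF.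
  by apply: mEg => // a; exact: mc'.
have H0 v : (0 <= H v)%E by rewrite mule_ge0//; exact: Eg_ge0.
rewrite [LHS](gauss_elim indX gaussX (i := i) (H := H))//; last by apply: sD; rewrite mem_head.
apply: eq_integral => w _ /=; rewrite -gintZl//; first last.
- by move=> t; exact: Eg_ge0.
- apply: (mEg _ (measurableTypeR R) (fun i _ => V w i) (fun t => c (V w) + t *: (Num.sqrt (var i) *: u i (V w)))) => //.
  by move=> a; under eq_fun do rewrite !mxE; apply: measurable_funD => //; exact: measurable_funM.
apply: eq_gint => t; rewrite /H /c'.
set v' := fun j => if j == i then _ else _.
have hv j : j \notin i :: s -> v' j = V w j by rewrite inE negb_or /v' => /andP[/negbTE ->].
rewrite (oF v' (V w))// (oc v' (V w))// (ou i _ v' (V w)) ?mem_head//.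
congr (_ * _)%E; rewrite {1}/v' eqxx scalerA (mulrC t); congr (Eg _ _ _).
apply/eq_in_map => j js; congr (_ *: _); apply: ou; last exact: hv.
by rewrite inE js orbT.
Qed.

End LinearElimination.

(** * The network *)

Section NetworkFunctions.
Context {R : realType}.
Variables (n0 k : nat) (sigma : R -> R) (Cb CW : R) (wd : nat -> nat) (x : 'M[R]_(k, n0)).
Hypothesis csigma : continuous sigma.
Hypothesis wd0 : wd 0%N = n0.

Lemma netZ_ext (b b' : nat -> nat -> R) (W W' : nat -> nat -> nat -> R) (y : 'I_n0 -> R) l i :
  (forall l' i', (1 <= l' <= l)%N -> ((l' < l)%N -> (i' < wd l')%N) -> (l' = l -> i' = i) ->
     b l' i' = b' l' i') ->
  (forall l' i' j', (1 <= l' <= l)%N -> ((l' < l)%N -> (i' < wd l')%N) -> (l' = l -> i' = i) ->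
     (j' < wd l'.-1)%N -> W l' i' j' = W' l' i' j') ->
  netZ sigma wd b W y l i = netZ sigma wd b' W' y l i.
Proof.
elim: l i => [//|[|l] IH] i hb hW.
  rewrite /= hb//; congr (_ + _); apply: eq_bigr => r _; rewrite hW//=.
  by rewrite wd0.
rewrite -[LHS]/(b l.+2 i + \sum_(j < wd l.+1) W l.+2 i j * sigma (netZ sigma wd b W y l.+1 j)).
rewrite -[RHS]/(b' l.+2 i + \sum_(j < wd l.+1) W' l.+2 i j * sigma (netZ sigma wd b' W' y l.+1 j)).
rewrite hb ?ltnn ?ltnSn ?leqnn//; congr (_ + _); apply: eq_bigr => j _.
rewrite hW ?ltnn ?leqnn//=; congr (_ * sigma _); apply: IH.
- move=> l' i' /andP[l1 l2] h1 h2; apply: hb.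
  + by rewrite l1 leqW.
  + move=> _; case: (ltngtP l' l.+1) l2 => // [l2 _|e _]; first exact: h1.
    by rewrite e (h2 e).
  + by move=> e; move: l2; rewrite e ltnn.
- move=> l' i' j' /andP[l1 l2] h1 h2 j'l; apply: hW => //.
  + by rewrite l1 leqW.
  + move=> _; case: (ltngtP l' l.+1) l2 => // [l2 _|e _]; first exact: h1.
    by rewrite e (h2 e).
  + by move=> e; move: l2; rewrite e ltnn.
Qed.

Definition param : choiceType := ((nat * nat) + (nat * nat * nat))%type.
Implicit Types (v : param -> R) (l : nat).

Definition pvar (idx : param) : R :=
  match idx with inl _ => Cb | inr (l, _, _) => CW / (wd l.-1)%:R end.

Definition zvec v l i : 'cV[R]_k :=
  \col_a netZ sigma wd (fun l i => v (inl (l, i))) (fun l i j => v (inr (l, i, j)))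
    (fun r => x a r) l i.

(* [hvec v 0 j] is the [j]-th coordinate of the inputs, which makes the first layer an
   instance of the general one. *)
Definition hvec v l j : 'cV[R]_k :=
  if l == 0%N then \col_a (if insub j is Some r then x a r else 0) else map_mx sigma (zvec v l j).

Definition pvec (idx : param) v : 'cV[R]_k :=
  match idx with inl _ => const_mx 1 | inr (l, i, j) => hvec v l.-1 j end.

Definition incoming l i : seq param :=
  inl (l.+1, i) :: [seq inr (l.+1, i, j) | j <- iota 0 (wd l)].

(* The covariance matrix, given the first [l] layers, of each of the independent Gaussian
   vectors [zvec v l.+1 i]. *)
Definition Gmat v l : 'M[R]_k :=
  Cb *: const_mx 1 + (CW / (wd l)%:R) *: \sum_(j < wd l) hvec v l j *m (hvec v l j)^T.

Lemma zvecE v l i : zvec v l.+1 i = \sum_(idx <- incoming l i) v idx *: pvec idx v.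
Proof.
rewrite /incoming big_cons big_map; apply/colP => a.
rewrite !mxE mulr1.
have -> : iota 0 (wd l) = index_iota 0 (wd l) by rewrite /index_iota subn0.
rewrite big_mkord summxE; case: l => [|l] /=; last first.
  by congr (_ + _); apply: eq_bigr => j _; rewrite !mxE.
congr (_ + _); rewrite wd0; apply: eq_bigr => j _.
by rewrite !mxE valK.
Qed.

Lemma incoming_uniq l i : uniq (incoming l i).
Proof.
rewrite /= map_inj_uniq ?iota_uniq ?andbT; last by move=> j j' [].
by apply/mapP => -[].
Qed.

Lemma incomingP l i idx : idx \in incoming l i ->
  idx = inl (l.+1, i) \/ exists2 j, (j < wd l)%N & idx = inr (l.+1, i, j).
Proof.
rewrite inE => /orP[/eqP ->|/mapP[j]]; first by left.
by rewrite mem_iota => jl ->; right; exists j.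
Qed.

Lemma measurable_zvec d (T : measurableType d) (v : param -> T -> R) l i a :
  (forall idx, measurable_fun setT (v idx)) ->
  measurable_fun setT (fun t => zvec (fun idx => v idx t) l i a 0).
Proof.
move=> mv; under eq_fun do rewrite mxE.
elim: l i => [|[|l] IH] i /=; first exact: measurable_cst.
- apply: measurable_funD => //; apply: measurable_sum => r; exact: measurable_funM.
- apply: measurable_funD => //; apply: measurable_sum => j; apply: measurable_funM => //.
  apply: (measurableT_comp (f := sigma)); last exact: IH.
  exact: continuous_measurable_fun.
Qed.

Lemma cmeas_hvec l j : cmeas (fun v => hvec v l j).
Proof.
move=> d T v mv a; rewrite /hvec; case: eqP => _.
  by under eq_fun do rewrite mxE; exact: measurable_cst.
under eq_fun do rewrite mxE; apply: (measurableT_comp (f := sigma)); last exact: measurable_zvec.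
exact: continuous_measurable_fun.
Qed.

Lemma cmeas_pvec idx : cmeas (pvec idx).
Proof.
case: idx => [[l i]|[[l i] j]] /=; last exact: cmeas_hvec.
by move=> d T v mv a; under eq_fun do rewrite mxE; exact: measurable_cst.
Qed.

Lemma measurable_Gmat d (T : measurableType d) (v : param -> T -> R) l :
  (forall idx, measurable_fun setT (v idx)) ->
  mx_measurable (fun t => Gmat (fun idx => v idx t) l).
Proof.
move=> mv a b; under eq_fun do rewrite !mxE summxE.
apply: measurable_funD => //; apply: measurable_funM => //; apply: measurable_sum => j.
under eq_fun do rewrite !mxE big_ord1 !mxE.
by apply: measurable_funM; exact: cmeas_hvec.
Qed.

Lemma zvec_off v v' l l' m i : (l' <= l)%N \/ l' = l.+1 /\ m != i ->
  (forall idx, idx \notin incoming l i -> v idx = v' idx) -> zvec v l' m = zvec v' l' m.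
Proof.
move=> lm vv; apply/colP => a; rewrite !mxE.
apply: netZ_ext => [l1 i1 /andP[_ l1l'] _ e1|l1 i1 j1 /andP[_ l1l'] _ e1 _]; apply: vv;
    apply/negP => /incomingP[]//.
- move=> [le ie]; case: lm => [l'l|[l'l /eqP]].
    by move: (leq_trans l1l' l'l); rewrite le ltnn.
  by rewrite -ie => mi; apply: mi; rewrite e1// le l'l.
- by case.
- move=> [j jl [le ie _]]; case: lm => [l'l|[l'l /eqP]].
    by move: (leq_trans l1l' l'l); rewrite le ltnn.
  by rewrite -ie => mi; apply: mi; rewrite e1// le l'l.
Qed.

Lemma hvec_off l i j : off_support (incoming l i) (fun v => hvec v l j).
Proof.
move=> v v' vv; rewrite /hvec; case: eqP => // _; congr map_mx.
by apply: (zvec_off (l := l) (i := i)) => //; left.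
Qed.

Lemma pvec_off l i idx : idx \in incoming l i -> off_support (incoming l i) (pvec idx).
Proof.
by move=> /incomingP[->|[j _ ->]] v v' vv //=; exact: (@hvec_off l i j v v' vv).
Qed.

Lemma Gmat_off l i : off_support (incoming l i) (fun v => Gmat v l).
Proof.
move=> v v' vv; rewrite /Gmat; congr (_ + _ *: _); apply: eq_bigr => j _.
by rewrite (@hvec_off l i j v v' vv).
Qed.

Hypothesis Cb0 : 0 <= Cb.
Hypothesis CW0 : 0 < CW.

Lemma pvar_ge0 idx : 0 <= pvar idx.
Proof. by case: idx => [[l i]|[[l i] j]] //=; rewrite divr_ge0// ltW. Qed.

Lemma cov_incoming v l i :
  cov [seq Num.sqrt (pvar idx) *: pvec idx v | idx <- incoming l i] = Gmat v l.
Proof.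
have E idx : (Num.sqrt (pvar idx) *: pvec idx v) *m (Num.sqrt (pvar idx) *: pvec idx v)^T =
    pvar idx *: (pvec idx v *m (pvec idx v)^T).
  by rewrite trmxZ -scalemxAl -scalemxAr scalerA -expr2 sqr_sqrtr// pvar_ge0.
rewrite /cov big_map /incoming big_cons big_map E; congr (_ + _).
  by congr (_ *: _); apply/matrixP => a b; rewrite !mxE big_ord1 !mxE mulr1.
have -> : iota 0 (wd l) = index_iota 0 (wd l) by rewrite /index_iota subn0.
by rewrite big_mkord scaler_sumr; apply: eq_bigr => j _; rewrite E.
Qed.

Lemma psd_const : psd (const_mx 1 : 'M[R]_k).
Proof.
have -> : const_mx 1 = const_mx 1 *m (const_mx 1 : 'cV[R]_k)^T :> 'M[R]_k.
  by apply/matrixP => a b; rewrite !mxE big_ord1 !mxE mulr1.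
exact: psd_outer.
Qed.

Lemma Gmat_SCb v l : SCb Cb (Gmat v l).
Proof.
have h : psd ((CW / (wd l)%:R) *: \sum_(j < wd l) hvec v l j *m (hvec v l j)^T).
  apply: psdZ; first by rewrite divr_ge0// ltW.
  by apply: psd_sum => j; exact: psd_outer.
split; last by rewrite /Gmat addrAC subrr add0r.
by apply: psdD => //; exact: psdZ psd_const.
Qed.

Lemma Gmat0 v : Gmat v 0 = g0mat Cb CW x.
Proof.
apply/matrixP => a b; rewrite !mxE mulr1 summxE wd0; congr (_ + _ * _).
by apply: eq_bigr => j _; rewrite !mxE big_ord1 !mxE valK.
Qed.

Lemma Gmat_box (M : R) v l a b : (forall t, `|sigma t| <= M) -> `|Gmat v l.+1 a b| <= Cb + CW * M ^+ 2.
Proof.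
move=> sM; rewrite !mxE mulr1 (le_trans (ler_normD _ _))// ger0_norm// lerD2l.
have M0 : 0 <= M by exact: le_trans (sM 0).
have [->|w0] := posnP (wd l.+1).
  by rewrite invr0 mulr0 mul0r normr0 mulr_ge0 ?sqr_ge0// ltW.
have q0 : 0 <= CW / (wd l.+1)%:R by rewrite divr_ge0// ltW.
rewrite normrM (ger0_norm q0) -mulrA ler_pM2l// ler_pdivrMl ?ltr0n//.
rewrite summxE (le_trans (ler_norm_sum _ _ _))//.
rewrite (@le_trans _ _ (\sum_(j < wd l.+1) M ^+ 2))//; last by rewrite sumr_const card_ord mulr_natl.
apply: ler_sum => j _; rewrite !mxE big_ord1 !mxE normrM expr2.
by apply: ler_pM.
Qed.

Lemma Gmat_step v l :
  CW^-1 *: (Gmat v l.+1 - Cb *: const_mx 1) =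
  (wd l.+1)%:R^-1 *: \sum_(j < wd l.+1) hvec v l.+1 j *m (hvec v l.+1 j)^T.
Proof.
by rewrite /Gmat addrAC subrr add0r scalerA mulrA mulVf ?mul1r// gt_eqF.
Qed.

End NetworkFunctions.

Section NetworkMoments.
Context {R : realType} d (Omega : measurableType d) (P : probability Omega R).
Variables (L n0 k : nat) (sigma : R -> R) (Cb CW : R) (wd : nat -> nat) (x : 'M[R]_(k, n0)).
Hypothesis csigma : continuous sigma.
Hypothesis wd0 : wd 0%N = n0.
Hypothesis Cb0 : 0 <= Cb.
Hypothesis CW0 : 0 < CW.
Variable X : param -> Omega -> R.

Definition active : set param := [set idx | match idx with
  | inl (l, i) => (1 <= l <= L.+1)%N /\ (i < wd l)%N
  | inr (l, i, j) => (1 <= l <= L.+1)%N /\ (i < wd l)%N /\ (j < wd l.-1)%N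
  end].

Hypothesis indX : mutually_independent P active X.
Hypothesis gaussX : forall idx, active idx -> centered_gaussian P (X idx) (pvar Cb CW wd idx).

Notation V w := (fun idx => cutoff active X idx w).
Notation zv := (zvec sigma wd x).
Notation G := (Gmat sigma Cb CW wd x).

Lemma incoming_active l i idx : (l <= L)%N -> (i < wd l.+1)%N ->
  idx \in incoming wd l i -> active idx.
Proof. by move=> lL iw /incomingP[->|[j jl ->]]. Qed.

Let gaussX' i : active i -> 0 <= pvar Cb CW wd i /\ centered_gaussian P (X i) (pvar Cb CW wd i).
Proof. by move=> ai; split; [exact: pvar_ge0|exact: gaussX]. Qed.

Lemma neuron_elim l (E : nat -> 'cV[R]_k -> R) (K : nat -> 'M[R]_k -> R) m
    (F : (param -> R) -> \bar R) :
  (l <= L)%N -> (m <= wd l.+1)%N ->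
  (forall i, vmeas (fun z => (expR (E i z))%:E)) ->
  (forall i q s, SCb Cb q -> cov s = q ->
     Eg s (fun z => (expR (E i z))%:E) 0 = (expR (K i q))%:E) ->
  fmeas F -> (forall v, 0 <= F v)%E -> (forall i, off_support (incoming wd l i) F) ->
  (\int[P]_w (F (V w) * (expR (\sum_(i < m) E i (zv (V w) l.+1 i)))%:E) =
   \int[P]_w (F (V w) * (expR (\sum_(i < m) K i (G (V w) l)))%:E))%E.
Proof.
move=> lL + mE EK; elim: m F => [|m IH] F mwd mF F0 oF.
  by apply: eq_integral => w _; rewrite !big_ord0.
have expE0 i z : (0 <= (expR (E i z))%:E :> \bar R)%E by rewrite lee_fin expR_ge0.
have mz i d' (T : measurableType d') (v : param -> T -> R) :
    (forall i, measurable_fun setT (v i)) ->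
    measurable_fun setT (fun t => E i (zv (fun j => v j t) l.+1 i)).
  move=> mv; have -> : (fun t => E i (zv (fun j => v j t) l.+1 i)) =
      fun t => ln (fine (expR (E i (zv (fun j => v j t) l.+1 i)))%:E).
    by apply/funext => t; rewrite /= expRK.
  apply: measurableT_comp => //; apply: measurableT_comp => //.
  by apply: mE => a; exact: measurable_zvec.
have EgK i v : Eg [seq Num.sqrt (pvar Cb CW wd j) *: pvec sigma wd x j v | j <- incoming wd l i]
      (fun z => (expR (E i z))%:E) 0 = (expR (K i (G v l)))%:E.
  by apply: EK; [exact: Gmat_SCb|exact: cov_incoming].
have mK i : fmeas (fun v => (expR (K i (G v l)))%:E).
  move=> d' T v mv; under eq_fun do rewrite -EgK.
  apply: (measurable_Eg _ (a := fun j t => Num.sqrt (pvar Cb CW wd j) *: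
    pvec sigma wd x j (fun idx => v idx t)) (x := fun=> 0) (mE i) (expE0 i)) => //.
  move=> j a; under eq_fun do rewrite !mxE.
  by apply: measurable_funM => //; exact: cmeas_pvec.
pose F' v := (F v * (expR (\sum_(i < m) E i (zv v l.+1 i)))%:E)%E.
have mF' : fmeas F'.
  move=> d' T v mv; apply: emeasurable_funM; first exact: mF.
  apply/measurable_EFinP; apply: measurable_expR_comp; apply: measurable_sum => i.
  exact: mz.
have F'0 v : (0 <= F' v)%E by rewrite mule_ge0// lee_fin expR_ge0.
have oF' : off_support (incoming wd l m) F'.
  move=> v v' vv; rewrite /F' (oF m v v' vv); congr (_ * (expR _)%:E)%E.
  apply: eq_bigr => i _; congr (E i); apply: (zvec_off sigma x wd0 (l := l) (i := m)) => //.
  by right; split => //; rewrite ltn_eqF.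
transitivity (\int[P]_w (F' (V w) * (expR (E m (zv (V w) l.+1 m)))%:E))%E.
  apply: eq_integral => w _; rewrite /F' big_ord_recr/= expRD EFinM muleA.
  by [].
under eq_integral do rewrite zvecE// -[X in E m X]add0r.
rewrite (lin_elim indX gaussX' (F := F') (c := fun=> 0)
  (psi := fun z => (expR (E m z))%:E) (u := pvec sigma wd x)).
all: cycle 1.
- exact: incoming_uniq.
- by move=> i; apply: incoming_active.
- exact: mF'.
- exact: F'0.
- exact: oF'.
- by move=> d' T v mv a; under eq_fun do rewrite mxE; exact: measurable_cst.
- by [].
- by move=> i; exact: cmeas_pvec.
- by move=> i; exact: pvec_off.
- exact: mE.
- exact: expE0.
under eq_integral do rewrite EgK.
transitivity (\int[P]_w ((F (V w) * (expR (K m (G (V w) l)))%:E) *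
    (expR (\sum_(i < m) E i (zv (V w) l.+1 i)))%:E))%E.
  by apply: eq_integral => w _; rewrite /F' -!muleA; congr (_ * _)%E; rewrite muleC.
rewrite (IH (fun v => F v * (expR (K m (G v l)))%:E)%E).
- apply: eq_integral => w _; rewrite big_ord_recr/= expRD EFinM -muleA; congr (_ * _)%E.
  by rewrite muleC.
- exact: ltnW.
- by move=> d' T v mv; apply: emeasurable_funM; [exact: mF|exact: mK].
- by move=> v; rewrite mule_ge0// lee_fin expR_ge0.
- by move=> i v v' vv; rewrite (oF i v v' vv) (Gmat_off sigma Cb CW x wd0 vv).
Qed.

Lemma measurable_kp l (psi : 'cV[R]_k -> R) (K : 'M[R]_k -> R) :
  vmeas (fun z => (expR (psi z))%:E) ->
  (forall q s, SCb Cb q -> cov s = q -> Eg s (fun z => (expR (psi z))%:E) 0 = (expR (K q))%:E) ->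
  measurable_fun setT (fun w => K (G (V w) l)).
Proof.
move=> mpsi EK.
have e0 z : (0 <= (expR (psi z))%:E :> \bar R)%E by rewrite lee_fin expR_ge0.
have EgK w : Eg [seq Num.sqrt (pvar Cb CW wd j) *: pvec sigma wd x j (V w) | j <- incoming wd l 0]
      (fun z => (expR (psi z))%:E) 0 = (expR (K (G (V w) l)))%:E.
  by apply: EK; [exact: Gmat_SCb|exact: cov_incoming].
have -> : (fun w => K (G (V w) l)) = fun w => ln (fine (expR (K (G (V w) l)))%:E).
  by apply/funext => w; rewrite /= expRK.
apply: measurableT_comp => //; apply: measurableT_comp => //.
under eq_fun do rewrite -EgK.
apply: (measurable_Eg _ (a := fun j w => Num.sqrt (pvar Cb CW wd j) *: pvec sigma wd x j (V w))
  (x := fun=> 0) mpsi e0) => // j a.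
under eq_fun do rewrite !mxE.
apply: measurable_funM => //; apply: cmeas_pvec => // idx; exact: (measurable_cutoff indX).
Qed.

Lemma measurable_GV l : mx_measurable (fun w => G (V w) l).
Proof. by apply: measurable_Gmat => // idx; exact: (measurable_cutoff indX). Qed.

Lemma layer_elim l (E : nat -> 'cV[R]_k -> R) (K : nat -> 'M[R]_k -> R) g rho :
  (l <= L)%N ->
  (forall i, vmeas (fun z => (expR (E i z))%:E)) ->
  (forall i q s, SCb Cb q -> cov s = q ->
     Eg s (fun z => (expR (E i z))%:E) 0 = (expR (K i q))%:E) ->
  (\int[P]_(w in inball (fun w => G (V w) l) g rho)
     (expR (\sum_(i < wd l.+1) E i (zv (V w) l.+1 i)))%:E =
   \int[P]_(w in inball (fun w => G (V w) l) g rho)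
     (expR (\sum_(i < wd l.+1) K i (G (V w) l)))%:E)%E.
Proof.
move=> lL mE EK; rewrite integral_mkcond [RHS]integral_mkcond.
pose F (v : param -> R) : \bar R := (\1_[set q | ball g rho q] (G v l))%:E.
have := @neuron_elim l E K (wd l.+1) F lL (leqnn _) mE EK.
have e (h : Omega -> R) : (\int[P]_w (F (V w) * (h w)%:E) =
    \int[P]_w ((fun w => (h w)%:E) \_ (inball (fun w => G (V w) l) g rho)) w)%E.
  apply: eq_integral => w _; rewrite /F patchE indicE /inball.
  rewrite (_ : (w \in _) = (G (V w) l \in [set q | ball g rho q])).
    by case: ifP; rewrite ?mul1e ?mul0e.
  by apply/idP/idP; rewrite !inE.
rewrite !e; apply.
- move=> d' T v mv; apply/measurable_EFinP.
  rewrite (_ : (fun t => _) = \1_(inball (fun t => G (fun idx => v idx t) l) g rho)).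
    by apply: measurable_indic; apply: measurable_inball; exact: measurable_Gmat.
  by apply/funext => t; rewrite !indicE; congr (nat_of_bool _)%:R; apply/idP/idP; rewrite !inE.
- by move=> v; rewrite lee_fin.
- by move=> i v v' vv; rewrite /F (Gmat_off sigma Cb CW x wd0 vv).
Qed.

Lemma hidden_model l M : (l < L)%N -> (0 < wd l.+1)%N -> (forall t, `|sigma t| <= M) ->
  mgf_model P (SCb Cb) (@kap R k sigma) (wd l.+1)%:R (fun w => G (V w) l)
    (fun w => CW^-1 *: (G (V w) l.+1 - Cb *: const_mx 1)).
Proof.
move=> lL wl sM.
pose E (eta : 'M[R]_k) (z : 'cV[R]_k) := \sum_a \sum_b eta a b * sigma (z a 0) * sigma (z b 0).
have mE eta : vmeas (fun z => (expR (E eta z))%:E).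
  move=> d' T z mz; apply/measurable_EFinP; apply: measurable_expR_comp.
  have ms a : measurable_fun setT (fun t => sigma (z t a 0)).
    by apply: (measurableT_comp (f := sigma)); [exact: continuous_measurable_fun|exact: mz].
  apply: measurable_sum => a; apply: measurable_sum => b.
  by apply: measurable_funM => //; exact: measurable_funM.
have EK eta q s : SCb Cb q -> cov s = q ->
    Eg s (fun z => (expR (E eta z))%:E) 0 = (expR (kap sigma eta q))%:E.
  by move=> [pq _]; exact: (kap_Eg csigma sM).
split => //.
- split; first exact: measurable_GV.
  move=> a b; under eq_fun do rewrite !mxE.
  apply: measurable_funM => //; apply: measurable_funB => //.
  have := measurable_GV l.+1 a b; by under eq_fun do rewrite !mxE.
- by move=> eta; apply: (measurable_kp l (mE eta)) => q s; exact: EK.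
- by move=> w; exact: Gmat_SCb.
move=> eta g rho.
have := layer_elim g rho (ltnW lL) (fun _ => mE eta) (fun _ => EK eta).
rewrite (eq_integral (fun w => (expR ((wd l.+1)%:R *
  mxdot eta (CW^-1 *: (G (V w) l.+1 - Cb *: const_mx 1))))%:E)).
  move=> ->; apply: eq_integral => w _.
  by rewrite sumr_const card_ord mulr_natl.
move=> w _; congr (expR _)%:E; rewrite Gmat_step// mxdotZr mulrA mulfV ?mul1r ?pnatr_eq0 -?lt0n//.
rewrite /mxdot /E exchange_big /=; apply: eq_bigr => a _; rewrite exchange_big /=.
apply: eq_bigr => b _; rewrite summxE mulr_sumr; apply: eq_bigr => j _.
by rewrite !mxE big_ord1 !mxE mulrA.
Qed.

Lemma output_model (N : R) m : 0 < N -> wd L.+1 = m ->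
  mgf_model P (SCb Cb) (fun (T : 'M[R]_(k, m)) q => \sum_h qform q (col h T) / 2) N
    (fun w => G (V w) L) (fun w => \matrix_(a, h) (zv (V w) L.+1 h a 0 / Num.sqrt N)).
Proof.
move=> N0 wm; subst m.
pose E (t z : 'cV[R]_k) := (t^T *m z) 0 0.
have mE t : vmeas (fun z => (expR (E t z))%:E).
  move=> d' T z mz; apply/measurable_EFinP; apply: measurable_expR_comp.
  under eq_fun do rewrite /E mxE.
  by apply: measurable_sum => a; exact: measurable_funM.
have EK t q s : SCb Cb q -> cov s = q ->
    Eg s (fun z => (expR (E t z))%:E) 0 = (expR (qform q t / 2))%:E.
  by move=> _ <-; rewrite Eg_exp mulmx0 mxE add0r.
split => //.
- exact: ltW.
- split; first exact: measurable_GV.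
  move=> a h; under eq_fun do rewrite mxE.
  apply: measurable_funM => //; apply: measurable_zvec => // idx; exact: (measurable_cutoff indX).
- move=> T; apply: measurable_sum => h.
  exact: (measurable_kp L (mE (col h T)) (K := fun q => qform q (col h T) / 2) (EK _)).
- by move=> w; exact: Gmat_SCb.
move=> T g rho.
pose c (i : nat) : 'cV[R]_k := if insub i is Some h then Num.sqrt N *: col h T else 0.
have cE (h : 'I_(wd L.+1)) : c h = Num.sqrt N *: col h T by rewrite /c valK.
have s0 : 0 < Num.sqrt N by rewrite sqrtr_gt0.
have := layer_elim g rho (leqnn L) (fun i => mE (c i)) (fun i => EK (c i)).
rewrite (eq_integral (fun w => (expR (N * mxdot T
    (\matrix_(a, h) (zv (V w) L.+1 h a 0 / Num.sqrt N))))%:E)); last first.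
  move=> w _; congr (expR _)%:E; rewrite /mxdot exchange_big mulr_sumr/=.
  apply: eq_bigr => h _; rewrite mulr_sumr cE /E mxE; apply: eq_bigr => a _; rewrite !mxE.
  by rewrite -[X in _ = X * _](sqr_sqrtr (ltW N0)); field; exact: lt0r_neq0.
move=> ->; apply: eq_integral => w _; congr (expR _)%:E.
rewrite mulr_sumr; apply: eq_bigr => h _.
by rewrite cE qformZ sqr_sqrtr ?ltW// mulrA.
Qed.

Lemma netZ_cutoff i a w : (i < wd L.+1)%N ->
  netZ sigma wd (fun l i => X (inl (l, i)) w) (fun l i j => X (inr (l, i, j)) w)
    (fun r => x a r) L.+1 i = zv (V w) L.+1 i a 0.
Proof.
move=> iL; rewrite mxE; apply: netZ_ext => //.
  move=> l' i' l1 h1 h2; rewrite cutoffE//; split => //.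
  by case: (ltngtP l' L.+1) l1 => [/h1//|//|e]; rewrite ?andbF// e h2.
move=> l' i' j' l1 h1 h2 jl; rewrite cutoffE//; split => //; split => //.
by case: (ltngtP l' L.+1) l1 => [/h1//|//|e]; rewrite ?andbF// e h2.
Qed.

End NetworkMoments.

(** * From local bounds to the large deviation principle *)

Section ExtendedReals.
Context {R : realType}.

Lemma ereal_between (x y : \bar R) : (x < y)%E -> exists c : R, (x < c%:E)%E /\ (c%:E < y)%E.
Proof.
case: x y => [x||] [y||] //=; rewrite ?lte_fin => xy.
- by exists ((x + y) / 2); rewrite !lte_fin; split; lra.
- by exists (x + 1); rewrite lte_fin ltry; split=> //; lra.
- by exists (y - 1); rewrite lte_fin ltNyr; split=> //; lra.
- by exists 0; rewrite ltry ltNyr.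
Qed.

Lemma limn_esup_le_near (u : nat -> \bar R) a :
  (\forall n \near \oo, (u n <= a)%E) -> (limn_esup u <= a)%E.
Proof.
move=> ua; rewrite /limn_esup /limf_esup.
apply: (le_trans (y := ereal_sup (u @` [set n | (u n <= a)%E]))).
  by apply: ereal_inf_lbound; exists [set n | (u n <= a)%E].
by apply: ge_ereal_sup => _ [n un <-].
Qed.

Lemma limn_einf_ge_near (u : nat -> \bar R) a :
  (\forall n \near \oo, (a <= u n)%E) -> (a <= limn_einf u)%E.
Proof.
move=> ua; rewrite /limn_einf leeNr; apply: limn_esup_le_near.
by apply: filterS ua => n /=; rewrite leeN2.
Qed.

Lemma elog_le (v c : R) (x : \bar R) : 0 < v -> (0 <= x)%E ->
  (x <= (expR (- (v * c)))%:E)%E -> ((v^-1)%:E * elog x <= (- c)%:E)%E.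
Proof.
move=> v0; case: x => [x||]//=; rewrite !lee_fin => x0 xc.
case: ifPn => [_|]; first by rewrite gt0_muleNy ?leNye// lte_fin invr_gt0.
rewrite -ltNge => xp; rewrite -EFinM lee_fin ler_pdivrMl// mulrN -[leRHS]expRK.
by rewrite ler_ln ?posrE ?expR_gt0.
Qed.

Lemma elog_ge (v c : R) (x : \bar R) : 0 < v ->
  ((expR (- (v * c)))%:E <= x)%E -> ((- c)%:E <= (v^-1)%:E * elog x)%E.
Proof.
move=> v0; case: x => [x||]//=; rewrite ?lee_fin => xc; last first.
  by rewrite gt0_muley ?leey// lte_fin invr_gt0.
have xp : 0 < x by apply: lt_le_trans xc; exact: expR_gt0.
rewrite [(x <= 0)%R]lt_geF// -EFinM lee_fin ler_pdivlMl// mulrN -[leLHS]expRK.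
by rewrite ler_ln ?posrE ?expR_gt0.
Qed.

End ExtendedReals.

Section LocalToGlobal.
Context {R : realType} d (Omega : measurableType d) (P : probability Omega R).
Variable v : nat -> R.
Hypothesis v_infty : v @ \oo --> +oo.
Implicit Types (A : nat -> set Omega) (c : R).

Definition expbound A c : Prop :=
  \forall n \near \oo, (P (A n) <= (expR (- (v n * c)))%:E)%E.

Definition expbound_below A c : Prop :=
  \forall n \near \oo, ((expR (- (v n * c)))%:E <= P (A n))%E.

Lemma v_large c : \forall n \near \oo, c <= v n.
Proof. by move/cvgryPge : v_infty; exact. Qed.

Lemma union_bound (T : choiceType) (s : seq T) (A : T -> nat -> set Omega) E c c' :
  c < c' -> (forall n, measurable (E n)) -> (forall i n, measurable (A i n)) ->
  (forall n w, E n w -> exists2 i, i \in s & A i n w) ->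
  (forall i, i \in s -> expbound (A i) c') -> expbound E c.
Proof.
move=> cc mE mA EA Ab.
have H : \forall n \near \oo, (P (\big[setU/set0]_(i <- s) A i n) <=
    ((size s)%:R * expR (- (v n * c')))%:E)%E.
  elim: s Ab {EA} => [|i s IH] Ab.
    by apply: nearW => n; rewrite big_nil measure0 mul0r.
  have Ai : expbound (A i) c' by apply: Ab; rewrite mem_head.
  have {}IH := IH (fun j js => Ab j (mem_behead (s := i :: s) js)).
  near=> n; rewrite big_cons (le_trans (measureU2 _ _ _))//.
    by apply: bigsetU_measurable => j _.
  rewrite /= -add1n natrD mulrDl mul1r EFinD; apply: leeD; near: n; [exact: Ai|exact: IH].
have L : \forall n \near \oo, ln (size s).+1%:R / (c' - c) <= v n by exact: v_large.
near=> n; apply: (le_trans (y := P (\big[setU/set0]_(i <- s) A i n))).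
  apply: le_measure; rewrite ?inE//; first by apply: bigsetU_measurable => i _.
  move=> w /EA[i si Aiw]; rewrite -bigcup_seq; by exists i.
apply: (le_trans (y := ((size s)%:R * expR (- (v n * c')))%:E)); first by near: n.
have s0 : (0 : R) < (size s).+1%:R by rewrite ltr0n.
rewrite lee_fin (@le_trans _ _ ((size s).+1%:R * expR (- (v n * c'))))//.
  by rewrite ler_wpM2r ?expR_ge0// ler_nat.
rewrite -[X in X * _]lnK ?posrE// -expRD ler_expR.
have : ln (size s).+1%:R / (c' - c) <= v n by near: n.
rewrite ler_pdivrMr ?subr_gt0// mulrBr; lra.
Unshelve. all: by end_near. Qed.

Lemma expbound_sub A B c : (forall n, measurable (A n)) -> (forall n, measurable (B n)) ->
  (forall n, A n `<=` B n) -> expbound B c -> expbound A c.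
Proof.
move=> mA mB AB; apply: filterS => n; apply: le_trans.
by apply: le_measure; rewrite ?inE.
Qed.

Lemma expbound_contra A B c c' : (forall n, measurable (A n)) -> (forall n, measurable (B n)) ->
  (forall n, A n `<=` B n) -> c' < c -> expbound B c -> expbound_below A c' -> False.
Proof.
move=> mA mB AB cc uB lA.
have F : \forall n \near \oo, False.
  near=> n.
  have : ((expR (- (v n * c')))%:E <= (expR (- (v n * c)))%:E)%E.
    apply: (le_trans (y := P (B n))); last by near: n.
    apply: (le_trans (y := P (A n))); first by near: n.
    by apply: le_measure; rewrite ?inE.
  rewrite lee_fin ler_expR lerN2 leNgt ltr_pM2l ?cc//.
  by apply: (@lt_le_trans _ _ 1) => //; near: n; exact: v_large.
by have /filter_ex[] := F.
Unshelve. all: by end_near. Qed.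

Lemma ball_cover p r (K : set 'M[R]_(p, r)) (f : 'M[R]_(p, r) -> R) : compact K ->
  (forall z, K z -> 0 < f z) ->
  exists s : seq 'M[R]_(p, r), (forall z, z \in s -> K z) /\
    forall y, K y -> exists2 z, z \in s & ball z (f z) y.
Proof.
rewrite compact_cover => cK f0.
have [|y Ky|D DK KD] := cK _ K (fun z => (ball z (f z))°).
- by move=> z _; exact: open_interior.
- by exists y => //; apply: nbhs_singleton; apply: nbhs_interior; exact/nbhsx_ballx/f0.
- exists (finmap.enum_fset D); split => [z zD|y /KD[z zD]]; first by have := DK _ zD; rewrite inE.
  by move=> /interior_subset; exists z.
Qed.

Section Matrices.
Context {p r : nat}.
Variable Y : nat -> Omega -> 'M[R]_(p, r).
Hypothesis mY : forall n, mx_measurable (Y n).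
Implicit Types (z : 'M[R]_(p, r)).

Definition rat_ball (qi : 'M[rat]_(p, r) * nat) : set 'M[R]_(p, r) :=
  ball (map_mx (@ratr R) qi.1 : 'M[R]_(p, r)) qi.2.+1%:R^-1.

Lemma open_ball_union (O : set 'M[R]_(p, r)) : open O ->
  O = \bigcup_(qi in [set qi | rat_ball qi `<=` O]) rat_ball qi.
Proof.
move=> oO; apply/seteqP; split => [y Oy|y [qi /= qO]]; last exact: qO.
have /nbhs_ballP[e /= e0 eO] : nbhs y O by exact: open_nbhs_nbhs.
have [i ie] : exists i, (i.+1%:R^-1 : R) < e / 2.
  have e2 : 0 < e / 2 by rewrite divr_gt0.
  exists (Num.truncn (e / 2)^-1); rewrite invf_plt ?posrE//.
  by rewrite truncnS_gt.
have i0 : (0 : R) < i.+1%:R^-1 by [].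
have H (a : 'I_p) (b : 'I_r) : exists q : rat, `|ratr q - y a b| < i.+1%:R^-1.
  have ab : y a b - i.+1%:R^-1 < y a b + i.+1%:R^-1 by rewrite ltrD2l (lt_trans _ i0)// oppr_lt0.
  have [q] := rat_in_itvoo ab.
  by rewrite in_itv/= => /andP[q1 q2]; exists q; rewrite ltr_distl q1 q2.
pose q := \matrix_(a < p, b < r) projT1 (cid (H a b)).
have qy : rat_ball (q, i) y.
  by split => // a b; rewrite /ball /= !mxE; case: cid.
exists (q, i) => //= u qu; apply: eO; apply: (@le_ball _ _ _ (i.+1%:R^-1 + i.+1%:R^-1)).
  by rewrite [leRHS]splitr lerD// ltW.
exact: ball_triangle (ball_sym qy) qu.
Qed.

Lemma measurable_preimage_open n (O : set 'M[R]_(p, r)) : open O -> measurable (Y n @^-1` O).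
Proof.
move=> /open_ball_union ->; rewrite preimage_bigcup.
rewrite bigcup_mkcond; apply: countable_bigcupT_measurable => [|qi]; first exact: countableP.
by case: ifP => // _; exact: measurable_inball.
Qed.

Lemma measurable_preimage_closed n (C : set 'M[R]_(p, r)) : closed C -> measurable (Y n @^-1` C).
Proof.
move=> cC; rewrite -[C]setCK preimage_setC; apply: measurableC.
exact: (@measurable_preimage_open n (~` C) (closed_openC cC)).
Qed.

Variable rate : 'M[R]_(p, r) -> \bar R.
Hypothesis rate0 : forall z, (0 <= rate z)%E.
Hypothesis upper : forall z c, (c%:E < rate z)%E ->
  exists2 de, 0 < de & expbound (fun n => inball (Y n) z de) c.
Hypothesis lower : forall z c de, (rate z < c%:E)%E -> 0 < de ->
  expbound_below (fun n => inball (Y n) z de) c.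
Hypothesis tight : forall c, exists B, expbound (fun n => Y n @^-1` ~` mx_box B) c.

Let mball n z de : measurable (inball (Y n) z de).
Proof. exact: measurable_inball. Qed.

(* A point of smaller rate close to [z] would, by [lower], contradict the upper bound at [z]. *)
Lemma rate_lsc : lower_semicontinuous rate.
Proof.
move=> z a az.
have [c [+ cz]] := ereal_between az; rewrite lte_fin => ac.
have [de de0 U] := upper cz.
exists (ball z (de / 2)); first by apply: nbhsx_ballx; rewrite divr_gt0.
move=> y zy; rewrite ltNge; apply/negP => ya.
have e2 : 0 < de / 2 by rewrite divr_gt0.
have lo : expbound_below (fun n => inball (Y n) y (de / 2)) ((a + c) / 2).
  by apply: lower => //; apply: (le_lt_trans ya); rewrite lte_fin; lra.
apply: (expbound_contra _ _ _ _ U lo) => // [n w yw|]; last by lra.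
by rewrite /inball /= [de]splitr; exact: ball_triangle zy yw.
Qed.

Lemma closed_level a : closed [set z | (rate z <= a%:E)%E].
Proof.
rewrite (_ : [set _ | _] = ~` [set z | (a%:E < rate z)%E]); last first.
  by apply/seteqP; split => z /=; rewrite leNgt => /negP.
by apply: open_closedC; have /lower_semicontinuousP := rate_lsc; exact.
Qed.

Lemma compact_level a : compact [set z | (rate z <= a%:E)%E].
Proof.
have [B tB] := tight (a + 2).
apply: (subclosed_compact (@closed_level a) (@compact_mx_box R p r B)) => z za.
apply: contrapT => nBz.
have oB : open (~` (mx_box B : set 'M[R]_(p, r))).
  by apply: closed_openC; apply: compact_closed (@compact_mx_box R p r B) => //; exact: norm_hausdorff.
have /nbhs_ballP[de /= de0 dB] : nbhs z (~` mx_box B) by exact: open_nbhs_nbhs.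
have lo : expbound_below (fun n => inball (Y n) z de) (a + 1).
  by apply: lower => //; apply: (le_lt_trans za); rewrite lte_fin; lra.
apply: (expbound_contra _ _ _ _ tB lo) => //.
- by move=> n; exact: measurable_preimage_open.
- by move=> n w; exact: dB.
- lra.
Qed.

Lemma expbound_closed (C : set 'M[R]_(p, r)) c : closed C ->
  (c%:E < ereal_inf (rate @` C))%E -> expbound (fun n => Y n @^-1` C) c.
Proof.
move=> cC cI.
have [c' [+ c'I]] := ereal_between cI; rewrite lte_fin => cc'.
have [B tB] := tight c'.
have U z : exists de, C z -> 0 < de /\ expbound (fun n => inball (Y n) z de) c'.
  have [Cz|nC] := pselect (C z); last by exists 0.
  have [|de de0 ub] := @upper z c'; last by exists de.
  by apply: (lt_le_trans c'I); apply: ereal_inf_lbound; exists z.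
pose f z := projT1 (cid (U z)).
have fP z : C z -> 0 < f z /\ expbound (fun n => inball (Y n) z (f z)) c'.
  by rewrite /f; case: cid.
have [|z [_ Cz]|s [sK Ks]] := @ball_cover p r (mx_box B `&` C) f.
- by apply: compact_closedI => //; exact: compact_mx_box.
- by case: (fP z Cz).
have oB : open (~` (mx_box B : set 'M[R]_(p, r))).
  by apply: closed_openC; apply: compact_closed (@compact_mx_box R p r B) => //; exact: norm_hausdorff.
apply: (@union_bound _ (None :: [seq Some z | z <- s])
  (fun o n => if o is Some z then inball (Y n) z (f z) else Y n @^-1` ~` mx_box B) _ c c' cc').
- by move=> n; exact: measurable_preimage_closed.
- by move=> [z|] n => //; exact: measurable_preimage_open.
- move=> n w /= Cw; have [Bw|nBw] := pselect (mx_box B (Y n w)); last first.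
    by exists None; rewrite ?mem_head.
  have [z zs zw] := Ks (Y n w) (conj Bw Cw); exists (Some z) => //.
  by rewrite inE map_f.
- move=> i; rewrite inE => /orP[/eqP ->//|/mapP[z /sK [_ Cz] ->]].
  by case: (fP z Cz).
Qed.

Lemma LDP_local : LDP P v Y rate /\ good_rate_function rate.
Proof.
have rf : rate_function rate by split => //; exact: rate_lsc.
split; last by split => // a; exact: compact_level.
split => //; split => [C cC|O oO].
- rewrite leNgt; apply/negP => /ereal_between[c [Ic cl]].
  have /expbound_closed : ((- c)%:E < ereal_inf (rate @` C))%E by rewrite EFinN lteNl.
  move=> /(_ cC) eb; move: cl; rewrite ltNge => /negP; apply.
  apply: limn_esup_le_near; near=> n; rewrite -[c]opprK; apply: elog_le => //.
    by apply: (@lt_le_trans _ _ 1) => //; near: n; exact: v_large.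
  by near: n.
- rewrite leeNl; apply: le_ereal_inf_tmp => _ [z Oz <-].
  rewrite leNgt; apply/negP => /ereal_between[c [zc cl]].
  have /nbhs_ballP[de /= de0 dO] : nbhs z O by exact: open_nbhs_nbhs.
  have lo := lower zc de0.
  move: cl; rewrite ltNge => /negP; apply; rewrite leeNl -EFinN.
  apply: limn_einf_ge_near; near=> n; apply: elog_ge.
    by apply: (@lt_le_trans _ _ 1) => //; near: n; exact: v_large.
  apply: (le_trans (y := P (inball (Y n) z de))); first by near: n.
  apply: le_measure; rewrite ?inE//; first exact: measurable_preimage_open.
  by move=> w; exact: dO.
Unshelve. all: by end_near. Qed.

End Matrices.
End LocalToGlobal.

(** * Propagation of local bounds through a layer *)

Section Propagation.
Context {R : realType} d (Omega : measurableType d) (P : probability Omega R) {k p r : nat}.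
Variable v : nat -> R.
Hypothesis v_infty : v @ \oo --> +oo.
Variable S : set 'M[R]_k.
Variable kp : 'M[R]_(p, r) -> 'M[R]_k -> R.
Variables (N : nat -> R) (X : nat -> Omega -> 'M[R]_k) (Y : nat -> Omega -> 'M[R]_(p, r)).
Hypothesis model : forall n, mgf_model P S kp (N n) (X n) (Y n).
Hypothesis kp_continuous : forall g, S g -> forall eta (e : R), 0 < e ->
  nbhs g (fun q => S q -> `|kp eta q - kp eta g| < e).
Hypothesis kp0 : forall q, kp 0 q = 0.
Variables (I1 : 'M[R]_k -> \bar R) (J : 'M[R]_(p, r) -> 'M[R]_k -> \bar R).
Hypothesis I10 : forall g, (0 <= I1 g)%E.
Hypothesis J0 : forall y g, S g -> (0 <= J y g)%E.

Let mX n : mx_measurable (X n). Proof. by have [_ []] := model n. Qed.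
Let mY n : mx_measurable (Y n). Proof. by have [_ []] := model n. Qed.
Let mXb n g rho : measurable (inball (X n) g rho). Proof. exact: measurable_inball. Qed.
Let mYb n y rho : measurable (inball (Y n) y rho). Proof. exact: measurable_inball. Qed.
Let mXY n g y rho de : measurable (inball (X n) g rho `&` inball (Y n) y de).
Proof. exact: measurableI. Qed.
Let XS n w : S (X n w). Proof. by have [] := model n. Qed.

Section Upper.
Hypothesis U1 : forall g c, S g -> (c%:E < I1 g)%E ->
  exists2 de, 0 < de & expbound P v (fun n => inball (X n) g de) c.
Hypothesis JU : forall y g c2, S g -> 0 <= c2 -> (c2%:E < J y g)%E ->
  exists eta a, a < mxdot eta y - kp eta g /\ \forall n \near \oo, v n * c2 <= N n * a.

Lemma joint_upper y g c : S g -> (c%:E < I1 g + J y g)%E ->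
  exists2 de, 0 < de &
    expbound P v (fun n => inball (X n) g de `&` inball (Y n) y de) c.
Proof.
move=> Sg cIJ; have [cI|Ic] := ltP (c%:E)%E (I1 g).
  have [de de0 U] := U1 Sg cI; exists de => //.
  by apply: expbound_sub U => // n w [].
have U1g c0 := @U1 g c0 Sg; move: Ic cIJ U1g; have := I10 g; case: (I1 g) => [i1||]//=.
rewrite !lee_fin => i10 ic cIJ U1g.
have /ereal_between[c2 [+ c2J]] : ((c - i1)%:E < J y g)%E by rewrite EFinB lte_subel_addl.
rewrite lte_fin => c2i.
have [|de0 de00 U] := U1g (c - c2); first by rewrite lte_fin; lra.
have [|eta [a [aeta Na]]] := JU Sg _ c2J; first lra.
have [de1 de10 H] := @upper_step _ _ _ P _ _ _ S kp g (kp_continuous Sg) eta y a aeta.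
exists (Num.min de0 de1); first by rewrite lt_min de00.
set de := Num.min de0 de1; near=> n.
have h : (P (inball (X n) g de `&` inball (Y n) y de1) <=
    (expR (- (N n * a)))%:E * P (inball (X n) g de))%E.
  by apply: H => //; rewrite ge_min lexx orbT.
apply: (le_trans (y := P (inball (X n) g de `&` inball (Y n) y de1))).
  apply: le_measure; rewrite ?inE//; apply: setIS => w; apply: le_ball.
  by rewrite ge_min lexx orbT.
apply: (le_trans h).
have -> : - (v n * c) = - (v n * c2) + - (v n * (c - c2)) by ring.
rewrite expRD EFinM; apply: lee_pmul => //.
- by rewrite lee_fin ler_expR lerN2; near: n.
- apply: (le_trans (y := P (inball (X n) g de0))); last by near: n.
  apply: le_measure; rewrite ?inE// => w; apply: le_ball.
  by rewrite ge_min lexx.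
Unshelve. all: by end_near. Qed.

Lemma common_radius (T : eqType) (s : seq T) (f : T -> R) : (forall z, z \in s -> 0 < f z) ->
  exists2 de, 0 < de & forall z, z \in s -> de <= f z.
Proof.
elim: s => [|z s IH] fs; first by exists 1.
have [|de de0 H] := IH; first by move=> y ys; apply: fs; rewrite inE ys orbT.
exists (Num.min de (f z)); first by rewrite lt_min de0 fs// mem_head.
move=> y; rewrite inE => /orP[/eqP ->|/H h]; first by rewrite ge_min lexx orbT.
by rewrite ge_min h.
Qed.

Lemma propagate_upper B y c c' : compact (S `&` @mx_box R k k B) ->
  (forall n w, mx_box B (X n w)) -> c < c' ->
  (forall g, S g -> (c'%:E < I1 g + J y g)%E) ->
  exists2 de, 0 < de & expbound P v (fun n => inball (Y n) y de) c.
Proof.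
move=> cK XB cc IJ.
have H g : exists de, S g -> 0 < de /\
    expbound P v (fun n => inball (X n) g de `&` inball (Y n) y de) c'.
  have [Sg|nS] := pselect (S g); last by exists 0.
  by have [de de0 U] := joint_upper Sg (IJ g Sg); exists de.
pose f g := projT1 (cid (H g)).
have fP g : S g -> 0 < f g /\
    expbound P v (fun n => inball (X n) g (f g) `&` inball (Y n) y (f g)) c'.
  by rewrite /f; case: cid.
have [|s [sK Ks]] := @ball_cover R _ _ _ f cK; first by move=> z [/fP[]].
have [|de de0 deP] := @common_radius _ s f; first by move=> z /sK[/fP[]].
exists de => //.
apply: (@union_bound _ _ _ _ _ v_infty _ s
  (fun g n => inball (X n) g (f g) `&` inball (Y n) y (f g)) _ _ _ cc) => //.
- move=> n w Yw; have [g gs Xg] := Ks (X n w) (conj (XS n w) (XB n w)).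
  by exists g => //; split => //; apply: le_ball Yw; exact: deP.
- by move=> g /sK[/fP[]].
Qed.

End Upper.

Section Lower.
Hypothesis L1 : forall g c de, S g -> (I1 g < c%:E)%E -> 0 < de ->
  expbound_below P v (fun n => inball (X n) g de) c.

Definition joint_below y g c2 de : Prop := exists2 rho, 0 < rho &
  \forall n \near \oo, ((expR (- (v n * c2)))%:E * P (inball (X n) g rho) <=
    P (inball (X n) g rho `&` inball (Y n) y de))%E.

Lemma propagate_lower y g c de : S g ->
  (forall c2, (J y g < c2%:E)%E -> joint_below y g c2 de) ->
  (I1 g + J y g < c%:E)%E -> expbound_below P v (fun n => inball (Y n) y de) c.
Proof.
move=> Sg JB; have := I10 g; have := J0 y Sg; have L1g c0 de0 := @L1 g c0 de0 Sg; move: L1g.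
case: (I1 g) => [i1||]//=; case: (J y g) JB => [j||]//= JB L1g.
rewrite !lee_fin => j0 i0; rewrite -EFinD lte_fin => ijc.
pose e := (c - i1 - j) / 2.
have [|rho rho0 H] := JB (j + e); first by rewrite lte_fin /e; lra.
have lo : expbound_below P v (fun n => inball (X n) g rho) (i1 + e).
  by apply: L1g => //; rewrite lte_fin /e; lra.
near=> n.
apply: (le_trans (y := P (inball (X n) g rho `&` inball (Y n) y de))); last first.
  by apply: le_measure; rewrite ?inE//; exact: subIsetr.
apply: (le_trans (y := ((expR (- (v n * (j + e))))%:E * P (inball (X n) g rho))%E)); last first.
  by near: n.
have -> : - (v n * c) = - (v n * (j + e)) + - (v n * (i1 + e)) by rewrite /e; field.
rewrite expRD EFinM lee_pmul2l ?lte_fin ?expR_gt0//.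
by near: n.
Unshelve. all: by end_near. Qed.

Hypothesis N_infty : N @ \oo --> +oo.
Variables C t0 : R.
Hypothesis C0 : 0 <= C.
Hypothesis t00 : 0 < t0.

Lemma joint_below_tilt y g (c0 a c2 de : R) : S g -> 0 < de -> c0 < a ->
  (forall eta, mxdot eta y - kp eta g <= c0) ->
  (forall eta, exists m, quad_bound kp g C t0 eta m) ->
  (\forall n \near \oo, N n * a <= v n * c2) -> joint_below y g c2 de.
Proof.
move=> Sg de0 ca yc qb Na.
have [rho rho0 H] := lower_step P (kp_continuous Sg) kp0 C0 t00 de0 ca yc qb.
exists rho => //; have [N0 HN] := H rho rho0 (lexx _).
have NN : \forall n \near \oo, N0 <= N n by move/cvgryPge : N_infty; exact.
near=> n; apply: le_trans (HN (N n) (X n) (Y n) _ (model n)); last by near: n.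
by rewrite lee_wpmul2r// lee_fin ler_expR lerN2; near: n.
Unshelve. all: by end_near. Qed.

Lemma joint_below_mean m g (c2 de : R) : S g -> 0 < de -> 0 < c2 ->
  quad_bound kp g C t0 0 m -> joint_below m g c2 de.
Proof.
move=> Sg de0 c20 qb.
have [rho rho0 H] := lower_step_mean P (kp_continuous Sg) C0 t00 qb de0.
exists rho => //; have [N0 HN] := H rho rho0 (lexx _).
have NN : \forall n \near \oo, N0 <= N n by move/cvgryPge : N_infty; exact.
have VV : \forall n \near \oo, ln 2 / c2 <= v n by exact: v_large.
near=> n; apply: le_trans (HN (N n) (X n) (Y n) _ (model n)); last by near: n.
rewrite lee_wpmul2r// lee_fin div1r expRN lef_pV2 ?posrE ?expR_gt0//.
have : ln 2 / c2 <= v n by near: n.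
by rewrite ler_pdivrMr// -ler_expR lnK// posrE.
Unshelve. all: by end_near. Qed.

End Lower.
End Propagation.

(** * Rate functions *)

Section CumulantTransform.
Context {R : realType} {k : nat}.
Variable sigma : R -> R.
Hypothesis csigma : continuous sigma.
Variable M : R.
Hypothesis sigmaM : forall t, `|sigma t| <= M.
Implicit Types (eta y q : 'M[R]_k).
Notation kap := (@kap R k sigma).

Lemma kappa_star_ge eta y q : ((mxdot eta y - kap eta q)%:E <= kappa_star sigma y q)%E.
Proof.
by apply: ereal_sup_ubound; exists eta => //; rewrite (kappaE csigma sigmaM) EFinB.
Qed.

Lemma kappa_star_lt (c : R) y q : (c%:E < kappa_star sigma y q)%E ->
  exists eta, c < mxdot eta y - kap eta q.
Proof.
rewrite /kappa_star => /ereal_sup_gt[_ [eta _ <-]].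
by rewrite (kappaE csigma sigmaM) -EFinB lte_fin; exists eta.
Qed.

Lemma kappa_star_ge0 y q : (0 <= kappa_star sigma y q)%E.
Proof.
by have := kappa_star_ge 0 y q; rewrite mxdot0l (kap0 csigma sigmaM) subr0.
Qed.

Lemma kappa_star_gt0 y q : y != ymat sigma q -> (0 < kappa_star sigma y q)%E.
Proof.
apply: contraNT; rewrite -leNgt => k0.
have le eta : mxdot eta y <= kap eta q.
  by rewrite -subr_le0 -lee_fin (le_trans (kappa_star_ge eta y q)).
apply/eqP/matrixP => a b; apply: contrapT => /eqP; rewrite -subr_eq0.
have [m [/(_ erefl) -> H]] := kap_quad csigma sigmaM 0 q.
set D := y a b - _ => D0; pose C : R := 2 * (M ^+ 2) ^+ 2.
have C0 : 0 <= C by rewrite /C mulr_ge0// sqr_ge0.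
have M2 : 0 <= M ^+ 2 by exact: sqr_ge0.
have d0 : 0 <= `|D| * M ^+ 2 by rewrite mulr_ge0.
pose z := C + 1 + 2 * (`|D| * M ^+ 2).
have z0 : 0 < z by rewrite /z; lra.
have := le (0 + (D / z) *: delta_mx a b).
move=> /le_trans/(_ (H a b (D / z) _)).
rewrite mxdot_deltal mxdot0l add0r (kap0 csigma sigmaM) add0r.
have -> : `|D / z| * M ^+ 2 <= 1 / 2.
  rewrite normrM normfV (gtr0_norm z0) mulrAC ler_pdivrMr// /z; lra.
move=> /(_ isT); rewrite -/C -subr_ge0.
rewrite (_ : _ - _ = (D / z) ^+ 2 * (C - z)); last first.
  by rewrite /D; field; exact: lt0r_neq0.
rewrite pmulr_rge0; last by rewrite exprn_even_gt0//= mulf_neq0// invr_neq0// gt_eqF.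
rewrite /z; lra.
Qed.

Lemma kap_nbhs q : psd q -> forall eta (e : R), 0 < e ->
  nbhs q (fun p => psd p -> `|kap eta p - kap eta q| < e).
Proof.
move=> pq eta e e0; have [de de0 H] := kap_continuous csigma sigmaM eta pq e0.
by apply/nbhs_ballP; exists de => // p qp pp; exact: H.
Qed.

Lemma kap_quad_bound q eta : exists m, (eta = 0 -> m = ymat sigma q) /\
  quad_bound kap q (2 * (M ^+ 2) ^+ 2) (1 / (2 * (M ^+ 2 + 1))) eta m.
Proof.
have [m [m0 H]] := kap_quad csigma sigmaM eta q; exists m; split => // a b t tM.
apply: H; have M2 : 0 <= M ^+ 2 by exact: sqr_ge0.
apply: (le_trans (ler_wpM2r M2 tM)).
rewrite mul1r mulrC ler_pdivrMr; lra.
Qed.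

End CumulantTransform.

Section Widths.
Context {R : realType}.
Variables v N : nat -> R.
Variable gam : \bar R.
Hypothesis v_infty : v @ \oo --> +oo.
Hypothesis gam1 : (1 <= gam)%E.
Hypothesis ratio : (fun n => (N n / v n)%:E) @ \oo --> gam.

Lemma ratio_gt (c : R) : (c%:E < gam)%E -> \forall n \near \oo, c * v n <= N n.
Proof.
move=> cg; have v1 := v_large v_infty 1.
have near_c : \forall n \near \oo, (c%:E < (N n / v n)%:E)%E.
  have H : nbhs gam [set x | (c%:E < x)%E].
    by apply: open_nbhs_nbhs; split => //; exact: open_ereal_gt_ereal.
  exact: ratio H.
near=> n.
have v0 : 0 < v n by apply: (@lt_le_trans _ _ 1) => //; near: n.
have : (c%:E < (N n / v n)%:E)%E by near: n.
by rewrite lte_fin ltr_pdivlMr// => /ltW.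
Unshelve. all: by end_near. Qed.

Lemma ratio_lt (c : R) : (gam < c%:E)%E -> \forall n \near \oo, N n <= c * v n.
Proof.
move=> cg; have v1 := v_large v_infty 1.
have near_c : \forall n \near \oo, ((N n / v n)%:E < c%:E)%E.
  have H : nbhs gam [set x | (x < c%:E)%E].
    by apply: open_nbhs_nbhs; split => //; exact: open_ereal_lt_ereal.
  exact: ratio H.
near=> n.
have v0 : 0 < v n by apply: (@lt_le_trans _ _ 1) => //; near: n.
have : ((N n / v n)%:E < c%:E)%E by near: n.
by rewrite lte_fin ltr_pdivrMr// => /ltW.
Unshelve. all: by end_near. Qed.

Lemma width_infty : N @ \oo --> +oo.
Proof.
apply/cvgryPge => A; have vA := v_large v_infty (2 * `|A|).
have : ((1 / 2)%:E < gam)%E by apply: lt_le_trans gam1; rewrite lte_fin; lra.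
move=> /ratio_gt Nv; near=> n.
have Nvn : 1 / 2 * v n <= N n by near: n.
have vAn : 2 * `|A| <= v n by near: n.
apply: (le_trans (ler_norm A)); lra.
Unshelve. all: by end_near. Qed.

End Widths.

Section HiddenRate.
Context {R : realType} {k : nat}.
Variable sigma : R -> R.
Hypothesis csigma : continuous sigma.
Variable M : R.
Hypothesis sigmaM : forall t, `|sigma t| <= M.
Variables (Cb CW : R) (gam : \bar R).
Hypothesis CW0 : 0 < CW.
Hypothesis gam1 : (1 <= gam)%E.
Notation kap := (@kap R k sigma).
Notation J y g := (Jcond sigma Cb CW gam (Cb *: const_mx 1 + CW *: y) g).

Lemma Jcond_ge0 (g' g : 'M[R]_k) : (0 <= Jcond sigma Cb CW gam g' g)%E.
Proof.
have k0 := kappa_star_ge0 csigma sigmaM.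
rewrite /Jcond; case: gam gam1 => [c||]// c1; last by rewrite /Delta; case: ifP.
by apply: mule_ge0 => //; rewrite lee_fin; move: c1; rewrite lee_fin; apply: le_trans.
Qed.

Lemma rescaleK (y : 'M[R]_k) : CW^-1 *: (Cb *: const_mx 1 + CW *: y - Cb *: const_mx 1) = y.
Proof. by rewrite addrAC subrr add0r scalerA mulVf ?scale1r// gt_eqF. Qed.

(* For [gam = +oo] this holds because [kappa_star sigma y g] vanishes only at [ymat sigma g]. *)
Lemma JcondE (y g : 'M[R]_k) : J y g = (gam * kappa_star sigma y g)%E.
Proof.
rewrite /Jcond; case: gam gam1 => [c||]//; rewrite ?rescaleK// => _.
rewrite /Delta; case: eqP => [/addrI/(scalerI (lt0r_neq0 CW0)) ->|ne].
  suff -> : kappa_star sigma (ymat sigma g) g = 0%E by rewrite mule0.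
  apply/eqP; rewrite eq_le (kappa_star_ge0 csigma sigmaM) andbT.
  apply: ge_ereal_sup => _ [eta _ <-].
  by rewrite (kappaE csigma sigmaM) -EFinB lee_fin subr_le0 (kap_jensen csigma sigmaM).
rewrite gt0_mulye// (kappa_star_gt0 csigma sigmaM)//; apply/eqP => e; apply: ne; by rewrite e.
Qed.

Variables v N : nat -> R.
Hypothesis v_infty : v @ \oo --> +oo.
Hypothesis ratio : (fun n => (N n / v n)%:E) @ \oo --> gam.

Lemma hidden_upper (y g : 'M[R]_k) (c2 : R) : 0 <= c2 -> (c2%:E < J y g)%E ->
  exists eta a, a < mxdot eta y - kap eta g /\ \forall n \near \oo, v n * c2 <= N n * a.
Proof.
move=> c20; rewrite JcondE => cJ.
have gam0 : (0 < gam)%E by apply: lt_le_trans gam1; rewrite lte_fin.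
have [eta [a [a0 aeta ca]]] : exists eta (a : R), [/\ 0 < a, a < mxdot eta y - kap eta g &
    (c2%:E < gam * a%:E)%E].
  case E : gam gam1 cJ => [c||]// g1 cJ; last first.
    have /(kappa_star_lt csigma sigmaM)[eta ceta] : (0%:E < kappa_star sigma y g)%E.
      rewrite lt_neqAle (kappa_star_ge0 csigma sigmaM) andbT; apply: contraTN cJ => /eqP <-.
      by rewrite mule0 -leNgt lee_fin.
    exists eta, ((mxdot eta y - kap eta g) / 2); split; [lra|lra|].
    by rewrite gt0_mulye ?ltry// lte_fin; lra.
  have c0 : 0 < c by move: g1; rewrite lee_fin; exact: lt_le_trans.
  have /(kappa_star_lt csigma sigmaM)[eta ceta] : ((c2 / c)%:E < kappa_star sigma y g)%E.
    by rewrite mulrC EFinM lte_pdivrMl.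
  have d0 : 0 <= c2 / c by rewrite divr_ge0// ltW.
  exists eta, ((c2 / c + (mxdot eta y - kap eta g)) / 2); split; [lra|lra|].
  rewrite -EFinM lte_fin -ltr_pdivrMl// mulrC; lra.
exists eta, a; split => //.
have /(ratio_gt v_infty ratio) : ((c2 / a)%:E < gam)%E.
  by rewrite EFinM lte_pdivrMr// .
apply: filterS => n; rewrite -(ler_pM2r a0); apply: le_trans.
by rewrite mulrAC divfK ?gt_eqF// mulrC.
Qed.

Context d (Omega : measurableType d) (P : probability Omega R).
Variables (X Y : nat -> Omega -> 'M[R]_k).
Hypothesis model : forall n, mgf_model P (SCb Cb) kap (N n) (X n) (Y n).

Lemma hidden_lower (y g : 'M[R]_k) (c2 de : R) : SCb Cb g -> 0 < de -> (J y g < c2%:E)%E ->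
  joint_below P v X Y y g c2 de.
Proof.
move=> Sg de0; rewrite JcondE => Jc.
have kc (p : 'M[R]_k) : SCb Cb p -> forall eta (e : R), 0 < e ->
    nbhs p (fun q => SCb Cb q -> `|kap eta q - kap eta p| < e).
  move=> [pg _] eta e e0; apply: filterS (kap_nbhs csigma sigmaM pg eta e0) => q H [pq _].
  exact: H.
have N_infty := width_infty v_infty gam1 ratio.
have C0 : 0 <= 2 * (M ^+ 2) ^+ 2 by rewrite mulr_ge0// sqr_ge0.
have t00 : 0 < 1 / (2 * (M ^+ 2 + 1)).
  by rewrite divr_gt0// mulr_gt0// ltr_wpDl// sqr_ge0.
have kap0' := kap0 csigma sigmaM.
case E : gam gam1 Jc => [c||]// g1 Jc; last first.
  have y0 : y = ymat sigma g.
    apply/eqP; apply: contraTT Jc => /(kappa_star_gt0 csigma sigmaM) ?.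
    by rewrite gt0_mulye// -leNgt leey.
  have c20 : 0 < c2.
    by move: Jc; rewrite -lte_fin; apply: le_lt_trans; rewrite mule_ge0// (kappa_star_ge0 csigma sigmaM).
  have [m [/(_ erefl) em qb]] := kap_quad_bound csigma sigmaM g 0.
  by rewrite y0 -em; exact: (joint_below_mean v_infty model kc N_infty C0 t00 Sg de0 c20 qb).
have c0 : 0 < c by move: g1; rewrite lee_fin; exact: lt_le_trans.
have := fun eta => kappa_star_ge csigma sigmaM eta y g; have := kappa_star_ge0 csigma sigmaM y g.
case: (kappa_star sigma y g) Jc => [s||]// Jc; last first.
  by move: Jc; rewrite gt0_muley// ltNge leey.
rewrite lee_fin => s0 ksub.
move: Jc; rewrite -EFinM lte_fin => cs.
have sc : s < c2 / c by rewrite ltr_pdivlMr// mulrC.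
have tilt := joint_below_tilt (v := v) model kc (kap0' k) N_infty C0 t00 (y := y) (c0 := s)
  (a := (s + c2 / c) / 2) (c2 := c2) Sg de0.
apply: tilt.
- lra.
- by move=> eta; rewrite -lee_fin; exact: ksub.
- by move=> eta; have [m [_ qb]] := kap_quad_bound csigma sigmaM g eta; exists m.
have a0 : 0 < (s + c2 / c) / 2 by lra.
have /(ratio_lt v_infty ratio) : (gam < (c2 / ((s + c2 / c) / 2))%:E)%E.
  rewrite E lte_fin ltr_pdivlMr//.
  by rewrite -ltr_pdivlMl// mulrC; lra.
apply: filterS => n; rewrite -(ler_pM2r a0) => /le_trans; apply.
by rewrite mulrAC divfK ?gt_eqF// mulrC.
Qed.

End HiddenRate.

Section ChainRate.
Context {R : realType} {k : nat}.
Variable sigma : R -> R.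
Hypothesis csigma : continuous sigma.
Variable M : R.
Hypothesis sigmaM : forall t, `|sigma t| <= M.
Variables (Cb CW : R) (L : nat) (gam : nat -> \bar R).
Hypothesis gam1 : forall l, (1 <= l <= L)%N -> (1 <= gam l)%E.
Implicit Types (g : 'M[R]_k) (gs : nat -> 'M[R]_k).
Notation J l g' g := (Jcond sigma Cb CW (gam l) g' g).
Notation I l := (IG sigma Cb CW l gam).

Lemma chain_sum_ge0 l gs : (l <= L)%N -> (0 <= \sum_(1 <= i < l.+1) J i (gs i) (gs i.-1))%E.
Proof.
move=> lL; rewrite big_seq_cond; apply: sume_ge0 => i; rewrite mem_index_iota andbT ltnS => /andP[i1 il].
by apply: (Jcond_ge0 csigma sigmaM); apply: gam1; rewrite i1 (leq_trans il).
Qed.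

Lemma IG_ge0 l g0 g : (l <= L)%N -> (0 <= I l g0 g)%E.
Proof. by move=> lL; apply: le_ereal_inf_tmp => _ [gs _ <-]; exact: chain_sum_ge0. Qed.

Lemma IG_zero g0 : I 0 g0 g0 = 0%E.
Proof.
apply/eqP; rewrite eq_le IG_ge0// andbT; apply: ereal_inf_lbound.
exists (fun=> g0); last by rewrite big_geq.
by split => //; split => // l; rewrite ltn0 andbF.
Qed.

Lemma IG_zero_neq g0 g : g != g0 -> I 0 g0 g = +oo%E.
Proof.
move=> gg; rewrite /IG (_ : [set _ | _ in _] = set0) ?ereal_inf0//.
apply/seteqP; split => // t [gs [e0 [e1 _]] _].
by move/eqP: gg; apply; rewrite -e1.
Qed.

Lemma chain_sum_extend (F : nat -> 'M[R]_k -> 'M[R]_k -> \bar R) gs g l :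
  let gs' i := if i == l.+1 then g else gs i in
  (\sum_(1 <= i < l.+2) F i (gs' i) (gs' i.-1) =
   \sum_(1 <= i < l.+1) F i (gs i) (gs i.-1) + F l.+1 g (gs l))%E.
Proof.
move=> gs'; rewrite big_nat_recr//=; congr (_ + _)%E; last first.
  by rewrite /gs' eqxx (ltn_eqF (ltnSn l)).
apply: eq_big_nat => i /andP[_ il]; rewrite /gs' (ltn_eqF il) ltn_eqF//.
by rewrite (leq_ltn_trans (leq_pred i)).
Qed.

Lemma IG_succ_le l g0 g' g : (l < L)%N -> SCb Cb g' -> (I l.+1 g0 g <= I l g0 g' + J l.+1 g g')%E.
Proof.
move=> lL Sg'.
have J0 : (0 <= J l.+1 g g')%E by apply: (Jcond_ge0 csigma sigmaM); exact: gam1.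
have H gs : gs 0%N = g0 -> gs l = g' -> (forall i, (1 <= i < l)%N -> SCb Cb (gs i)) ->
    (I l.+1 g0 g <= \sum_(1 <= i < l.+1) J i (gs i) (gs i.-1) + J l.+1 g g')%E.
  move=> h0 hl hS; apply: ereal_inf_lbound.
  pose gs' i := if i == l.+1 then g else gs i.
  exists gs'.
    split; first by rewrite /gs'.
    split=> [|i /andP[i1 il]]; first by rewrite /gs' eqxx.
    rewrite /gs' ltn_eqF//; move: il; rewrite ltnS leq_eqVlt => /orP[/eqP ->|il].
      by rewrite hl.
    by apply: hS; rewrite i1.
  by rewrite -hl; exact: (chain_sum_extend (fun i => Jcond sigma Cb CW (gam i))).
case: (J l.+1 g g') J0 H => [j||]// J0 H; last first.
  by rewrite addey ?leey// gt_eqF// (lt_le_trans _ (IG_ge0 _ _ (ltnW lL))).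
rewrite -leeBlDr//; apply: le_ereal_inf_tmp => _ [gs [h0 [hl hS]] <-].
by rewrite leeBlDr//; exact: H.
Qed.

Lemma IG_succ_lt l g0 g (c : \bar R) : (l < L)%N -> SCb Cb g0 -> (I l.+1 g0 g < c)%E ->
  exists2 g', SCb Cb g' & (I l g0 g' + J l.+1 g g' < c)%E.
Proof.
move=> lL S0 /ereal_inf_lt[_ [gs [h0 [hl hS]] <-]].
rewrite big_nat_recr//= hl => lc; exists (gs l).
  by case: l hS {lL hl lc} => [|l] hS; [rewrite h0|apply: hS; rewrite ltnSn].
apply: le_lt_trans lc; apply: leeD => //; apply: ereal_inf_lbound.
exists gs => //; split => //; split => // i /andP[i1 il]; apply: hS.
by rewrite i1 ltnW.
Qed.

End ChainRate.

Section GaussianRate.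
Context {R : realType} {k m : nat}.
Implicit Types (g : 'M[R]_k) (z T r : 'M[R]_(k, m)).

Definition gaussian_rate z g : \bar R :=
  ereal_inf [set (sqnorm r / 2)%:E | r in [set r | msqrt g *m r = z]].

Definition gaussian_cgf T g : R := \sum_h qform g (col h T) / 2.

Lemma sqnorm_ge0 r : 0 <= sqnorm r.
Proof. by apply: sumr_ge0 => a _; apply: sumr_ge0 => h _; exact: sqr_ge0. Qed.

Lemma gaussian_rate_ge0 z g : (0 <= gaussian_rate z g)%E.
Proof.
by apply: le_ereal_inf_tmp => _ [r _ <-]; rewrite lee_fin divr_ge0// sqnorm_ge0.
Qed.

Lemma col_mulmx p (A : 'M[R]_(p, k)) T h : col h (A *m T) = A *m col h T.
Proof. by rewrite !colE mulmxA. Qed.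

Lemma qform_msqrt g T h : psd g -> qform g (col h T) = \sum_a (msqrt g *m T) a h ^+ 2.
Proof.
move=> pg; have [[sT _] ss] := msqrtP pg.
rewrite /qform -{1}ss -{1}sT -!mulmxA mulmxA -trmx_mul -col_mulmx mxE.
by apply: eq_bigr => a _; rewrite !mxE expr2.
Qed.

Lemma mxdot_msqrt g T r : psd g -> mxdot T (msqrt g *m r) = mxdot (msqrt g *m T) r.
Proof.
move=> pg; have [[sT _] _] := msqrtP pg.
rewrite /mxdot exchange_big [RHS]exchange_big/=; apply: eq_bigr => h _.
under eq_bigr do rewrite mxE mulr_sumr.
rewrite exchange_big/=; apply: eq_bigr => b _; rewrite mxE mulr_suml.
by apply: eq_bigr => a _; rewrite -{1}sT mxE; ring.
Qed.

Lemma gaussian_legendre g T r : psd g ->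
  mxdot T (msqrt g *m r) - gaussian_cgf T g <= sqnorm r / 2.
Proof.
move=> pg; rewrite mxdot_msqrt// /gaussian_cgf -mulr_suml.
under eq_bigr do rewrite qform_msqrt//.
rewrite exchange_big/= /mxdot /sqnorm -subr_ge0.
set u := msqrt g *m T.
rewrite (_ : _ - _ = (\sum_a \sum_h (r a h - u a h) ^+ 2) / 2).
  by rewrite divr_ge0// sumr_ge0// => a _; rewrite sumr_ge0// => h _; exact: sqr_ge0.
have -> : \sum_a \sum_h (r a h - u a h) ^+ 2 =
    \sum_a \sum_h r a h ^+ 2 - 2 * (\sum_a \sum_h u a h * r a h) + \sum_a \sum_h u a h ^+ 2.
  rewrite mulr_sumr -sumrB -big_split/=; apply: eq_bigr => a _.
  rewrite mulr_sumr -sumrB -big_split/=; apply: eq_bigr => h _; ring.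
by field.
Qed.

(* If [z = g D^T], the maximiser is [D^T]; otherwise some vector of the kernel of [g] is not
   orthogonal to [z], and the supremum over its multiples is infinite. *)
Lemma gaussian_rate_lt z g (c : R) : psd g -> (c%:E < gaussian_rate z g)%E ->
  exists T, c < mxdot T z - gaussian_cgf T g.
Proof.
move=> pg cz; have [[sT _] ss] := msqrtP pg; have gT : g^T = g by case: pg.
have [/submxP[D zD]|] := boolP (z^T <= g)%MS.
  have ez : z = msqrt g *m (msqrt g *m D^T).
    by rewrite mulmxA ss -[z]trmxK zD trmx_mul gT.
  exists D^T; apply: (@lt_le_trans _ _ (sqnorm (msqrt g *m D^T) / 2)).
    rewrite -lte_fin (lt_le_trans cz)//; apply: ereal_inf_lbound.
    by exists (msqrt g *m D^T).
  rewrite {1}ez mxdot_msqrt// /gaussian_cgf -mulr_suml.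
  under eq_bigr do rewrite qform_msqrt//.
  rewrite exchange_big/= /mxdot /sqnorm.
  under [X in _ <= X - _]eq_bigr do under eq_bigr do rewrite -expr2.
  by rewrite -/(sqnorm (msqrt g *m D^T)); set S := sqnorm _; lra.
rewrite submxE => /eqP/matrixP nz.
have [h [j hj]] : exists h j, (z^T *m cokermx g) h j != 0.
  apply: contrapT => nex; apply: nz => h j; rewrite [RHS]mxE; apply: contrapT => /eqP hj.
  by apply: nex; exists h, j.
pose u := col j (cokermx g).
have gu : g *m u = 0 by rewrite /u colE mulmxA mulmx_coker mul0mx.
pose b := (z^T *m cokermx g) h j.
pose T := ((c + 1) / b) *: (u *m delta_mx 0 h : 'M[R]_(k, m)).
exists T.
have -> : gaussian_cgf T g = 0.
  rewrite /gaussian_cgf big1// => i _.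
  have -> : col i T = ((c + 1) / b * (i == h)%:R) *: u.
    apply/colP => a; rewrite !mxE big_ord1 !mxE eqxx/=.
    by case: (i == h); rewrite /= ?mulr1 ?mulr0 ?mul0r.
  by rewrite qformZ /qform -mulmxA gu mulmx0 mxE mulr0 mul0r.
have -> : mxdot T z = c + 1; last lra.
rewrite mxdotC mxdotZr.
have -> : mxdot z (u *m delta_mx 0 h) = b.
  rewrite /mxdot /b mxE; apply: eq_bigr => a _.
  rewrite (bigD1 h)//= big1 ?addr0; last first.
    by move=> i ih; rewrite !mxE big_ord1 !mxE (negbTE ih) andbF mulr0 mulr0.
  by rewrite !mxE big_ord1 !mxE !eqxx mulr1.
by rewrite divfK.
Qed.

Lemma gaussian_cgf0 g : gaussian_cgf 0 g = 0.
Proof.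
by rewrite /gaussian_cgf big1// => h _; rewrite col0 /qform mulmx0 mxE mul0r.
Qed.

Lemma continuous_gaussian_cgf T : continuous (gaussian_cgf T).
Proof.
apply: (continuous_sumr (T := 'M[R]_k)) => h.
apply: (continuous_mulr (T := 'M[R]_k)); last exact: cst_continuous.
rewrite (_ : (fun g => _) = fun g => \sum_i \sum_j col h T j 0 * g j i * col h T i 0); last first.
  by apply/funext => g; rewrite qformE.
apply: (continuous_sumr (T := 'M[R]_k)) => i; apply: (continuous_sumr (T := 'M[R]_k)) => j.
apply: (continuous_mulr (T := 'M[R]_k)); last exact: cst_continuous.
apply: (continuous_mulr (T := 'M[R]_k)); [exact: cst_continuous|exact: coord_continuous].
Qed.

Lemma gaussian_cgf_nbhs g T (e : R) : 0 < e ->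
  nbhs g (fun q => `|gaussian_cgf T q - gaussian_cgf T g| < e).
Proof.
move=> e0; have /cvgrPdist_lt/(_ e e0) := @continuous_gaussian_cgf T g.
by apply: filterS => q; rewrite distrC.
Qed.

Lemma qform_delta g T h a b (t : R) : g^T = g ->
  qform g (col h (T + t *: delta_mx a b)) = qform g (col h T) +
    (b == h)%:R * (2 * t * (g *m T) a h + t ^+ 2 * g a a).
Proof.
move=> gs.
have -> : col h (T + t *: delta_mx a b) = col h T + (t * (b == h)%:R) *: delta_mx a 0.
  apply/colP => i; rewrite !mxE eqxx andbT (eq_sym h b) -mulrA; congr (_ + _ * _).
  by case: (i == a); case: (b == h); rewrite ?mulr0 ?mulr1.
have D (u w : 'cV[R]_k) : qform g (u + w) = qform g u + 2 * (w^T *m (g *m u)) 0 0 + qform g w.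
  rewrite /qform !(trmxD, mulmxDl, mulmxDr) !mx11D -!mulmxA.
  have -> : (u^T *m (g *m w)) 0 0 = (w^T *m (g *m u)) 0 0.
    by rewrite -mx11T !trmx_mul trmxK gs mulmxA.
  ring.
rewrite D qformZ trmxZ -scalemxAl mx11Z -col_mulmx.
have -> : ((delta_mx a 0 : 'cV[R]_k)^T *m col h (g *m T)) 0 0 = (g *m T) a h.
  by rewrite trmx_delta -rowE !mxE.
have -> : qform g (delta_mx a 0) = g a a.
  by rewrite /qform trmx_delta -rowE -colE !mxE.
by case: (b == h) => /=; ring.
Qed.

Lemma gaussian_quad g T : psd g -> exists p, forall t0,
  quad_bound gaussian_cgf g (\sum_a `|g a a|) t0 T p.
Proof.
move=> pg; exists (g *m T) => t0 a b t _; rewrite /gaussian_cgf.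
under eq_bigr do (rewrite qform_delta ?mulrDl; last by case: pg).
rewrite big_split/= -addrA lerD2l (bigD1 b)//= big1 ?addr0; last first.
  by move=> h hb; rewrite eq_sym (negbTE hb) !mul0r.
rewrite eqxx (_ : true%:R = 1 :> R)// mul1r.
have ga : g a a <= \sum_a `|g a a|.
  rewrite (bigD1 a)//= (le_trans (ler_norm _))// lerDl.
  by apply: sumr_ge0.
have : 0 <= g a a.
  have [_ /(_ (delta_mx a 0))] := pg; by rewrite trmx_delta -rowE -colE !mxE.
have := ler_wpM2r (sqr_ge0 t) ga.
have : 0 <= t ^+ 2 by exact: sqr_ge0.
move: (t ^+ 2) (\sum_a _) => s G s0 sG g0.
have : 0 <= s * g a a by exact: mulr_ge0.
lra.
Qed.

End GaussianRate.

(** * The output layer *)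

Section OutputTail.
Context {R : realType} d (Omega : measurableType d) (P : probability Omega R) {k m : nat}.
Implicit Types (X : Omega -> 'M[R]_k) (Y : Omega -> 'M[R]_(k, m)).

Lemma gaussian_cgf_delta (g : 'M[R]_k) a (b : 'I_m) (t : R) : g^T = g ->
  gaussian_cgf (0 + t *: delta_mx a b) g = t ^+ 2 * g a a / 2.
Proof.
move=> gs; rewrite /gaussian_cgf (bigD1 b)//= big1 ?addr0; last first.
  move=> h hb; rewrite qform_delta// eq_sym (negbTE hb) mul0r addr0.
  by rewrite col0 /qform mulmx0 mxE mul0r.
rewrite qform_delta// eqxx mulmx0 mxE mulr0 add0r col0.
by rewrite {1}/qform mulmx0 mxE add0r mul1r.
Qed.

Lemma tail_bound (S : set 'M[R]_k) (kp : 'M[R]_(k, m) -> 'M[R]_k -> R) N X Y T B (b K : R) :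
  mgf_model P S kp N X Y -> (forall w, mx_box B (X w)) -> (forall w, kp T (X w) <= K) ->
  (P [set w | (b <= mxdot T (Y w))%R] <= (expR (- (N * (b - K))))%:E)%E.
Proof.
move=> [N0 [mX mY] mk _ mgf] XB kK.
have IT : inball X 0 (`|B| + 1) = setT.
  apply/seteqP; split => // w _; split; first by rewrite ltr_wpDl.
  move=> i j; rewrite /ball /= mxE sub0r normrN; apply: (le_lt_trans (XB w i j)).
  by rewrite (le_lt_trans (ler_norm B))// ltrDl.
have mT : measurable_fun setT (fun w => mxdot T (Y w)) by exact: measurable_mxdot.
have mA : measurable [set w | b <= mxdot T (Y w)].
  rewrite (_ : [set w | _] = (fun w => mxdot T (Y w)) @^-1` [set` `[b, +oo[]).
    by rewrite -[X in measurable X]setTI; apply: mT.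
  by apply/seteqP; split => w /=; rewrite in_itv/= andbT.
have me : measurable_fun setT (fun w => expR (N * mxdot T (Y w))).
  by apply: measurable_expR_comp; exact: measurable_funM.
pose c := expR (- (N * b)).
have c0 : 0 <= c by exact: expR_ge0.
have := mgf T 0 (`|B| + 1); rewrite IT => E.
apply: (le_trans (y := (\int[P]_(w in setT) (c * expR (N * mxdot T (Y w)))%:E)%E)).
  apply: (le_trans (y := (\int[P]_(w in [set w | (b <= mxdot T (Y w))%R])
      (c * expR (N * mxdot T (Y w)))%:E)%E)).
    rewrite -[X in (X <= _)%E]mul1e -int_cst//; apply: int_le => //.
      exact: measurable_funM.
    move=> w /= bw; rewrite /c -expRD -[X in X <= _]expR0 ler_expR.
    by rewrite addrC -mulrBr mulr_ge0// subr_ge0.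
  apply: int_subset => //; first exact: measurable_funM.
  by move=> w; rewrite mulr_ge0// expR_ge0.
rewrite int_Zl//.
rewrite [X in (_ * X)%E]E.
apply: (le_trans (y := (c%:E * \int[P]_(w in setT) (expR (N * K))%:E)%E)).
  apply: lee_wpmul2l; first by rewrite lee_fin.
  apply: int_le => //.
  - by apply: measurable_expR_comp; exact: measurable_funM.
  - by move=> w _; rewrite ler_expR ler_wpM2l.
rewrite int_cst// ?expR_ge0// probability_setT mule1 -EFinM lee_fin /c -expRD ler_expR.
by rewrite mulrBr; lra.
Qed.

Variable v : nat -> R.
Hypothesis v_infty : v @ \oo --> +oo.
Variables (S : set 'M[R]_k) (X : nat -> Omega -> 'M[R]_k) (Y : nat -> Omega -> 'M[R]_(k, m)).
Hypothesis S_sym : forall g, S g -> g^T = g.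
Hypothesis model : forall n, mgf_model P S (@gaussian_cgf R k m) (v n) (X n) (Y n).
Variable B : R.
Hypothesis XB : forall n w, mx_box B (X n w).

Lemma output_tight c : exists b, expbound P v (fun n => Y n @^-1` ~` mx_box b) c.
Proof.
pose b := c + 1 + B / 2.
pose A (i : 'I_k * 'I_m * bool) n : set Omega :=
  [set w | b <= mxdot (0 + (-1) ^+ i.2 *: delta_mx i.1.1 i.1.2) (Y n w)].
have mY n : mx_measurable (Y n) by have [_ []] := model n.
have oB : open (~` (mx_box b : set 'M[R]_(k, m))).
  by apply: closed_openC; apply: compact_closed (@compact_mx_box R k m b) => //; exact: norm_hausdorff.
exists b; have cc : c < c + 1 by lra.
apply: (@union_bound _ _ _ P v v_infty _ (enum {: 'I_k * 'I_m * bool}) A _ c (c + 1) cc).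
- by move=> n; exact: measurable_preimage_open.
- move=> i n; have mT := measurable_mxdot (0 + (-1) ^+ i.2 *: delta_mx i.1.1 i.1.2) (mY n).
  rewrite /A (_ : [set w | _] = (fun w => mxdot (0 + (-1) ^+ i.2 *: delta_mx i.1.1 i.1.2) (Y n w))
    @^-1` [set` `[b, +oo[]).
    by rewrite -[X in measurable X]setTI; apply: mT.
  by apply/seteqP; split => w /=; rewrite in_itv/= andbT.
- move=> n w /= nb; have [a [h hb]] : exists a h, b < `|Y n w a h|.
    apply: contrapT => nex; apply: nb => a h; rewrite leNgt; apply/negP => hb.
    by apply: nex; exists a, h.
  exists (a, h, Y n w a h < 0); first by rewrite mem_enum.
  by rewrite /A /= mxdot_deltal mxdot0l add0r -normrEsign ltW.
- move=> i _; apply: nearW => n.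
  have H w : gaussian_cgf (0 + (-1) ^+ i.2 *: delta_mx i.1.1 i.1.2) (X n w) <= B / 2.
    have Ss : S (X n w) by have [] := model n.
    rewrite gaussian_cgf_delta; last exact: S_sym.
    rewrite sqrr_sign mul1r ler_pM2r ?invr_gt0//.
    by rewrite (le_trans (ler_norm _))//; exact: XB.
  apply: le_trans (tail_bound b (model n) (XB n) H) _.
  by rewrite /b addrK.
Qed.

End OutputTail.

Section NetworkLDP.
Context {R : realType}.
Variables (L n0 nL1 : nat) (Cb CW : R) (sigma : R -> R) (nn : nat -> nat -> nat).
Variables (k : nat) (x : 'M[R]_(k, n0)) (lhat : nat) (gam : nat -> \bar R).
Context (d : measure_display) (Omega : measurableType d) (P : probability Omega R).
Variable X : nat -> param -> Omega -> R.
Notation wd n := (width n0 nL1 L nn n).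
Notation v := (fun n => (nn n lhat)%:R : R).
Hypothesis Cb0 : 0 <= Cb.
Hypothesis CW0 : 0 < CW.
Hypothesis nn1 : forall n l, (1 <= l <= L)%N -> (1 <= nn n l)%N.
Hypothesis v_infty : v @ \oo --> +oo.
Hypothesis indX : forall n, mutually_independent P (active L (wd n)) (X n).
Hypothesis gaussX : forall n idx, active L (wd n) idx ->
  centered_gaussian P (X n idx) (pvar Cb CW (wd n) idx).
Hypothesis csigma : continuous sigma.
Variable M : R.
Hypothesis sigmaM : forall t, `|sigma t| <= M.
Hypothesis lhatL : (1 <= lhat <= L)%N.
Hypothesis gam1 : forall l, (1 <= l <= L)%N -> (1 <= gam l)%E.
Hypothesis ratio : forall l, (1 <= l <= L)%N ->
  (fun n => ((nn n l)%:R / (nn n lhat)%:R : R)%:E) @ \oo --> gam l.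

Notation G l := (fun n w => Gmat sigma Cb CW (wd n) x (fun idx => cutoff (active L (wd n)) (X n) idx w) l).
Notation Z := (fun n w => \matrix_(a < k, h < nL1)
  (zvec sigma (wd n) x (fun idx => cutoff (active L (wd n)) (X n) idx w) L.+1 h a 0 / Num.sqrt (v n))).
Notation g0 := (g0mat Cb CW x).
Notation I l := (IG sigma Cb CW l gam g0).

Lemma width_hidden n l : (1 <= l <= L)%N -> wd n l = nn n l.
Proof.
by move=> /andP[l1 lL]; rewrite /width gtn_eqF// ltn_eqF.
Qed.

Lemma g0_SCb : SCb Cb g0.
Proof.
by rewrite -(Gmat0 sigma Cb CW (wd := wd 0) x erefl (fun=> 0)); exact: Gmat_SCb.
Qed.

Definition box_bound : R := Cb + CW * M ^+ 2 + \sum_a \sum_b `|g0 a b|.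

Lemma G_box l n w : mx_box box_bound (G l n w).
Proof.
have s0 : 0 <= \sum_a \sum_b `|g0 a b| by apply: sumr_ge0 => a _; exact: sumr_ge0.
have M0 : 0 <= CW * M ^+ 2 by rewrite mulr_ge0 ?sqr_ge0// ltW.
move=> a b; case: l => [|l]; last first.
  by rewrite (le_trans (Gmat_box _ x Cb0 CW0 _ l a b sigmaM))// /box_bound lerDl.
rewrite Gmat0// /box_bound (@le_trans _ _ (\sum_a \sum_b `|g0 a b|))//; last first.
  by rewrite lerDr addr_ge0.
rewrite (bigD1 a)//= (bigD1 b)//= -addrA lerDl addr_ge0//.
  exact: sumr_ge0.
by apply: sumr_ge0 => i _; exact: sumr_ge0.
Qed.

Lemma layer_model l n : (l < L)%N ->
  mgf_model P (SCb Cb) (@kap R k sigma) (nn n l.+1)%:R (G l n)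
    (fun w => CW^-1 *: (G l.+1 n w - Cb *: const_mx 1)).
Proof.
move=> lL; rewrite -(@width_hidden n l.+1)//.
apply: (hidden_model x csigma (erefl : wd n 0%N = n0) Cb0 CW0 (indX n) (gaussX (n := n)) lL _ sigmaM).
by rewrite width_hidden//; exact: nn1.
Qed.

Lemma inball_rescale (H : Omega -> 'M[R]_k) y (de : R) :
  inball H (Cb *: const_mx 1 + CW *: y) (CW * de) =
  inball (fun w => CW^-1 *: (H w - Cb *: const_mx 1)) y de.
Proof.
apply/seteqP; split => w [de0 h]; (split; first by move: de0; rewrite ?pmulr_rgt0// ).
  move=> a b; have := h a b; rewrite /ball /= !mxE => hab.
  rewrite -(ltr_pM2l CW0) -{1}(gtr0_norm CW0) -normrM mulrBr mulVKf ?gt_eqF//.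
  by rewrite opprB addrA (addrC (CW * _)).
move=> a b; have := h a b; rewrite /ball /= !mxE => hab.
rewrite -(ltr_pM2l CW0) -{1}(gtr0_norm CW0) -normrM mulrBr mulVKf ?gt_eqF// in hab.
by move: hab; rewrite opprB addrA (addrC (CW * _)).
Qed.

Lemma rescale_surj (g : 'M[R]_k) : Cb *: const_mx 1 + CW *: (CW^-1 *: (g - Cb *: const_mx 1)) = g.
Proof. by rewrite scalerA mulfV ?gt_eqF// scale1r addrC subrK. Qed.

Lemma hidden_local l : (l <= L)%N ->
  (forall g c, SCb Cb g -> (c%:E < I l g)%E ->
     exists2 de, 0 < de & expbound P v (fun n => inball (G l n) g de) c) /\
  (forall g c de, SCb Cb g -> (I l g < c%:E)%E -> 0 < de ->
     expbound_below P v (fun n => inball (G l n) g de) c).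
Proof.
elim: l => [_|l IH lL].
  have v0 n : 0 <= v n by [].
  split=> [g c Sg|g c de Sg].
    have [->|gg] := eqVneq g g0.
      rewrite (IG_zero csigma sigmaM Cb CW gam1)// lte_fin => c0; exists 1 => //.
      apply: nearW => n; apply: (le_trans (probability_le1 P _)).
        by apply: measurable_inball; exact: (measurable_GV Cb CW x csigma (indX n)).
      by rewrite lee_fin -[leLHS]expR0 ler_expR oppr_ge0 mulr_ge0_le0// ltW.
    move=> _; have [a [b ab]] : exists a b, g a b != g0 a b.
      apply: contrapT => nex; move/eqP: gg; apply; apply/matrixP => a b.
      by apply: contrapT => /eqP ab; apply: nex; exists a, b.
    exists `|g a b - g0 a b|; first by rewrite normr_gt0 subr_eq0.
    apply: nearW => n; rewrite (_ : inball _ _ _ = set0) ?measure0 ?lee_fin ?expR_ge0//.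
    apply/seteqP; split => // w [_ /(_ a b)]; rewrite /ball/= Gmat0//.
    by rewrite ltxx.
  have [->|gg] := eqVneq g g0; last by rewrite IG_zero_neq.
  rewrite (IG_zero csigma sigmaM Cb CW gam1)// lte_fin => c0 de0.
  apply: nearW => n; rewrite (_ : inball _ _ _ = setT); last first.
    by apply/seteqP; split => // w _; rewrite /inball /= Gmat0//; exact: ballxx.
  by rewrite probability_setT lee_fin -[leRHS]expR0 ler_expR oppr_le0 mulr_ge0// ltW.
have [IHu IHl] := IH (ltnW lL).
have l1 : (1 <= l.+1 <= L)%N by [].
have Jc := @Jcond_ge0 R k sigma csigma M sigmaM Cb CW (gam l.+1) (gam1 l1).
have kc (p : 'M[R]_k) : SCb Cb p -> forall eta (e : R), 0 < e ->
    nbhs p (fun q => SCb Cb q -> `|kap sigma eta q - kap sigma eta p| < e).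
  move=> [pg _] eta e e0; apply: filterS (kap_nbhs csigma sigmaM pg eta e0) => q H [pq _].
  exact: H.
pose N n : R := (nn n l.+1)%:R.
pose Y n w := CW^-1 *: (G l.+1 n w - Cb *: const_mx 1).
have mod n : mgf_model P (SCb Cb) (@kap R k sigma) (N n) (G l n) (Y n) by exact: layer_model.
pose J (y g : 'M[R]_k) := Jcond sigma Cb CW (gam l.+1) (Cb *: const_mx 1 + CW *: y) g.
have J0 y g : SCb Cb g -> (0 <= J y g)%E by move=> _; exact: Jc.
have I0 g : (0 <= I l g)%E by apply: (IG_ge0 csigma sigmaM Cb CW gam1); exact: ltnW.
split=> [g' c Sg'|g' c de Sg'].
  move=> /ereal_between[c' [cc' c'I]]; rewrite lte_fin in cc'.
  pose y := CW^-1 *: (g' - Cb *: const_mx 1).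
  have [] := @propagate_upper _ _ _ P k k k v v_infty _ _ N (G l) Y mod kc (I l) J I0 IHu _
    box_bound y c c' (@compact_SCb_box R k Cb box_bound) (G_box l) cc' _.
  - move=> y' g c2 Sg c20 cJ.
    exact: (hidden_upper csigma sigmaM CW0 (gam1 l1) v_infty (ratio l1) c20 cJ).
  - move=> g Sg; apply: (lt_le_trans c'I); rewrite /J rescale_surj.
    exact: (@IG_succ_le R k sigma csigma M sigmaM Cb CW L gam gam1).
  move=> de de0 U; exists (CW * de); first exact: mulr_gt0.
  by apply: filterS U => n; rewrite -(rescale_surj g') -/y inball_rescale.
move=> Ic de0.
have [g Sg IJ] := IG_succ_lt lL g0_SCb Ic.
pose y := CW^-1 *: (g' - Cb *: const_mx 1).
suff : expbound_below P v (fun n => inball (Y n) y (CW^-1 * de)) c.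
  apply: filterS => n; rewrite -(rescale_surj g') -/y -{2}(mulVKf (lt0r_neq0 CW0) de).
  by rewrite inball_rescale.
apply: (@propagate_lower _ _ _ P k k k v _ _ N (G l) Y mod (I l) J I0 J0 IHl y g) => //.
- move=> c2; apply: (hidden_lower csigma sigmaM CW0 (gam1 l1) v_infty (ratio l1) mod) => //.
  by rewrite mulr_gt0// invr_gt0.
- by rewrite /J rescale_surj.
Qed.

Notation IZ' := (@IZ R sigma Cb CW L gam k n0 nL1 x).

Lemma IZ_ge0 z : (0 <= IZ' z)%E.
Proof.
apply: le_ereal_inf_tmp => _ [g [r [Sg [_ ->]]]].
by rewrite adde_ge0 ?(IG_ge0 csigma sigmaM Cb CW gam1)// lee_fin divr_ge0// sqnorm_ge0.
Qed.

Lemma IZ_le z g : SCb Cb g -> (IZ' z <= I L g + gaussian_rate z g)%E.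
Proof.
move=> Sg; have I0 : (0 <= I L g)%E by exact: (IG_ge0 csigma sigmaM Cb CW gam1).
have H r : msqrt g *m r = z -> (IZ' z <= I L g + (sqnorm r / 2)%:E)%E.
  by move=> gz; apply: ereal_inf_lbound; exists g, r.
case: (I L g) I0 H => [i||]// i0 H; last first.
  rewrite addye ?leey// gt_eqF// (lt_le_trans _ (gaussian_rate_ge0 _ _))//.
rewrite -leeBlDl//; apply: le_ereal_inf_tmp => _ [r gz <-].
by rewrite leeBlDl//; exact: H.
Qed.

Lemma output_LDP : LDP P v Z IZ' /\ good_rate_function (T := 'M[R]_(k, nL1)) IZ'.
Proof.
have [IHu IHl] := hidden_local (leqnn L).
have v0 n : 0 < v n by rewrite ltr0n; exact: nn1.
have wdL n : wd n L.+1 = nL1 by rewrite /width /= eqxx.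
have mod n : mgf_model P (SCb Cb) (@gaussian_cgf R k nL1) (v n) (G L n) (Z n).
  exact: (output_model x csigma (erefl : wd n 0%N = n0) Cb0 CW0 (indX n) (gaussX (n := n)) (v0 n) (wdL n)).
have kc (p : 'M[R]_k) : SCb Cb p -> forall (T : 'M[R]_(k, nL1)) (e : R), 0 < e ->
    nbhs p (fun q => SCb Cb q -> `|gaussian_cgf T q - gaussian_cgf T p| < e).
  move=> _ T e e0; apply: filterS (gaussian_cgf_nbhs p T e0) => q H _; exact: H.
have I0 g : (0 <= I L g)%E by exact: (IG_ge0 csigma sigmaM Cb CW gam1).
apply: (LDP_local v_infty (P := P) (Y := Z)).
- by move=> n; have [_ []] := mod n.
- exact: IZ_ge0.
- move=> z c /ereal_between[c' [cc' c'I]]; rewrite lte_fin in cc'.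
  apply: (@propagate_upper _ _ _ P k k nL1 v v_infty _ _ v (G L) Z mod kc (I L)
    gaussian_rate I0 IHu _ box_bound z c c' (@compact_SCb_box R k Cb box_bound) (G_box L) cc').
  + move=> y g c2 [pg _] c20 /(gaussian_rate_lt pg)[T cT].
    by exists T, c2; split => //; exact: nearW.
  + by move=> g Sg; apply: (lt_le_trans c'I); exact: IZ_le.
- move=> z c de Ic de0; have [_ [g [r [Sg [gz ->]]]] Irc] := ereal_inf_lt Ic.
  apply: (@propagate_lower _ _ _ P k k nL1 v _ _ v (G L) Z mod (I L)
    gaussian_rate I0 (fun y g _ => gaussian_rate_ge0 y g) IHl z g) => //.
    move=> c2 /ereal_inf_lt[_ [r' gz' <-]]; rewrite lte_fin => rc.
    have C0 : 0 <= \sum_a `|g a a| by exact: sumr_ge0.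
    apply: (joint_below_tilt (v := v) mod kc (@gaussian_cgf0 R k nL1) v_infty C0 ltr01 Sg de0 rc).
    + by move=> T; rewrite -gz'; apply: gaussian_legendre; case: Sg.
    + by move=> T; have [|p H] := @gaussian_quad _ _ _ g T; [case: Sg|exists p].
    + exact: nearW.
  apply: le_lt_trans Irc; apply: leeD => //; apply: ereal_inf_lbound.
  by exists r.
- move=> c; apply: (output_tight v_infty (S := SCb Cb) (X := G L) _ mod (G_box L)).
  by move=> g [[]].
Qed.

End NetworkLDP.

Theorem theorem2p1 (R : realType) (L n0 nL1 : nat) (Cb CW : R) (sigma : R -> R)
  (nn : nat -> nat -> nat) (k : nat) (x : 'M[R]_(k, n0))
  (lhat : nat) (gam : nat -> \bar R)
  (d : measure_display) (Omega : measurableType d) (P : probability Omega R)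
  (b : nat -> nat -> nat -> Omega -> R)
  (W : nat -> nat -> nat -> nat -> Omega -> R) :
  (1 <= L)%N -> (1 <= n0)%N -> (1 <= nL1)%N -> 0 <= Cb -> 0 < CW ->
  (* hidden widths n_l(n) >= 1 with n_l(n) -> oo *)
  (forall n l, (1 <= l <= L)%N -> (1 <= nn n l)%N) ->
  (forall l, (1 <= l <= L)%N -> (fun n => (nn n l)%:R : R) @ \oo --> +oo) ->
  (* the network: for each n, independent centered Gaussian biases and weights *)
  (forall n,
     mutually_independent P
       (fun idx : (nat * nat) + (nat * nat * nat) =>
          match idx with
          | inl (l, i) => (1 <= l <= L.+1)%N /\ (i < width n0 nL1 L nn n l)%N
          | inr (l, i, j) => (1 <= l <= L.+1)%N /\ (i < width n0 nL1 L nn n l)%N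
                              /\ (j < width n0 nL1 L nn n l.-1)%N
          end)
       (fun idx => match idx with
                   | inl (l, i) => b n l i
                   | inr (l, i, j) => W n l i j
                   end)) ->
  (forall n l i, (1 <= l <= L.+1)%N -> (i < width n0 nL1 L nn n l)%N ->
     centered_gaussian P (b n l i) Cb) ->
  (forall n l i j, (1 <= l <= L.+1)%N -> (i < width n0 nL1 L nn n l)%N ->
     (j < width n0 nL1 L nn n l.-1)%N ->
     centered_gaussian P (W n l i j) (CW / (width n0 nL1 L nn n l.-1)%:R)) ->
  (* (i) sigma continuous and bounded *)
  continuous sigma -> (exists M : R, forall t, `|sigma t| <= M) ->
  (* (ii) width ratios *)
  (1 <= lhat <= L)%N ->
  (forall l, (1 <= l <= L)%N -> (1 <= gam l)%E) ->
  (forall l, (1 <= l <= L)%N ->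
     (fun n => ((nn n l)%:R / (nn n lhat)%:R : R)%:E) @ \oo --> gam l) ->
  LDP P (fun n => (nn n lhat)%:R)
    (fun n (w : Omega) =>
       \matrix_(a < k, h < nL1)
         (netZ sigma (width n0 nL1 L nn n) (fun l i => b n l i w)
            (fun l i j => W n l i j w) (fun r => x a r) L.+1 h
          / Num.sqrt (nn n lhat)%:R))
    (IZ sigma Cb CW L gam x)
  /\ good_rate_function (T := 'M[R]_(k, nL1)) (IZ sigma Cb CW L gam x).
Proof.
move=> L1 n01 nL11 Cb0 CW0 nn1 nn_infty ind gb gW csigma [M sigmaM] lhatL gam1 ratio.
pose X n (idx : param) : Omega -> R :=
  match idx with inl (l, i) => b n l i | inr (l, i, j) => W n l i j end.
pose wd n := width n0 nL1 L nn n.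
have gX n idx : active L (wd n) idx -> centered_gaussian P (X n idx) (pvar Cb CW (wd n) idx).
  case: idx => [[l i] [l1 iw]|[[l i] j] [l1 [iw jw]]]; first exact: gb.
  exact: gW.
pose Z n w := \matrix_(a < k, h < nL1) (zvec sigma (wd n) x
  (fun idx => cutoff (active L (wd n)) (X n) idx w) L.+1 h a 0 / Num.sqrt (nn n lhat)%:R).
rewrite [Y in LDP P _ Y _](_ : _ = Z).
  exact: (output_LDP x Cb0 CW0 nn1 (nn_infty _ lhatL) ind gX csigma sigmaM lhatL gam1 ratio).
apply/funext => n; apply/funext => w; apply/matrixP => a h; rewrite !mxE.
have hL : (h < wd n L.+1)%N by rewrite /wd /width /= eqxx.
by have := netZ_cutoff sigma x (erefl : wd n 0%N = n0) (X n) a w hL; rewrite mxE => <-.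
Qed.
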